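(* Bounded C2E \textsc{Nondeterministic Constraint Logic} and bounded C2C \textsc{Nondeterministic Constraint Logic} are both fixed-parameter tractable with respect to the parameter $tw+\Delta$, where $tw$ is the treewidth and $\Delta$ the maximum degree of the input constraint graph.
   Context: A constraint graph is an undirected graph with a positive integer weight on every edge and a nonnegative integer weight (its minimum inflow) on every vertex. A legal configuration is an assignment of an orientation to every edge such that for every vertex, the total weight of the edges oriented into that vertex is at least that vertex's minimum inflow. A reconfiguration sequence is a sequence of legal configurations in which each configuration is obtained from the previous one by reversing exactly one edge; it is bounded if every edge is reversed at most once. Bounded C2C NCL: given a constraint graph $G$ and legal configurations $C_1,C_2$, is there a bounded reconfiguration sequence from $C_1$ to $C_2$? Bounded C2E NCL: given a constraint graph $G$, a target edge $e$ and a legal configuration $C_1$, is there a bounded reconfiguration sequence starting at $C_1$ that reverses $e$? *)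

(* Defs.v *)
From mathcomp Require Import all_boot.
From mathcomp Require Import boolp.

Set Implicit Arguments.
Unset Strict Implicit.
Unset Printing Implicit Defensive.

(** * Model of computation

   N. D. Jones' imperative language WHILE over binary trees ("Computability and
   Complexity from a Programming Perspective", MIT Press, 1997), with one atom
   and without tree equality.  Every elementary operation has unit cost; since
   trees are immutable, and hence can be shared, this time measure is
   polynomially equivalent to that of Turing machines. *)

Inductive dtree := Leaf | Node of dtree & dtree.

Fixpoint dsize (d : dtree) : nat :=
  if d is Node a b then (dsize a + dsize b).+1 else 1.

Definition dhd (d : dtree) : dtree := if d is Node a _ then a else Leaf.
Definition dtl (d : dtree) : dtree := if d is Node _ b then b else Leaf.

Inductive expr :=
  | EVar of nat
  | ENil
  | ECons of expr & expr
  | EHd of expr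
  | ETl of expr.

Inductive cmd :=
  | Assign of nat & expr
  | Seq of cmd & cmd
  | If of expr & cmd & cmd
  | While of expr & cmd.

Definition store := nat -> dtree.

Definition upd (s : store) (x : nat) (d : dtree) : store :=
  fun y => if y == x then d else s y.

Fixpoint eval (s : store) (e : expr) : dtree :=
  match e with
  | EVar x => s x
  | ENil => Leaf
  | ECons a b => Node (eval s a) (eval s b)
  | EHd a => dhd (eval s a)
  | ETl a => dtl (eval s a)
  end.

Fixpoint ecost (e : expr) : nat :=
  match e with
  | EVar _ | ENil => 1
  | ECons a b => (ecost a + ecost b).+1
  | EHd a | ETl a => (ecost a).+1
  end.

(* [exec c s t s']: started in the store s, the command c halts in the store s'
   after t time units.  In a test, Leaf is false and any other tree is true. *)
Inductive exec : cmd -> store -> nat -> store -> Prop :=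
  | ExecAssign x e s :
      exec (Assign x e) s (ecost e).+1 (upd s x (eval s e))
  | ExecSeq c1 c2 s s1 s2 t1 t2 :
      exec c1 s t1 s1 -> exec c2 s1 t2 s2 ->
      exec (Seq c1 c2) s (t1 + t2).+1 s2
  | ExecIfTrue e c1 c2 s s1 t :
      eval s e <> Leaf -> exec c1 s t s1 ->
      exec (If e c1 c2) s (ecost e + t).+1 s1
  | ExecIfFalse e c1 c2 s s1 t :
      eval s e = Leaf -> exec c2 s t s1 ->
      exec (If e c1 c2) s (ecost e + t).+1 s1
  | ExecWhileFalse e c s :
      eval s e = Leaf -> exec (While e c) s (ecost e).+1 s
  | ExecWhileTrue e c s s1 s2 t1 t2 :
      eval s e <> Leaf -> exec c s t1 s1 -> exec (While e c) s1 t2 s2 ->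
      exec (While e c) s (ecost e + t1 + t2).+1 s2.

(* Variable 0 is both the input and the output variable. *)
Definition init (d : dtree) : store := upd (fun=> Leaf) 0 d.

Definition runs (p : cmd) (input : dtree) (t : nat) (output : dtree) : Prop :=
  exists2 s, exec p (init input) t s & s 0 = output.

(** * Encodings *)

Definition enc_bool (b : bool) : dtree := if b then Node Leaf Leaf else Leaf.

Fixpoint enc_seq (s : seq dtree) : dtree :=
  if s is d :: s' then Node d (enc_seq s') else Leaf.

(* Naturals are encoded in binary, least significant bit first. *)
Fixpoint pos_bits (p : BinNums.positive) : seq bool :=
  match p with
  | BinNums.xH => [:: true]
  | BinNums.xO q => false :: pos_bits q
  | BinNums.xI q => true :: pos_bits q
  end.

Definition nat_bits (n : nat) : seq bool :=
  if bin_of_nat n is BinNums.Npos p then pos_bits p else [::].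

Definition enc_nat (n : nat) : dtree := enc_seq (map enc_bool (nat_bits n)).

(** * Fixed-parameter tractability *)

Definition computable (f : nat -> nat) : Prop :=
  exists p, forall n, exists t, runs p (enc_nat n) t (enc_nat (f n)).

Record decision_problem := DecisionProblem {
  instance : Type;
  encode : instance -> dtree;
  yes : instance -> Prop
}.

(* One program, a computable f and a constant c such that every instance x is
   decided in time at most f(kappa x) * |x|^c.  The parameter (or a witness for
   it) is not part of the input.  As [dsize] is positive, a bound of the form
   f(k) * |x|^c is as general as f(k) * poly(|x|). *)
Definition fpt (P : decision_problem) (kappa : instance P -> nat) : Prop :=
  exists (p : cmd) (f : nat -> nat) (c : nat), computable f /\
    forall x : instance P, exists (t : nat) (out : dtree),
      [/\ runs p (encode x) t out,
          t <= f (kappa x) * dsize (encode x) ^ c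
        & out <> Leaf <-> yes x].

(** * Graphs, treewidth and maximum degree *)

Record sgraph := SGraph {
  sg_order : nat;
  adj : rel 'I_sg_order;
  adj_sym : symmetric adj;
  adj_irr : irreflexive adj
}.

Notation vertex G := 'I_(sg_order G).

(* The edge {u, v} is represented by the pair (u, v) with u < v. *)
Definition edge (G : sgraph) : Type :=
  {p : vertex G * vertex G | (p.1 < p.2) && adj p.1 p.2}.

Definition max_degree (G : sgraph) : nat :=
  \max_(v : vertex G) #|[set u | adj v u]|.

Definition is_tree (T : sgraph) : Prop :=
  [/\ 0 < sg_order T,
      forall x y : vertex T, connect (@adj T) x y
    & forall c : seq (vertex T), 2 < size c -> ~ ucycle (@adj T) c].

Definition is_tree_decomp (G T : sgraph) (bag : vertex T -> {set vertex G}) :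
    Prop :=
  [/\ is_tree T,
      forall v, exists x, v \in bag x,
      forall u v, adj u v -> exists x, (u \in bag x) && (v \in bag x)
    & forall v x y, v \in bag x -> v \in bag y ->
        connect [rel a b | [&& adj a b, v \in bag a & v \in bag b]] x y].

(* Width is (largest bag size) - 1, here at most k. *)
Definition tw_le (G : sgraph) (k : nat) : Prop :=
  exists (T : sgraph) (bag : vertex T -> {set vertex G}),
    is_tree_decomp bag /\ forall x, #|bag x| <= k.+1.

Lemma tw_le_order (G : sgraph) : exists k, `[< tw_le G k >].
Proof.
exists (sg_order G); apply/asboolP.
pose r := [rel x y : 'I_1 | false].
have rs : symmetric r by [].
have ri : irreflexive r by [].
exists (SGraph rs ri), (fun=> setT); split; last first.
  by move=> _; rewrite cardsT card_ord leqnSn.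
split=> [|v|u v _|v x y _ _]; last by rewrite (ord1 x) (ord1 y) connect0.
- split=> // [x y|[//|x [//|y c]] _]; first by rewrite (ord1 x) (ord1 y) connect0.
  by case/andP.
- by exists ord0; rewrite inE.
- by exists ord0; rewrite !inE.
Qed.

(* The graph without vertices gets treewidth 0. *)
Definition treewidth (G : sgraph) : nat := ex_minn (tw_le_order G).

(** * Constraint graphs and bounded reconfiguration *)

Record cgraph := CGraph {
  graph_of :> sgraph;
  weight : edge graph_of -> nat;
  weight_gt0 : forall e, 0 < weight e;
  inflow : vertex graph_of -> nat
}.

(* For an edge represented by (u, v), true is the orientation u -> v and false
   the orientation v -> u. *)
Definition config (G : cgraph) := {ffun edge G -> bool}.

Definition head_of (G : cgraph) (C : config G) (e : edge G) : vertex G :=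
  if C e then (sval e).2 else (sval e).1.

Definition legal (G : cgraph) (C : config G) : bool :=
  [forall v : vertex G,
     inflow v <= \sum_(e : edge G | head_of C e == v) weight e].

Definition reverse (G : cgraph) (C : config G) (e : edge G) : config G :=
  [ffun e' => if e' == e then ~~ C e' else C e'].

Definition step (G : cgraph) : rel (config G) :=
  fun C D => [exists e : edge G, D == reverse C e].

(* C :: s is the whole sequence. *)
Definition reconf_seq (G : cgraph) (C : config G) (s : seq (config G)) : bool :=
  all (@legal G) (C :: s) && path (@step G) C s.

Definition reversals (G : cgraph) (C : config G) (s : seq (config G))
    (e : edge G) : nat :=
  count (fun CD : config G * config G => CD.1 e != CD.2 e) (zip (C :: s) s).

Definition bounded (G : cgraph) (C : config G) (s : seq (config G)) : Prop :=
  forall e : edge G, reversals C s e <= 1.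

(** * The two decision problems *)

Definition enc_cgraph (G : cgraph) : dtree :=
  Node
    (enc_seq [seq enc_nat (inflow v) | v : vertex G])
    (enc_seq [seq Node (Node (enc_nat (sval e).1) (enc_nat (sval e).2))
                       (enc_nat (weight e)) | e : edge G]).

(* One bit per edge, in the order of the edge list of [enc_cgraph]. *)
Definition enc_config (G : cgraph) (C : config G) : dtree :=
  enc_seq [seq enc_bool (C e) | e : edge G].

Record c2c_instance := C2CInstance {
  c2c_graph : cgraph;
  c2c_src : config c2c_graph;
  c2c_dst : config c2c_graph;
  c2c_src_legal : legal c2c_src;
  c2c_dst_legal : legal c2c_dst
}.

Definition bounded_C2C_NCL : decision_problem := {|
  instance := c2c_instance;
  encode I := Node (enc_cgraph (c2c_graph I))
                   (Node (enc_config (c2c_src I)) (enc_config (c2c_dst I)));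
  yes I := exists s, [/\ reconf_seq (c2c_src I) s, bounded (c2c_src I) s
                       & last (c2c_src I) s = c2c_dst I]
|}.

Record c2e_instance := C2EInstance {
  c2e_graph : cgraph;
  c2e_edge : edge c2e_graph;
  c2e_src : config c2e_graph;
  c2e_src_legal : legal c2e_src
}.

Definition bounded_C2E_NCL : decision_problem := {|
  instance := c2e_instance;
  encode I := Node (enc_cgraph (c2e_graph I))
                   (Node (Node (enc_nat (sval (c2e_edge I)).1)
                               (enc_nat (sval (c2e_edge I)).2))
                         (enc_config (c2e_src I)));
  yes I := exists s, [/\ reconf_seq (c2e_src I) s, bounded (c2e_src I) s
                       & 0 < reversals (c2e_src I) s (c2e_edge I)]
|}.

(* Main.v *)
(* A state of the algorithm is a partition of the vertices into blocks; a block
   carries the set of those orders of reversal of its boundary edges that extend to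
   legal reversals inside the block.  Contracting any set of blocks into one
   preserves the existence of a solution, because two duplicate-free sequences that
   agree on their common letters have a common extension.  So only termination
   depends on the choice of the contracted sets.

   Let [d X] be the number of edges leaving X.  If the treewidth is k and the maximum
   degree is D, then a tree decomposition yields a carving of width w = (k + 1) * D:
   a binary tree of unions of disjoint sets, from the single vertices up to the
   whole graph, in which every set has [d X <= w].  Call a union X of blocks good if
   it consists of more than 3 ^ d X blocks.  A good set of minimal size is titanic:
   whenever it is split in three, some part Y has [d Y >= d X]; and by
   submodularity, contracting a titanic set preserves the existence of a carving of
   width w.  Minimal good sets have at most 2 * 3 ^ w blocks and can be grown from a
   pair of blocks by adding adjacent blocks, which leaves f(w) * n ^ 2 candidates.

   Neither a tree decomposition nor k is computed: the contraction process is
   restarted with more and more fuel N, a bound on the size of all intermediate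
   lists, until it ends with a single block. *)
Require Import Defs.
From mathcomp Require Import all_boot zify.

Set Implicit Arguments.
Unset Strict Implicit.
Unset Printing Implicit Defensive.

(* [have] and [suff] leave the type class instances of a statement unresolved. *)
Notation "!! x" := (ltac:(refine x)) (at level 200, x at level 200, only parsing).

(** The 3 in the definition of good is the number of parts in the definition of titanic: in a
    minimal good set X, a part with fewer boundary edges is not good, so it has at most a third of 3
    ^ d X blocks, and three such parts cannot make up X. Good sets exist for two reasons: the whole
    graph has no boundary edge, so it is good as soon as it has two blocks, and a node of the
    carving with more than 3 ^ w blocks is good as well; the lowest such node has few blocks. The
    obstacle on the machine side is that the program must run in time polynomial in input and fuel
    together on every input, also on those of large treewidth or degree. Hence every list that could
    explode is tested against the fuel before it is kept. Lack of fuel leaves the state as it is or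
    yields no answer, but never a wrong answer, so the search may stop at the first answer. Fuel and
    vertex numbers are unary, whereas weights stay binary. *)

Class Enc (T : Type) := enc : T -> dtree.

#[global] Instance Enc_dtree : Enc dtree := id.
#[global] Instance Enc_unit : Enc unit := fun=> Leaf.
#[global] Instance Enc_bool : Enc bool := enc_bool.
#[global] Instance Enc_prod A B (eA : Enc A) (eB : Enc B) : Enc (A * B) :=
  fun p => Node (enc p.1) (enc p.2).
#[global] Instance Enc_seq A (eA : Enc A) : Enc (seq A) :=
  fun s => enc_seq (map enc s).
(* Unary, so that numbers measure their own size. *)
#[global] Instance Enc_nat : Enc nat := fun n => iter n (Node Leaf) Leaf.

Definition esize A (eA : Enc A) (a : A) : nat := dsize (enc a).
Arguments esize {A eA} a.

Lemma esize_gt0 A {eA : Enc A} (a : A) : 0 < esize a.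
Proof. by rewrite /esize; case: (enc a). Qed.

Lemma esize_pair A B {eA : Enc A} {eB : Enc B} (p : A * B) :
  esize p = (esize p.1 + esize p.2).+1.
Proof. by []. Qed.

Lemma esize_cons A {eA : Enc A} x (s : seq A) :
  esize (x :: s) = (esize x + esize s).+1.
Proof. by []. Qed.

Lemma esize_nat (n : nat) : esize n = n.*2.+1.
Proof. by rewrite /esize; elim: n => //= n IH; rewrite {}IH; lia. Qed.

Lemma esize_bool (b : bool) : esize b <= 3.
Proof. by case: b. Qed.

Lemma esize_seq A {eA : Enc A} (s : seq A) :
  esize s = (\sum_(x <- s) (esize x).+1).+1.
Proof.
elim: s => [|x s IH]; first by rewrite big_nil.
by rewrite esize_cons IH big_cons; lia.
Qed.

Lemma esize_cat A {eA : Enc A} (s t : seq A) :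
  (esize (s ++ t)).+1 = esize s + esize t.
Proof. by rewrite !esize_seq big_cat /=; lia. Qed.

Lemma esize_rev A {eA : Enc A} (s : seq A) : esize (rev s) = esize s.
Proof.
elim: s => // x s IH.
have := !! esize_cat (rev s) [:: x]; rewrite cats1 -rev_cons !esize_cons IH.
by rewrite (_ : esize [::] = 1) //; lia.
Qed.

Lemma esize_take A {eA : Enc A} k (s : seq A) : esize (take k s) <= esize s.
Proof.
have := !! esize_cat (take k s) (drop k s); rewrite cat_take_drop.
by have := !! esize_gt0 (drop k s); lia.
Qed.

Lemma esize_drop A {eA : Enc A} k (s : seq A) : esize (drop k s) <= esize s.
Proof.
have := !! esize_cat (take k s) (drop k s); rewrite cat_take_drop.
by have := !! esize_gt0 (take k s); lia.
Qed.

Lemma esize_filter A {eA : Enc A} (p : pred A) (s : seq A) :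
  esize (filter p s) <= esize s.
Proof. by elim: s => //= x s IH; case: ifP; rewrite !esize_cons; lia. Qed.

Lemma size_esize A {eA : Enc A} (s : seq A) : size s < esize s.
Proof. by elim: s => //= x s IH; rewrite esize_cons; lia. Qed.

Lemma esize_le A {eA : Enc A} (s : seq A) k n :
  size s <= k -> all (fun x => esize x <= n) s -> esize s <= (k * n.+1).+1.
Proof.
elim: s k => [|x s IH] [|k] //= sk /andP[hx hs]; rewrite esize_cons.
by have := IH k sk hs; lia.
Qed.

(** * Polynomial bounds *)

Lemma leq_exp2r_weak m n e : m <= n -> m ^ e <= n ^ e.
Proof. by case: e => // e mn; rewrite leq_exp2r. Qed.


(** Monotonicity lets a bound be applied to an upper estimate of a size instead of the size itself.
    One constant [c] serves as coefficient and exponent, so that the closure properties handle a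
    single witness. *)
Definition polyb (P : nat -> nat) : Prop :=
  {homo P : m n / m <= n} /\ exists c, forall n, P n <= c * n.+1 ^ c.

Lemma polyb_const k : polyb (fun=> k).
Proof.
split=> //; exists k => n; rewrite leq_pmulr //.
by rewrite expn_gt0.
Qed.

Lemma polyb_id : polyb id.
Proof. by split=> //; exists 1 => n; rewrite mul1n expn1. Qed.

Lemma poly_mono a b n c d : a <= c -> b <= d -> a * n.+1 ^ b <= c * n.+1 ^ d.
Proof. by move=> ac bd; rewrite leq_mul // leq_pexp2l. Qed.

Lemma polyb_add P Q : polyb P -> polyb Q -> polyb (fun n => P n + Q n).
Proof.
move=> [mP [c hP]] [mQ [d hQ]]; split=> [m n mn|].
  by rewrite leq_add ?mP ?mQ.
exists (c + d) => n; rewrite mulnDl leq_add //.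
- by apply: leq_trans (hP n) (poly_mono _ _ _); rewrite ?leq_addr.
- by apply: leq_trans (hQ n) (poly_mono _ _ _); rewrite ?leq_addl.
Qed.

Lemma polyb_mul P Q : polyb P -> polyb Q -> polyb (fun n => P n * Q n).
Proof.
move=> [mP [c hP]] [mQ [d hQ]]; split=> [m n mn|].
  by rewrite leq_mul ?mP ?mQ.
exists (c * d + c + d) => n.
apply: leq_trans (leq_mul (hP n) (hQ n)) _.
rewrite mulnACA -expnD; apply: poly_mono; lia.
Qed.

Lemma polyb_comp P Q : polyb P -> polyb Q -> polyb (fun n => P (Q n)).
Proof.
move=> [mP [c hP]] [mQ [d hQ]]; split=> [m n mn|]; first by rewrite mP ?mQ.
exists (c * d.+1 ^ c + d * c) => n.
apply: leq_trans (hP _) _.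
apply: (@leq_trans (c * (d.+1 * n.+1 ^ d) ^ c)).
  rewrite leq_mul // leq_exp2r_weak //.
  by apply: leq_ltn_trans (hQ n) _; rewrite ltn_pmul2r // expn_gt0.
by rewrite expnMn -expnM mulnA; apply: poly_mono; lia.
Qed.

(** * Functions computed by WHILE programs *)

(* The program may use the variables below m as scratch space and leaves the
   others unchanged, which makes programs composable. *)
Definition computes A B (eA : Enc A) (eB : Enc B) (p : cmd) (m : nat)
    (f : A -> B) (T : A -> nat) : Prop :=
  forall a s, s 0 = enc a -> exists t s',
    [/\ exec p s t s', s' 0 = enc (f a), forall y, m <= y -> s' y = s y
      & t <= T a].
Arguments computes {A B eA eB}.

Definition tcomp A B (eA : Enc A) (eB : Enc B) (f : A -> B) (T : A -> nat) :=
  exists p m, computes p m f T.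
Arguments tcomp {A B eA eB}.

Lemma computes_weak A B {eA : Enc A} {eB : Enc B} p m m' (f : A -> B) T T' :
  m <= m' -> (forall a, T a <= T' a) -> computes p m f T -> computes p m' f T'.
Proof.
move=> mm TT H a s s0; have [t [s' [h1 h2 h3 h4]]] := H a s s0.
exists t, s'; split=> // [y my|]; last exact: leq_trans (TT a).
by apply: h3; apply: leq_trans my.
Qed.

Lemma comp_weak A B {eA : Enc A} {eB : Enc B} (f : A -> B) T T' :
  (forall a, T a <= T' a) -> tcomp f T -> tcomp f T'.
Proof.
by move=> TT [p [m H]]; exists p, m; apply: computes_weak H.
Qed.

Lemma comp_ext A B {eA : Enc A} {eB : Enc B} (f g : A -> B) T :
  f =1 g -> tcomp f T -> tcomp g T.
Proof.
move=> fg [p [m H]]; exists p, m => a s s0.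
have [t [s' [h1 h2 h3 h4]]] := H a s s0.
by exists t, s'; split=> //; rewrite -fg.
Qed.

Lemma comp_expr A B {eA : Enc A} {eB : Enc B} (f : A -> B) e :
  (forall a s, s 0 = enc a -> eval s e = enc (f a)) ->
  tcomp f (fun=> (ecost e).+1).
Proof.
move=> H; exists (Assign 0 e), 1 => a s s0.
exists (ecost e).+1, (upd s 0 (eval s e)); split=> //; first exact: ExecAssign.
- by rewrite /upd eqxx; apply: H.
- by case.
Qed.

Lemma comp_comp A B C {eA : Enc A} {eB : Enc B} {eC : Enc C}
    (f : A -> B) (g : B -> C) T U :
  tcomp f T -> tcomp g U -> tcomp (fun a => g (f a)) (fun a => (T a + U (f a)).+1).
Proof.
move=> [p [m Hp]] [q [n Hq]]; exists (Seq p q), (maxn m n) => a s s0.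
have [t [s1 [h1 h2 h3 h4]]] := Hp a s s0.
have [u [s2 [k1 k2 k3 k4]]] := Hq _ s1 h2.
exists (t + u).+1, s2; split=> //; first exact: ExecSeq h1 k1.
  by move=> y; rewrite geq_max => /andP[my ny]; rewrite k3 // h3.
by rewrite ltnS leq_add.
Qed.

Lemma upd_same s x d : upd s x d x = d.
Proof. by rewrite /upd eqxx. Qed.

Lemma upd_other s x d y : y != x -> upd s x d y = s y.
Proof. by rewrite /upd => /negbTE->. Qed.

Lemma comp_pair A B C {eA : Enc A} {eB : Enc B} {eC : Enc C}
    (f : A -> B) (g : A -> C) T U :
  tcomp f T -> tcomp g U ->
  tcomp (fun a => (f a, g a)) (fun a => T a + U a + 20).
Proof.
move=> [p [m Hp]] [q [n Hq]].
(* Two variables above the scratch space of both programs: [x] saves the input, which [p]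
   overwrites, and [y] saves the result of [p] while [q] runs. *)
pose x := (maxn m n).+1; pose y := x.+1.
exists (Seq (Assign x (EVar 0)) (Seq p (Seq (Assign y (EVar 0))
  (Seq (Assign 0 (EVar x)) (Seq q (Assign 0 (ECons (EVar y) (EVar 0)))))))).
exists y.+1 => a s s0.
pose s1 := upd s x (s 0).
have s10 : s1 0 = enc a by [].
have [t [s2 [h1 h2 h3 h4]]] := Hp a s1 s10.
pose s3 := upd s2 y (s2 0); pose s4 := upd s3 0 (s3 x).
have s40 : s4 0 = enc a.
  rewrite /s4 /s3 /upd /= (ltn_eqF (ltnSn x)) h3 ?/s1 /upd ?eqxx //.
  by rewrite /x leqW // leq_maxl.
have [u [s5 [k1 k2 k3 k4]]] := Hq a s4 s40.
have s5y : s5 y = enc (f a).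
  rewrite k3; last by rewrite /y /x !leqW // leq_maxr.
  by rewrite /s4 /s3 /upd /= eqxx.
exists (2 + (t + (2 + (2 + (u + 4).+1).+1).+1).+1).+1, (upd s5 0 (Node (s5 y) (s5 0))).
split.
- apply: ExecSeq (ExecAssign _ _ _) _; apply: ExecSeq h1 _.
  apply: ExecSeq (ExecAssign _ _ _) _; apply: ExecSeq (ExecAssign _ _ _) _.
  by apply: ExecSeq k1 _; apply: (ExecAssign 0 (ECons (EVar y) (EVar 0))).
- by rewrite /upd /= s5y k2.
- move=> z yz; rewrite /upd; have z0 : z == 0 = false by case: z yz.
  rewrite z0 k3; last by rewrite /y /x in yz; lia.
  rewrite /s4 /s3 /upd z0 (gtn_eqF yz) h3; last by rewrite /y /x in yz; lia.
  by rewrite /s1 /upd gtn_eqF //; rewrite /y in yz; lia.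
- lia.
Qed.

Lemma comp_if A B {eA : Enc A} {eB : Enc B}
    (b : A -> bool) (f g : A -> B) Tb T U :
  tcomp b Tb -> tcomp f T -> tcomp g U ->
  tcomp (fun a => if b a then f a else g a)
       (fun a => Tb a + (if b a then T a else U a) + 60).
Proof.
move=> cb [p [m Hp]] [q [n Hq]].
(* The test alone would overwrite the input in variable 0, so it is computed together with a copy of
   the input. *)
have [r [k Hr]] := comp_pair cb (comp_expr (fun a s (e : s 0 = enc a) => e : eval s (EVar 0) = enc (id a))).
exists (Seq r (If (EHd (EVar 0)) (Seq (Assign 0 (ETl (EVar 0))) p)
                              (Seq (Assign 0 (ETl (EVar 0))) q))).
exists (maxn 1 (maxn k (maxn m n))) => a s s0.
have [t [s1 [h1 h2 h3 h4]]] := Hr a s s0.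
pose s2 := upd s1 0 (eval s1 (ETl (EVar 0))).
have s20 : s2 0 = enc a by rewrite /s2 /upd /= h2.
have fr y : maxn 1 (maxn k (maxn m n)) <= y -> [/\ s2 y = s y, m <= y & n <= y].
  rewrite !geq_max => /and4P[y0 ky my ny]; split=> //.
  by rewrite /s2 /upd gtn_eqF // h3.
case eb: (b a).
- have [u [s3 [k1 k2 k3 k4]]] := Hp a s2 s20.
  exists (t + (2 + (3 + u).+1).+1).+1, s3; split=> //.
  + apply: ExecSeq h1 _; apply: ExecIfTrue; first by rewrite /= h2 /= eb.
    by apply: ExecSeq k1; apply: ExecAssign.
  + by move=> y /fr[<- my _]; apply: k3.
  + by rewrite /= in h4; lia.
- have [u [s3 [k1 k2 k3 k4]]] := Hq a s2 s20.
  exists (t + (2 + (3 + u).+1).+1).+1, s3; split=> //.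
  + apply: ExecSeq h1 _; apply: ExecIfFalse; first by rewrite /= h2 /= eb.
    by apply: ExecSeq k1; apply: ExecAssign.
  + by move=> y /fr[<- _ ny]; apply: k3.
  + by rewrite /= in h4; lia.
Qed.

Lemma comp_case A B C {eA : Enc A} {eB : Enc B} {eC : Enc C}
    (g : A -> C) (h : A -> B -> seq B -> C) T U :
  tcomp g T -> tcomp (fun q : A * B * seq B => h q.1.1 q.1.2 q.2) U ->
  tcomp (fun x : A * seq B => if x.2 is b :: r then h x.1 b r else g x.1)
    (fun x => (if x.2 is b :: r then U (x.1, b, r) else T x.1) + 60).
Proof.
move=> [p [m Hp]] [q [n Hq]].
pose dec := ECons (ECons (EHd (EVar 0)) (EHd (ETl (EVar 0)))) (ETl (ETl (EVar 0))).
exists (If (ETl (EVar 0)) (Seq (Assign 0 dec) q) (Seq (Assign 0 (EHd (EVar 0))) p)).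
exists (maxn 1 (maxn m n)) => -[a l] s s0.
have fr v y : maxn 1 (maxn m n) <= y -> [/\ upd s 0 v y = s y, m <= y & n <= y].
  rewrite !geq_max => /and3P[y0 my ny]; split=> //.
  by rewrite /upd gtn_eqF.
case: l s0 => [|b r] s0 /=.
- have [|u [s3 [k1 k2 k3 k4]]] := Hp a (upd s 0 (eval s (EHd (EVar 0)))).
    by rewrite /upd /= s0.
  exists (2 + (3 + u).+1).+1, s3; split=> //.
  + apply: ExecIfFalse; first by rewrite /= s0.
    by apply: ExecSeq k1; apply: ExecAssign.
  + by move=> y my; have [e my1 _] := fr (eval s (EHd (EVar 0))) y my; rewrite k3 // e.
  + lia.
- have [|u [s3 [k1 k2 k3 k4]]] := Hq (a, b, r) (upd s 0 (eval s dec)).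
    by rewrite /upd /= s0.
  exists (2 + ((ecost dec).+1 + u).+1).+1, s3; split=> //.
  + apply: ExecIfTrue; first by rewrite /= s0.
    by apply: ExecSeq k1; apply: ExecAssign.
  + by move=> y my; have [e _ my1] := fr (eval s dec) y my; rewrite k3 // e.
  + by rewrite /=; lia.
Qed.

(** The cost of a round depends on the accumulator reached, so the time follows the fold; a closed
    form needs a bound on all accumulators, as in [foldtime_le]. The 60 is slack for the bookkeeping
    of the loop. *)
Fixpoint foldtime A B C (step : A -> C -> B -> C) (U : A * C * B -> nat) a c
    (l : seq B) : nat :=
  if l is b :: r then U (a, c, b) + 60 + foldtime step U a (step a c b) r else 60.

(** Apart from the search for fuel, this is the only use of [While]: all other iteration is a fold
    over a list. The environment [a] and the rest of the list are kept above the scratch space of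
    the step, the accumulator in variable 0. *)
Lemma comp_loop A B C {eA : Enc A} {eB : Enc B} {eC : Enc C}
    (step : A -> C -> B -> C) U :
  tcomp (fun q : A * C * B => step q.1.1 q.1.2 q.2) U ->
  tcomp (fun x : A * C * seq B => foldl (step x.1.1) x.1.2 x.2)
       (fun x => foldtime step U x.1.1 x.1.2 x.2).
Proof.
move=> [p [n Hn]]; have := computes_weak (leq_maxr 1 n) (fun=> leqnn _) Hn.
have : 0 < maxn 1 n by rewrite leq_maxl.
move: (maxn 1 n) => m {n Hn} m0 Hp.
pose env := m; pose rest := m.+1.
pose body := Seq (Assign 0 (ECons (ECons (EVar env) (EVar 0)) (EHd (EVar rest))))
  (Seq p (Assign rest (ETl (EVar rest)))).
exists (Seq (Assign env (EHd (EHd (EVar 0)))) (Seq (Assign rest (ETl (EVar 0)))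
  (Seq (Assign 0 (ETl (EHd (EVar 0)))) (While (EVar rest) body)))), m.+2.
move=> [[a c] l] s s0.
pose s1 := upd s env (eval s (EHd (EHd (EVar 0)))).
pose s2 := upd s1 rest (eval s1 (ETl (EVar 0))).
pose s3 := upd s2 0 (eval s2 (ETl (EHd (EVar 0)))).
suff [t [s' [h1 h2 h3 h4]]] : exists t s',
    [/\ exec (While (EVar rest) body) s3 t s', s' 0 = @enc C eC (foldl (step a) c l),
      forall y, m.+2 <= y -> s' y = s3 y & t + 40 <= foldtime step U a c l].
  exists (4 + (3 + (4 + t).+1).+1).+1, s'; split=> //.
  - by do 3! [apply: ExecSeq; first exact: ExecAssign].
  - move=> y my; rewrite h3 // /s3 /s2 /s1 /upd.
    by rewrite !gtn_eqF // /rest /env; lia.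
  - by move: h4 => /=; lia.
have env0 : env != 0 by rewrite gtn_eqF.
have restenv : env != rest by rewrite ltn_eqF.
have e1 : s3 env = enc a.
  by rewrite /s3 upd_other // /s2 upd_other // /s1 upd_same /= s0.
have e2 : s3 rest = enc l.
  by rewrite /s3 upd_other // /s2 upd_same /= /s1 upd_other 1?eq_sym // s0.
have e3 : s3 0 = enc c.
  by rewrite /s3 upd_same /= /s2 upd_other // /s1 upd_other 1?eq_sym // s0.
move: s3 e1 e2 e3; clear s s0 s1 s2.
elim: l c => [|b r IH] c s e1 e2 e3.
  exists 2, s; split=> //.
  by apply: (@ExecWhileFalse (EVar rest) body s); rewrite /= e2.
pose s1 := upd s 0 (Node (Node (s env) (s 0)) (dhd (s rest))).
have [|t1 [s2 [h1 h2 h3 h4]]] := Hp (a, c, b) s1.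
  by rewrite /s1 /upd /= e1 e2 e3.
pose s3 := upd s2 rest (dtl (s2 rest)).
have [||| t2 [s4 [k1 k2 k3 k4]]] := IH (step a c b) s3.
- by rewrite /s3 upd_other // h3 // /s1 upd_other.
- by rewrite /s3 upd_same h3 // /s1 upd_other // e2.
- by rewrite /s3 upd_other.
exists (1 + (7 + (t1 + 3).+1).+1 + t2).+1, s4; split=> //.
- apply: (@ExecWhileTrue (EVar rest)) k1; first by rewrite /= e2.
  apply: ExecSeq; first exact: (ExecAssign 0 (ECons (ECons (EVar env) (EVar 0)) (EHd (EVar rest)))).
  by apply: ExecSeq h1 _; apply: (ExecAssign rest (ETl (EVar rest))).
- move=> y my; rewrite k3 // /s3 /upd gtn_eqF // h3; last by lia.
  by rewrite /s1 /upd gtn_eqF //; lia.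
- by rewrite /=; lia.
Qed.

(** No bound on the time: this suffices for the parameter function in [fpt], which only has to be
    computable. *)
Variant CT A B (eA : Enc A) (eB : Enc B) (f : A -> B) : Prop :=
  CTi T of tcomp f T.
Arguments CT {A B eA eB} f.

(** The output size needs a bound of its own: [ECons] shares subtrees, so t steps can build a tree
    of size exponential in t, on which a second polynomial-time function would be too slow. *)
Variant PT A B (eA : Enc A) (eB : Enc B) (f : A -> B) : Prop :=
  PTi P of polyb P & tcomp f (fun a => P (esize a))
         & forall a, esize (f a) <= P (esize a).
Arguments PT {A B eA eB} f.

Lemma dsize_gt0 d : 0 < dsize d. Proof. by case: d. Qed.

Lemma dsize_hd d : dsize (dhd d) <= dsize d.
Proof. by case: d => //= a b; lia. Qed.

Lemma dsize_tl d : dsize (dtl d) <= dsize d.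
Proof. by case: d => //= a b; lia. Qed.

(** Every constructor of [e] contributes at most one copy of the input or one new node. *)
Lemma dsize_eval d e : dsize (eval (init d) e) <= ecost e * dsize d.
Proof.
have d0 := dsize_gt0 d.
elim: e => [x| |a IHa b IHb|a IHa|a IHa] /=; rewrite ?mul1n //.
- by rewrite /init /upd; case: eqP.
- by rewrite mulSn mulnDl; lia.
- by rewrite mulSn; apply: leq_trans (dsize_hd _) _; lia.
- by rewrite mulSn; apply: leq_trans (dsize_tl _) _; lia.
Qed.

Lemma PT_expr A B {eA : Enc A} {eB : Enc B} (f : A -> B) e :
  (forall a s, s 0 = enc a -> eval s e = enc (f a)) -> PT f.
Proof.
move=> H; apply: (@PTi _ _ _ _ _ (fun n => ecost e * n + (ecost e).+1)).
- apply: polyb_add (polyb_const _).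
  by apply: polyb_mul (polyb_const _) polyb_id.
- by apply: comp_weak (comp_expr H) => a; apply: leq_addl.
- move=> a; rewrite /esize -(H a (init (enc a))) //.
  by apply: leq_trans (dsize_eval _ _) (leq_addr _ _).
Qed.

Lemma CT_expr A B {eA : Enc A} {eB : Enc B} (f : A -> B) e :
  (forall a s, s 0 = enc a -> eval s e = enc (f a)) -> CT f.
Proof. by move=> H; apply: (CTi (comp_expr H)). Qed.

Lemma PT_CT A B {eA : Enc A} {eB : Enc B} (f : A -> B) : PT f -> CT f.
Proof. by move=> [P _ cf _]; apply: CTi cf. Qed.

Lemma PT_ext A B {eA : Enc A} {eB : Enc B} (f g : A -> B) :
  f =1 g -> PT f -> PT g.
Proof.
move=> fg [P pP cf sf]; apply: (@PTi _ _ _ _ _ P) => // [|a]; last by rewrite -fg.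
exact: comp_ext fg cf.
Qed.

Lemma CT_ext A B {eA : Enc A} {eB : Enc B} (f g : A -> B) :
  f =1 g -> CT f -> CT g.
Proof. by move=> fg [T cf]; apply: (CTi (comp_ext fg cf)). Qed.

Lemma CT_comp A B C {eA : Enc A} {eB : Enc B} {eC : Enc C}
    (f : A -> B) (g : B -> C) : CT f -> CT g -> CT (fun a => g (f a)).
Proof. by move=> [T cf] [U cg]; apply: (CTi (comp_comp cf cg)). Qed.

Lemma CT_pair A B C {eA : Enc A} {eB : Enc B} {eC : Enc C}
    (f : A -> B) (g : A -> C) : CT f -> CT g -> CT (fun a => (f a, g a)).
Proof. by move=> [T cf] [U cg]; apply: (CTi (comp_pair cf cg)). Qed.

Lemma CT_foldl X B C {eX : Enc X} {eB : Enc B} {eC : Enc C}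
    (step : X -> C -> B -> C) (i : X -> C) (l : X -> seq B) :
  CT (fun q : X * C * B => step q.1.1 q.1.2 q.2) -> CT i -> CT l ->
  CT (fun x => foldl (step x) (i x) (l x)).
Proof.
move=> [T cs] ci cl.
have ct : CT (fun x : X * C * seq B => foldl (step x.1.1) x.1.2 x.2).
  by apply: (CTi (comp_loop cs)).
apply: (CT_comp (f := fun x => ((x, i x), l x))) ct.
apply: CT_pair => //; apply: CT_pair => //.
by apply: (@CT_expr _ _ _ _ _ (EVar 0)).
Qed.


Lemma PT_id {X : Type} {eX : Enc X} : PT (fun x : X => x).
Proof. by apply: (@PT_expr _ _ _ _ _ (EVar 0)). Qed.

Fixpoint expr_of (d : dtree) : expr :=
  if d is Node a b then ECons (expr_of a) (expr_of b) else ENil.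

Lemma eval_expr_of s d : eval s (expr_of d) = d.
Proof. by elim: d => //= a -> b ->. Qed.

Lemma PT_const {X A : Type} {eX : Enc X} {eA : Enc A} (c : A) : PT (fun _ : X => c).
Proof.
by apply: (@PT_expr _ _ _ _ _ (expr_of (enc c))) => a s _; apply: eval_expr_of.
Qed.

Lemma PT_comp {X A B : Type} {eX : Enc X} {eA : Enc A} {eB : Enc B} (f : X -> A) (g : A -> B) : PT f -> PT g -> PT (fun x => g (f x)).
Proof.
move=> [P pP cf sf] [Q pQ cg sg].
apply: (@PTi _ _ _ _ _ (fun n => (P n + Q (P n)) + 1)).
- by apply: polyb_add (polyb_const _); apply: polyb_add; last exact: polyb_comp.
- apply: comp_weak (comp_comp cf cg) => a.
  by rewrite addn1 ltnS leq_add2l; apply: pQ.1.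
- move=> a; apply: leq_trans (sg _) _.
  by apply: leq_trans (pQ.1 _ _ (sf a)) _; lia.
Qed.

Lemma PT_pair {X A B : Type} {eX : Enc X} {eA : Enc A} {eB : Enc B} (f : X -> A) (g : X -> B) :
  PT f -> PT g -> PT (fun x => (f x, g x)).
Proof.
move=> [P pP cf sf] [Q pQ cg sg].
apply: (@PTi _ _ _ _ _ (fun n => P n + Q n + 20)).
- by apply: polyb_add (polyb_const _); apply: polyb_add.
- exact: comp_pair cf cg.
- by move=> a; rewrite esize_pair; have := sf a; have := sg a => /=; lia.
Qed.

Lemma PT_fst {X A B : Type} {eX : Enc X} {eA : Enc A} {eB : Enc B} (f : X -> A * B) : PT f -> PT (fun x => (f x).1).
Proof.
move=> cf; apply: PT_comp cf _.
by apply: (@PT_expr _ _ _ _ _ (EHd (EVar 0))) => a s /= ->.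
Qed.

Lemma PT_snd {X A B : Type} {eX : Enc X} {eA : Enc A} {eB : Enc B} (f : X -> A * B) : PT f -> PT (fun x => (f x).2).
Proof.
move=> cf; apply: PT_comp cf _.
by apply: (@PT_expr _ _ _ _ _ (ETl (EVar 0))) => a s /= ->.
Qed.

Lemma PT_comp2 {X A B C : Type} {eX : Enc X} {eA : Enc A} {eB : Enc B} {eC : Enc C} (op : A -> B -> C) (f : X -> A) (g : X -> B) :
  PT (fun p : A * B => op p.1 p.2) -> PT f -> PT g ->
  PT (fun x => op (f x) (g x)).
Proof.
by move=> cop cf cg; apply: (PT_comp (PT_pair cf cg) cop).
Qed.

Lemma PT_if {X A : Type} {eX : Enc X} {eA : Enc A} (b : X -> bool) (f g : X -> A) :
  PT b -> PT f -> PT g -> PT (fun x => if b x then f x else g x).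
Proof.
move=> [R pR cb sb] [P pP cf sf] [Q pQ cg sg].
apply: (@PTi _ _ _ _ _ (fun n => R n + (P n + Q n) + 60)).
- by apply: polyb_add (polyb_const _); apply: polyb_add => //; apply: polyb_add.
- by apply: comp_weak (comp_if cb cf cg) => a; case: (b a); lia.
- by move=> a; case: (b a); [have := sf a | have := sg a]; lia.
Qed.

Lemma PT_cons {X A : Type} {eX : Enc X} {eA : Enc A} (f : X -> A) (g : X -> seq A) :
  PT f -> PT g -> PT (fun x => f x :: g x).
Proof.
move=> cf cg; apply: (PT_comp (PT_pair cf cg) (g := fun p => p.1 :: p.2)).
by apply: (@PT_expr _ _ _ _ _ (EVar 0)).
Qed.


Lemma PT_case {X B C : Type} {eX : Enc X} {eB : Enc B} {eC : Enc C} (l : X -> seq B) (g : X -> C) (h : X -> B -> seq B -> C) :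
  PT l -> PT g -> PT (fun q : X * B * seq B => h q.1.1 q.1.2 q.2) ->
  PT (fun x => if l x is b :: r then h x b r else g x).
Proof.
move=> cl [P pP cg sg] [Q pQ ch sh].
apply: (PT_comp (f := fun x => (x, l x)) (PT_pair PT_id cl)
  (g := fun x : X * seq B => if x.2 is b :: r then h x.1 b r else g x.1)).
apply: (@PTi _ _ _ _ _ (fun n => Q (n + 2) + P n + 60)).
- apply: polyb_add (polyb_const _); apply: polyb_add => //.
  apply: polyb_comp pQ _; apply: polyb_add (polyb_const _); exact: polyb_id.
- apply: comp_weak (comp_case cg ch) => -[x [|b r]] /=.
    rewrite leq_add2r; apply: leq_trans _ (leq_addl _ _).
    by apply: pP.1; rewrite esize_pair /=; lia.
  rewrite !leq_add2r; apply: leq_trans _ (leq_addr _ _); apply: pQ.1.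
  by rewrite !esize_pair /= esize_cons; lia.
- move=> [x [|b r]] /=; rewrite esize_pair /=.
    apply: leq_trans (sg x) _; rewrite -addnA addnCA; apply: leq_trans _ (leq_addr _ _).
    by apply: pP.1; lia.
  apply: leq_trans (sh (x, b, r)) _; rewrite -addnA; apply: leq_trans _ (leq_addr _ _).
  by apply: pQ.1; rewrite !esize_pair /= esize_cons; lia.
Qed.

Lemma foldtime_le {X B C : Type} (step : X -> C -> B -> C) U a c l M :
  (forall l1 b l2, l = l1 ++ b :: l2 -> U (a, foldl (step a) c l1, b) <= M) ->
  foldtime step U a c l <= size l * (M + 60) + 60.
Proof.
elim: l c => //= b l IH c H.
have h1 := H [::] b l erefl.
have h2 := IH (step a c b) (fun l1 b' l2 e => H (b :: l1) b' l2 (congr1 (cons b) e)).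
rewrite mulSn; move: h1 h2 => /=; lia.
Qed.

(** Bounded recursion in the style of Cobham: a polynomial-time step is not enough, since its
    iteration may double the accumulator every time. The bound is required after every prefix of the
    list, because each intermediate accumulator is an input of the step. *)
Lemma PT_foldl {X B C : Type} {eX : Enc X} {eB : Enc B} {eC : Enc C} P (step : X -> C -> B -> C) (i : X -> C) (l : X -> seq B) :
  PT (fun q : X * C * B => step q.1.1 q.1.2 q.2) -> PT i -> PT l -> polyb P ->
  (forall x k, esize (foldl (step x) (i x) (take k (l x))) <= P (esize x)) ->
  PT (fun x => foldl (step x) (i x) (l x)).
Proof.
move=> [U pU cs ss] [Q pQ ci si] [R pR cl sl] pP H.
have cid := @comp_expr X X eX eX (fun x => x) (EVar 0) (fun a s e => e).
have ce := comp_pair (comp_pair cid ci) cl.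
have cc := comp_comp ce (comp_loop cs).
pose W n := R n * (U (n + P n + R n + 2) + 60) + 60.
apply: (@PTi _ _ _ _ _ (fun n => (2 + Q n + 20 + R n + 20 + W n) + 1 + P n)).
- have pW : polyb W.
    apply: polyb_add (polyb_const _); apply: polyb_mul => //.
    apply: polyb_add (polyb_const _); apply: polyb_comp pU _.
    do ?[apply: polyb_add; rewrite //; try exact: polyb_const]; exact: polyb_id.
  do ?[apply: polyb_add; rewrite //; try exact: polyb_const]; exact: polyb_id.
- apply: comp_weak cc => x /=; rewrite addn1; apply: leq_trans _ (leq_addr _ _).
  rewrite ltnS leq_add2l.
  apply: leq_trans (foldtime_le (M := U (esize x + P (esize x) + R (esize x) + 2)) _) _.
    move=> l1 b l2 e; apply: pU.1; rewrite !esize_pair /=.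
    have := H x (size l1); rewrite e take_size_cat // => h1.
    have := sl x; rewrite e => h2.
    have := !! esize_cat l1 (b :: l2); rewrite esize_cons.
    by have := !! esize_gt0 l1; lia.
  rewrite leq_add2r leq_mul2r; apply/orP; right.
  by have := sl x; have := !! size_esize (l x); lia.
- move=> x; have := H x (size (l x)); rewrite take_size; lia.
Qed.

(** * A library of polynomial-time functions *)

Ltac poly := repeat first [assumption | apply: polyb_id | apply: polyb_const
  | apply: polyb_add | apply: polyb_mul
  | match goal with [H : polyb _ |- _] => apply: (polyb_comp H) end].

(** Hooks that are redefined by [::=] whenever closure lemmas become available, so that [pt] can
    decompose a function along its syntax. *)
Ltac pt_alg := fail.
Ltac pt_num := fail.
Ltac pt_seq := fail.
Ltac pt_mem := fail.
Ltac pt_list := fail.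
Ltac pt_nat := fail.
Ltac pt_bool := fail.
Ltac pt_step := first
  [ assumption | exact: PT_id | exact: PT_const | pt_alg | pt_num | pt_seq | pt_mem
  | pt_list | pt_nat | pt_bool
  | apply PT_pair | apply PT_cons | apply PT_if | apply PT_case
  | apply PT_fst | apply PT_snd
  | match goal with [H : PT ?f |- PT (fun x => ?f (@?g x))] =>
      refine (PT_comp (f := g) (g := f) _ H) end ].
Ltac pt := cbv beta; repeat (pt_step; cbv beta).

Section Rev.
Context {X A : Type} {eX : Enc X} {eA : Enc A}.

Lemma foldl_catrev (s t : seq A) : foldl (fun c b => b :: c) t s = catrev s t.
Proof. by elim: s t => //= x s IH t; rewrite IH. Qed.

Lemma PT_catrev (f g : X -> seq A) :
  PT f -> PT g -> PT (fun x => catrev (f x) (g x)).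
Proof.
move=> cf cg; have [P pP _ sf] := cf; have [Q pQ _ sg] := cg.
apply: (PT_ext (f := fun x => foldl (fun c b => b :: c) (g x) (f x))).
  by move=> x; rewrite foldl_catrev.
apply: (@PT_foldl _ _ _ _ _ _ (fun n => P n + Q n)); try by [pt | poly].
move=> x k; rewrite foldl_catrev catrevE.
have := !! esize_cat (rev (take k (f x))) (g x); rewrite esize_rev.
by have := !! esize_take k (f x); have := sf x; have := sg x; lia.
Qed.

Lemma PT_rev (f : X -> seq A) : PT f -> PT (fun x => rev (f x)).
Proof. by move=> cf; apply: PT_catrev; pt. Qed.

Lemma PT_cat (f g : X -> seq A) :
  PT f -> PT g -> PT (fun x => f x ++ g x).
Proof.
move=> cf cg; apply: (PT_ext (f := fun x => catrev (rev (f x)) (g x))).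
  by move=> x; rewrite catrevE revK.
by apply: PT_catrev => //; apply: PT_rev.
Qed.

End Rev.

Section Map.
Context {X A B : Type} {eX : Enc X} {eA : Enc A} {eB : Enc B}.

Lemma foldl_map (h : A -> B) s t :
  foldl (fun c b => h b :: c) t s = catrev (map h s) t.
Proof. by elim: s t => //= x s IH t; rewrite IH. Qed.

Lemma esize_map_le (h : A -> B) (s : seq A) M :
  (forall a l r, s = l ++ a :: r -> esize (h a) <= M) ->
  esize (map h s) <= (size s * M.+1).+1.
Proof.
elim: s => //= a s IH H; rewrite esize_cons.
have := H a [::] s erefl; have := IH (fun b l r e => H b (a :: l) r (congr1 (cons a) e)).
by rewrite mulSn; lia.
Qed.

Lemma PT_map (h : X -> A -> B) (l : X -> seq A) :
  PT (fun p : X * A => h p.1 p.2) -> PT l -> PT (fun x => map (h x) (l x)).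
Proof.
move=> ch cl; have [P pP _ sh] := ch; have [Q pQ _ sl] := cl.
apply: (PT_ext (f := fun x => rev (foldl (fun c b => h x b :: c) [::] (l x)))).
  by move=> x; rewrite foldl_map catrevE cats0 revK.
apply: PT_rev.
apply: (@PT_foldl _ _ _ _ _ _ (fun n => (Q n * (P (n + Q n + 1) + 1)) + 1)); try by [pt | poly].
  pt; apply: (PT_comp2 (op := h)); pt.
move=> x k; rewrite foldl_map catrevE cats0 esize_rev map_take.
apply: leq_trans (esize_take _ _) _.
apply: leq_trans (esize_map_le (M := P (esize x + Q (esize x) + 1)) _) _.
  move=> a s r e; apply: leq_trans (sh (x, a)) _; apply: pP.1.
  have := sl x; rewrite esize_pair e /=.
  have := !! esize_cat s (a :: r); rewrite esize_cons.
  by have := !! esize_gt0 s; lia.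
rewrite !addn1 ltnS leq_mul2r; apply/orP; right.
by have := !! size_esize (l x); have := sl x; lia.
Qed.
End Map.

Ltac pt_list ::= first [apply PT_map | apply PT_rev | apply PT_cat].

Section Flatten.
Context {X A : Type} {eX : Enc X} {eA : Enc A}.

Lemma esize_flatten (ss : seq (seq A)) : esize (flatten ss) <= esize ss.
Proof.
elim: ss => //= s ss IH; rewrite esize_cons.
by have := !! esize_cat s (flatten ss); lia.
Qed.

Lemma PT_flatten (f : X -> seq (seq A)) : PT f -> PT (fun x => flatten (f x)).
Proof.
move=> cf; have [P pP _ sf] := cf.
have E (ss : seq (seq A)) t : foldl (fun c s => catrev s c) t ss = catrev (flatten ss) t.
  by elim: ss t => //= s ss IH t; rewrite IH !catrevE rev_cat catA.
apply: (PT_ext (f := fun x => rev (foldl (fun c s => catrev s c) [::] (f x)))).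
  by move=> x; rewrite E catrevE cats0 revK.
pt; apply: (@PT_foldl _ _ _ _ _ _ P) => //; try by pt.
  by apply: PT_catrev; pt.
move=> x k; rewrite E catrevE cats0 esize_rev.
apply: leq_trans (esize_flatten _) _.
by apply: leq_trans (esize_take _ _) (sf x).
Qed.

Lemma PT_filter (p : X -> A -> bool) (l : X -> seq A) :
  PT (fun q : X * A => p q.1 q.2) -> PT l ->
  PT (fun x => filter (p x) (l x)).
Proof.
move=> cp cl.
apply: (PT_ext (f := fun x => flatten (map (fun a => if p x a then [:: a] else [::]) (l x)))).
  by move=> x; elim: (l x) => //= a s <-; case: (p x a).
by apply: PT_flatten; pt.
Qed.

Lemma PT_has (p : X -> A -> bool) (l : X -> seq A) :
  PT (fun q : X * A => p q.1 q.2) -> PT l -> PT (fun x => has (p x) (l x)).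
Proof.
move=> cp cl.
apply: (PT_ext (f := fun x => foldl (fun c a => if c then true else p x a) false (l x))).
  move=> x; rewrite -[RHS]/(false || has (p x) (l x)); elim: (l x) false => /= [|a s IH] c.
    by rewrite orbF.
  by rewrite IH orbA; case: c.
apply: (@PT_foldl _ _ _ _ _ _ (fun=> 3)); try by [pt | poly | move=> *; apply: esize_bool].
by pt; apply: (PT_comp2 (op := p)); pt.
Qed.
End Flatten.

Section Bool.
Context {X A : Type} {eX : Enc X} {eA : Enc A}.

Lemma PT_negb (f : X -> bool) : PT f -> PT (fun x => ~~ f x).
Proof.
by move=> cf; apply: (PT_ext (f := fun x => if f x then false else true)); pt.
Qed.

Lemma PT_andb (f g : X -> bool) : PT f -> PT g -> PT (fun x => f x && g x).
Proof. by move=> cf cg; pt. Qed.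

Lemma PT_orb (f g : X -> bool) : PT f -> PT g -> PT (fun x => f x || g x).
Proof. by move=> cf cg; pt. Qed.

Lemma PT_implyb (f g : X -> bool) : PT f -> PT g -> PT (fun x => f x ==> g x).
Proof. by move=> cf cg; pt. Qed.

Lemma PT_addb (f g : X -> bool) : PT f -> PT g -> PT (fun x => f x (+) g x).
Proof.
move=> cf cg; apply: (PT_ext (f := fun x => if f x then ~~ g x else g x)).
  by move=> x; case: (f x).
by pt; apply: PT_negb.
Qed.

Lemma PT_eqb (f g : X -> bool) : PT f -> PT g -> PT (fun x => f x == g x).
Proof.
move=> cf cg; apply: (PT_ext (f := fun x => ~~ (f x (+) g x))).
  by move=> x; case: (f x) (g x) => [] [].
by apply: PT_negb; apply: PT_addb.
Qed.
End Bool.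

Ltac pt_list ::= first [apply PT_has | apply PT_map | apply PT_flatten
  | apply PT_filter | apply PT_rev | apply PT_cat].
Ltac pt_bool ::= first [apply PT_andb | apply PT_orb | apply PT_implyb
  | apply PT_addb | apply PT_eqb | apply PT_negb].

Section Nat.
Context {X A C : Type} {eX : Enc X} {eA : Enc A} {eC : Enc C}.

Lemma PT_all (p : X -> A -> bool) (l : X -> seq A) :
  PT (fun q : X * A => p q.1 q.2) -> PT l -> PT (fun x => all (p x) (l x)).
Proof.
move=> cp cl.
apply: (PT_ext (f := fun x => ~~ has (fun a => ~~ p x a) (l x))).
  by move=> x; rewrite has_predC negbK.
by pt.
Qed.

Lemma PT_nilp (f : X -> seq A) : PT f -> PT (fun x => nilp (f x)).
Proof.
move=> cf; apply: (PT_ext (f := fun x => if f x is _ :: _ then false else true)).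
  by move=> x; case: (f x).
by pt.
Qed.

Lemma PT_head (d : X -> A) (f : X -> seq A) :
  PT d -> PT f -> PT (fun x => head (d x) (f x)).
Proof. by move=> cd cf; rewrite /head; pt. Qed.

Lemma PT_behead (f : X -> seq A) : PT f -> PT (fun x => behead (f x)).
Proof.
by move=> cf; apply: (PT_ext (f := fun x => if f x is _ :: r then r else [::])); pt.
Qed.

(** As [tt] is encoded by [Leaf], a number and a list of that many units are the same tree.
    Conversions are free, and iteration a given number of times becomes a fold over a list. *)
Lemma enc_nseq n : enc (nseq n tt) = enc n.
Proof. by elim: n => //= n IH; rewrite -[RHS]/(Node Leaf (enc n)) -IH. Qed.

Lemma PT_nseq (f : X -> nat) : PT f -> PT (fun x => nseq (f x) tt).
Proof.
move=> cf; apply: (PT_comp cf (g := fun n => nseq n tt)).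
by apply: (@PT_expr _ _ _ _ _ (EVar 0)) => a s /= ->; rewrite enc_nseq.
Qed.

Lemma enc_size (s : seq unit) : enc (size s) = enc s.
Proof. by elim: s => //= -[] s IH; rewrite -[LHS]/(Node Leaf (enc (size s))) IH. Qed.

Lemma PT_size (f : X -> seq A) : PT f -> PT (fun x => size (f x)).
Proof.
move=> cf; apply: (PT_ext (f := fun x => size (map (fun=> tt) (f x)))).
  by move=> x; rewrite size_map.
apply: (PT_comp (f := fun x => map (fun=> tt) (f x)) (g := size)); first by pt.
by apply: (@PT_expr _ _ _ _ _ (EVar 0)) => a s /= ->; rewrite enc_size.
Qed.

Lemma foldl_iter (h : C -> C) n c : foldl (fun c _ => h c) c (nseq n tt) = iter n h c.
Proof. by elim: n c => //= n IH c; rewrite IH -iterSr. Qed.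

Lemma PT_iter P (step : X -> C -> C) (i : X -> C) (n : X -> nat) :
  PT (fun q : X * C => step q.1 q.2) -> PT i -> PT n -> polyb P ->
  (forall x k, k <= n x -> esize (iter k (step x) (i x)) <= P (esize x)) ->
  PT (fun x => iter (n x) (step x) (i x)).
Proof.
move=> cs ci cn pP H.
apply: (PT_ext (f := fun x => foldl (fun c _ => step x c) (i x) (nseq (n x) tt))).
  by move=> x; rewrite foldl_iter.
apply: (@PT_foldl _ _ _ _ _ _ P) => //.
- by pt; apply: (PT_comp2 (op := step)); pt.
- exact: PT_nseq.
- move=> x k; case: (leqP k (n x)) => nk.
    by rewrite take_nseq // foldl_iter; apply: H.
  rewrite take_oversize; last by rewrite size_nseq ltnW.
  by rewrite foldl_iter; apply: H.
Qed.
End Nat.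

Section Nat2.
Context {X A : Type} {eX : Enc X} {eA : Enc A}.

Lemma PT_succn (f : X -> nat) : PT f -> PT (fun x => (f x).+1).
Proof.
move=> cf; apply: (PT_comp cf (g := S)).
by apply: (@PT_expr _ _ _ _ _ (ECons ENil (EVar 0))) => a s /= ->.
Qed.

Lemma PT_predn (f : X -> nat) : PT f -> PT (fun x => (f x).-1).
Proof.
move=> cf; apply: (PT_comp cf (g := predn)).
by apply: (@PT_expr _ _ _ _ _ (ETl (EVar 0))) => -[|a] s /= ->.
Qed.

End Nat2.

Section Nat3.
Context {X A : Type} {eX : Enc X} {eA : Enc A}.

Lemma PT_addn (f g : X -> nat) : PT f -> PT g -> PT (fun x => f x + g x).
Proof.
move=> cf cg; apply: (PT_ext (f := fun x => size (nseq (f x) tt ++ nseq (g x) tt))).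
  by move=> x; rewrite size_cat !size_nseq.
by apply: PT_size; apply: PT_cat; apply: PT_nseq.
Qed.

Lemma iter_predn k n : iter k predn n = n - k.
Proof. by elim: k => [|k /= ->]; rewrite ?subn0 // subnS. Qed.

Lemma PT_subn (f g : X -> nat) : PT f -> PT g -> PT (fun x => f x - g x).
Proof.
move=> cf cg; have [P pP _ sf] := cf.
apply: (PT_ext (f := fun x => iter (g x) predn (f x))).
  by move=> x; apply: iter_predn.
apply: (@PT_iter _ _ _ _ P) => //; first by apply: PT_predn; pt.
move=> x k _; apply: leq_trans (sf x); rewrite iter_predn !esize_nat; lia.
Qed.

Lemma PT_leq (f g : X -> nat) : PT f -> PT g -> PT (fun x => f x <= g x).
Proof.
move=> cf cg; apply: (PT_ext (f := fun x => nilp (nseq (f x - g x) tt))).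
  by move=> x; rewrite /nilp size_nseq.
by apply: PT_nilp; apply: PT_nseq; apply: PT_subn.
Qed.

Lemma PT_eqn (f g : X -> nat) : PT f -> PT g -> PT (fun x => f x == g x).
Proof.
move=> cf cg; apply: (PT_ext (f := fun x => (f x <= g x) && (g x <= f x))).
  by move=> x; rewrite -eqn_leq.
by apply: PT_andb; apply: PT_leq.
Qed.

Lemma PT_minn (f g : X -> nat) : PT f -> PT g -> PT (fun x => minn (f x) (g x)).
Proof. by move=> cf cg; rewrite /minn; pt; apply: PT_leq; pt; apply: PT_succn. Qed.
End Nat3.

Ltac pt_list ::= first [apply PT_all | apply PT_has | apply PT_map | apply PT_flatten
  | apply PT_filter | apply PT_rev | apply PT_cat | apply PT_nilp | apply PT_head
  | apply PT_behead | apply PT_nseq | apply PT_size].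
Ltac pt_nat ::= first [apply PT_minn | apply PT_addn | apply PT_subn | apply PT_leq
  | apply PT_eqn | apply PT_succn | apply PT_predn].

Section Seqs.
Context {X A B : Type} {eX : Enc X} {eA : Enc A} {eB : Enc B}.

Lemma esize_iota n : esize (iota 0 n) <= (n * n.*2.+2).+1.
Proof.
apply: esize_le; first by rewrite size_iota.
by apply/allP => x; rewrite mem_iota esize_nat; lia.
Qed.

Lemma PT_iota0 (f : X -> nat) : PT f -> PT (fun x => iota 0 (f x)).
Proof.
move=> cf; have [P pP _ sf] := cf.
have E n : iter n (fun c => rcons c (size c)) [::] = iota 0 n.
  elim: n => //= n ->; rewrite size_iota -cats1 -[RHS]/(iota 0 n.+1).
  by rewrite -[in RHS]addn1 iotaD add0n.
apply: (PT_ext (f := fun x => iter (f x) (fun c => rcons c (size c)) [::])) => [x|].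
  exact: E.
apply: (@PT_iter _ _ _ _ (fun n => P n * (P n + 2) + 1)); rewrite -?cats1; try by [pt | poly].
- apply: (PT_ext (f := fun q : X * seq nat => q.2 ++ [:: size q.2])).
    by move=> q; rewrite cats1.
  by pt.
- move=> x k kx; rewrite E.
  apply: leq_trans (esize_iota _) _; have := sf x; rewrite esize_nat => h.
  by rewrite addn1 ltnS leq_mul //; lia.
Qed.

Lemma PT_drop (f : X -> nat) (g : X -> seq A) :
  PT f -> PT g -> PT (fun x => drop (f x) (g x)).
Proof.
move=> cf cg; have [P pP _ sg] := cg.
have E n (s : seq A) : iter n behead s = drop n s.
  by elim: n => [|n /= ->]; rewrite ?drop0 // -drop1 drop_drop add1n.
apply: (PT_ext (f := fun x => iter (f x) behead (g x))) => [x|].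
  exact: E.
apply: (@PT_iter _ _ _ _ P); try by [pt | poly].
by move=> x k _; rewrite E; apply: leq_trans (esize_drop _ _) (sg x).
Qed.

Lemma PT_take (f : X -> nat) (g : X -> seq A) :
  PT f -> PT g -> PT (fun x => take (f x) (g x)).
Proof.
move=> cf cg.
apply: (PT_ext (f := fun x => rev (drop (size (g x) - f x) (rev (g x))))).
  move=> x; rewrite rev_drop revK size_rev.
  case: (leqP (f x) (size (g x))) => h; first by rewrite subKn.
  by rewrite (eqP (ltnW h : size (g x) - f x == 0)) subn0 take_size take_oversize // ltnW.
by apply: PT_rev; apply: PT_drop; pt.
Qed.

Lemma PT_zip (f : X -> seq A) (g : X -> seq B) :
  PT f -> PT g -> PT (fun x => zip (f x) (g x)).
Proof.
move=> cf cg; have [P pP _ sf] := cf; have [Q pQ _ sg] := cg.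
pose st (c : seq (A * B) * seq B) (a : A) :=
  if c.2 is b :: r then ((a, b) :: c.1, r) else (c.1, [::]).
have E s t u : foldl st (u, t) s = (catrev (zip s t) u, drop (size s) t).
  elim: s t u => [|a s IH] [|b t] u //=; rewrite /st /= -/st IH //=.
  by case: (s).
apply: (PT_ext (f := fun x => rev (foldl st ([::], g x) (f x)).1)).
  by move=> x; rewrite E /= catrevE cats0 revK.
pt; apply: (@PT_foldl _ _ _ _ _ _ (fun n => P n + Q n + Q n + 1)); try by [rewrite /st; pt | poly].
move=> x k; rewrite E esize_pair /= catrevE cats0 esize_rev.
have := !! esize_drop (size (take k (f x))) (g x); have := sg x.
have := !! esize_take k (f x); have := sf x.
suff : !! (esize (zip (take k (f x)) (g x)) <= esize (take k (f x)) + esize (g x)) by lia.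
elim: (take k (f x)) (g x) => [|a s IH] [|b t] //=.
rewrite !esize_cons esize_pair /=; have := IH t; lia.
Qed.
End Seqs.

Section Mem.
Context {X : Type} {eX : Enc X} {T : eqType} {eT : Enc T}.
Hypothesis PT_eqT : PT (fun p : T * T => p.1 == p.2).

Lemma PT_eq_op (f g : X -> T) : PT f -> PT g -> PT (fun x => f x == g x).
Proof. by move=> cf cg; apply: (PT_comp2 (op := eq_op)). Qed.

Lemma PT_mem (f : X -> T) (g : X -> seq T) :
  PT f -> PT g -> PT (fun x => f x \in g x).
Proof.
move=> cf cg; apply: (PT_ext (f := fun x => has (fun y => y == f x) (g x))).
  by move=> x; rewrite has_pred1.
by pt; apply: (PT_comp2 (op := eq_op)) => //; pt.
Qed.
End Mem.

Lemma PT_nateq : PT (fun p : nat * nat => p.1 == p.2).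
Proof. by pt. Qed.

Lemma PT_seqeq (T : eqType) {eT : Enc T} : PT (fun p : T * T => p.1 == p.2) ->
  PT (fun p : seq T * seq T => p.1 == p.2).
Proof.
move=> cT.
pose st (c : bool * seq T) (a : T) :=
  if c.2 is b :: r then (c.1 && (b == a), r) else (false, [::]).
have E s t u : foldl st (u, t) s =
    (u && (size s <= size t) && (take (size s) t == s), drop (size s) t).
  elim: s t u => [|a s IH] [|b t] u //=; rewrite ?take0 ?drop0 ?eqxx ?andbT ?andbF //=.
    rewrite /st /= -/st; elim: (s) => //= {s} {}a s -> //.
  by rewrite {2}/st /= -/st IH /= eqseq_cons ltnS -!andbA; congr (_ && _, _); bool_congr.
apply: (PT_ext (f := fun p => (foldl st (true, p.2) p.1).1 && nilp (foldl st (true, p.2) p.1).2)).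
  move=> [s t] /=; rewrite E /= -andbA /nilp size_drop.
  case: leqP => //= st1; last by apply/esym/negP => /eqP e; rewrite e ltnn in st1.
  apply/andP/eqP => [[/eqP <-]|->]; last by rewrite take_size subnn !eqxx.
  by rewrite subn_eq0 => h; rewrite take_oversize // (leq_trans h) // size_take_min geq_minl.
suff : !! (PT (fun p : seq T * seq T => foldl st (true, p.2) p.1)) by move=> ?; pt.
apply: (@PT_foldl _ _ _ _ _ _ (fun n => n + 4)); try by [poly | pt].
  rewrite /st; pt.
  by apply: PT_eq_op => //; pt.
move=> [s t] k /=; rewrite E !esize_pair /=.
have := !! esize_drop (size (take k s)) t; have := !! esize_gt0 s.
set b := (_ && _); have := esize_bool b; lia.
Qed.

Lemma PT_memn {X : Type} {eX : Enc X} (f : X -> nat) (g : X -> seq nat) :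
  PT f -> PT g -> PT (fun x => f x \in g x).
Proof. exact: (PT_mem (T := nat) PT_nateq). Qed.

Lemma PT_mems {X : Type} {eX : Enc X} (f : X -> seq nat) (g : X -> seq (seq nat)) :
  PT f -> PT g -> PT (fun x => f x \in g x).
Proof. exact: (PT_mem (T := seq nat) (PT_seqeq (T := nat) PT_nateq)). Qed.

Lemma PT_eqs {X : Type} {eX : Enc X} (f : X -> seq nat) (g : X -> seq nat) :
  PT f -> PT g -> PT (fun x => f x == g x).
Proof. exact: (PT_eq_op (T := seq nat) (PT_seqeq (T := nat) PT_nateq)). Qed.

Ltac pt_seq ::= first [apply PT_iota0 | apply PT_drop | apply PT_take | apply PT_zip].
Ltac pt_mem ::= first [apply PT_memn | apply PT_mems | apply PT_eqs].

(** * Bounded size *)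

(** On the underlying trees this is the identity, so a program can inspect an arbitrary tree with
    the list operations. *)
Fixpoint dlist (d : dtree) : seq dtree := if d is Node a b then a :: dlist b else [::].

Lemma enc_dlist d : enc (dlist d) = d.
Proof. by elim: d => //= a _ b {2}<-. Qed.

(** One move of a traversal with an explicit stack. It removes exactly one node from the total size
    of a nonempty stack, so N moves empty the stack exactly when that size is at most N. *)
Definition pop (st : seq dtree) : seq dtree :=
  if st is d :: r then (if dlist d is a :: b then a :: enc b :: r else r) else [::].

Definition fits A (eA : Enc A) (N : nat) (a : A) : bool := nilp (iter N pop [:: enc a]).
Arguments fits {A eA}.

Lemma pop_size st : \sum_(d <- pop st) dsize d = (\sum_(d <- st) dsize d).-1.
Proof.
case: st => [|[|a b] r]; rewrite ?big_nil ?big_cons //=.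
by rewrite -/(dlist b) enc_dlist addnA.
Qed.

Lemma iter_pop_size k st :
  \sum_(d <- iter k pop st) dsize d = \sum_(d <- st) dsize d - k.
Proof. by elim: k => [|k IH]; rewrite ?subn0 //= pop_size IH subnS. Qed.

Lemma fitsE A {eA : Enc A} N (a : A) : fits N a = (esize a <= N).
Proof.
have := !! iter_pop_size N [:: enc a]; rewrite big_cons big_nil addn0 /fits /leq.
rewrite -/(esize a) => <-.
case: (iter N pop _) => [|d s]; first by rewrite big_nil.
by rewrite big_cons /=; have := dsize_gt0 d; case: (dsize d).
Qed.

Section Fits.
Context {X A : Type} {eX : Enc X} {eA : Enc A}.

Lemma PT_enc (f : X -> A) : PT f -> PT (fun x => enc (f x)).
Proof. by move=> cf; apply: (PT_comp cf); apply: (@PT_expr _ _ _ _ _ (EVar 0)). Qed.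

Lemma PT_dlist (f : X -> dtree) : PT f -> PT (fun x => dlist (f x)).
Proof.
move=> cf; apply: (PT_comp cf (g := dlist)).
by apply: (@PT_expr _ _ _ _ _ (EVar 0)) => d s /= ->; rewrite enc_dlist.
Qed.

Lemma esize_dtrees (st : seq dtree) : esize st <= (\sum_(d <- st) dsize d).*2.+1.
Proof.
rewrite esize_seq -muln2 big_distrl /= ltnS; apply: leq_sum => d _.
by rewrite /esize /enc /Enc_dtree /=; have := dsize_gt0 d; lia.
Qed.
End Fits.

Lemma PT_fits {X A : Type} {eX : Enc X} {eA : Enc A} (n : X -> nat) (f : X -> A) :
  PT n -> PT f -> PT (fun x => fits (n x) (f x)).
Proof.
move=> cn cf; rewrite /fits; pt; have [P pP _ sf] := cf.
apply: (@PT_iter _ _ _ _ (fun n => P n + P n + 1)); try by poly.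
- rewrite /pop; pt; first by apply: PT_dlist; pt.
  by apply: (PT_enc (A := seq dtree)); pt.
- by pt; apply: PT_enc.
- move=> x k _; apply: leq_trans (esize_dtrees _) _.
  by rewrite iter_pop_size big_cons big_nil; have := sf x; rewrite /esize; lia.
Qed.

(** * Binary arithmetic *)

(** Weights are never converted to unary numbers, since their values may be exponential in the
    length of the input; the program adds and compares bit sequences. *)
Definition bval (s : seq bool) : nat := foldr (fun (b : bool) v => b + v.*2) 0 s.

Lemma bval_nat_bits n : bval (nat_bits n) = n.
Proof.
have H p : bval (pos_bits p) = nat_of_pos p.
  by elim: p => //= p ->; rewrite ?NatTrec.doubleE.
by rewrite -[RHS]bin_of_natK /nat_bits; case: (bin_of_nat n) => //= p.
Qed.

Lemma bval_head s : bval s = head false s + (bval (behead s)).*2.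
Proof. by case: s. Qed.

Lemma bval_rcons s b : bval (rcons s b) = bval s + 2 ^ size s * b.
Proof.
elim: s => [|a s IH] /=; first by rewrite mul1n add0n addn0.
by rewrite IH expnS; lia.
Qed.

(** The new carry [if a (+) b then c else a] is the majority of [a], [b] and [c]. Missing bits of
    the shorter number are read as [false], and the output is collected in reverse. *)
Definition addstep (st : seq bool * seq bool * (bool * seq bool)) :=
  let: (x, y, (c, out)) := st in
  let: a := head false x in let: b := head false y in
  (behead x, behead y, (if a (+) b then c else a, (a (+) b (+) c) :: out)).

Definition badd (x y : seq bool) : seq bool :=
  let: st := iter (size x + size y) addstep (x, y, (false, [::])) in
  rev (st.2.1 :: st.2.2).

Lemma iter_addstep n x y c out : size x <= n -> size y <= n ->
  let: st := iter n addstep (x, y, (c, out)) in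
  bval (rev (st.2.1 :: st.2.2)) = bval (rev out) + 2 ^ size out * (bval x + bval y + c).
Proof.
elim: n x y c out => [|n IH] x y c out.
  by case: x y => // -[] // _ _ /=; rewrite rev_cons bval_rcons size_rev.
move=> sx sy; rewrite iterSr {1}/addstep.
have := IH (behead x) (behead y) (if head false x (+) head false y then c else head false x)
  ((head false x (+) head false y (+) c) :: out).
rewrite !size_behead => ->; try by lia.
rewrite rev_cons bval_rcons size_rev (bval_head x) (bval_head y) /= expnS.
by case: (head false x) (head false y) c => [] [] [] /=; nia.
Qed.

Lemma bval_badd x y : bval (badd x y) = bval x + bval y.
Proof.
have := @iter_addstep (size x + size y) x y false [::] (leq_addr _ _) (leq_addl _ _).
by rewrite /badd => ->; rewrite /= mul1n; lia.
Qed.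

Lemma iter_addstep_size n x y c out :
  let: st := iter n addstep (x, y, (c, out)) in
  [/\ st.1 = (drop n x, drop n y) & size st.2.2 = n + size out].
Proof.
elim: n x y c out => [|n IH] x y c out; first by rewrite !drop0.
rewrite iterSr {1}/addstep; have [-> ->] := IH (behead x) (behead y) (if head false x (+) head false y then c else head false x)
  ((head false x (+) head false y (+) c) :: out).
by rewrite /= addnS -!drop1 !drop_drop addn1.
Qed.

Lemma size_badd x y : size (badd x y) = (size x + size y).+1.
Proof.
have [_ h] := iter_addstep_size (size x + size y) x y false [::].
by rewrite /badd size_rev /= h addn0.
Qed.

Lemma esize_bits (s : seq bool) : esize s <= (size s * 4).+1.
Proof. by apply: esize_le => //; apply/allP => b _; apply: esize_bool. Qed.

(** The bits come least significant first, so a later difference overrides the verdict so far. *)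
Definition lestep (st : seq bool * seq bool * bool) :=
  let: (x, y, l) := st in
  (behead x, behead y, if head false x == head false y then l else head false y).

Definition ble (x y : seq bool) : bool :=
  (iter (size x + size y) lestep (x, y, true)).2.

Lemma iter_lestep n x y l : size x <= n -> size y <= n ->
  (iter n lestep (x, y, l)).2 = (bval x < bval y) || (bval x == bval y) && l.
Proof.
elim: n x y l => [|n IH] x y l; first by case: x y => // -[].
move=> sx sy; rewrite iterSr {1}/lestep IH ?size_behead; try lia.
rewrite (bval_head x) (bval_head y).
move: (bval (behead x)) (bval (behead y)) => a b.
by case: (head false x) (head false y) l => [] [] [] /=; lia.
Qed.

Lemma bleE x y : ble x y = (bval x <= bval y).
Proof. by rewrite /ble iter_lestep ?leq_addr ?leq_addl // andbT orbC -leq_eqVlt. Qed.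

Lemma iter_lestep_drop n x y l :
  (iter n lestep (x, y, l)).1 = (drop n x, drop n y).
Proof.
elim: n x y l => [|n IH] x y l; first by rewrite !drop0.
by rewrite iterSr {1}/lestep IH -!drop1 !drop_drop addn1.
Qed.

Definition bsum (ws : seq (seq bool)) : seq bool := foldl badd [::] ws.

Lemma bval_bsum ws : bval (bsum ws) = \sum_(w <- ws) bval w.
Proof.
suff H a : bval (foldl badd a ws) = bval a + \sum_(w <- ws) bval w by rewrite /bsum H.
elim: ws a => [|w ws IH] a /=; first by rewrite big_nil addn0.
by rewrite IH bval_badd big_cons addnA.
Qed.

Lemma size_bsum ws : size (bsum ws) = \sum_(w <- ws) (size w).+1.
Proof.
suff H a : size (foldl badd a ws) = size a + \sum_(w <- ws) (size w).+1.
  by rewrite /bsum H.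
elim: ws a => [|w ws IH] a /=; first by rewrite big_nil addn0.
by rewrite IH size_badd big_cons; lia.
Qed.

(** Turns a binary number into a unary one, with a cap that keeps the result polynomial. In an
    encoded graph the vertex numbers lie below the cap chosen in [mkitems], the number of vertices,
    and are read exactly. *)
Definition cap_val (cap : nat) (s : seq bool) : nat :=
  foldl (fun acc (b : bool) => minn (acc + acc + (if b then 1 else 0)) cap) 0 (rev s).

Lemma cap_valE cap s : cap_val cap s = minn (bval s) cap.
Proof.
rewrite /cap_val; elim: s => [|b s IH]; first by rewrite /= min0n.
by rewrite rev_cons -cats1 foldl_cat IH /=; case: b; lia.
Qed.

Section PTbin.
Context {X : Type} {eX : Enc X}.

Lemma PT_badd (f g : X -> seq bool) : PT f -> PT g -> PT (fun x => badd (f x) (g x)).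
Proof.
move=> cf cg; have [P pP _ sf] := cf; have [Q pQ _ sg] := cg.
have H : PT (fun x => iter (size (f x) + size (g x)) addstep (f x, g x, (false, [::]))).
  apply: (@PT_iter _ _ _ _ (fun n => P n + Q n + (P n + Q n) * 4 + 20)); try by [poly | pt].
    apply: (PT_ext (f := fun q => (behead q.2.1.1, behead q.2.1.2,
      (if head false q.2.1.1 (+) head false q.2.1.2 then q.2.2.1 else head false q.2.1.1,
       (head false q.2.1.1 (+) head false q.2.1.2 (+) q.2.2.1) :: q.2.2.2)))).
      by move=> [x [[? ?] [? ?]]].
    by pt.
  move=> x k kx; have [] := iter_addstep_size k (f x) (g x) false [::].
  case: (iter k _ _) => -[u v] [c out] /= [-> ->] so; rewrite !esize_pair /=.
  have := !! esize_drop k (f x); have := !! esize_drop k (g x).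
  have := esize_bool c; have := esize_bits out; rewrite so addn0.
  have := sf x; have := sg x; have := !! size_esize (f x); have := !! size_esize (g x).
  lia.
by rewrite /badd; pt.
Qed.

Lemma PT_ble (f g : X -> seq bool) : PT f -> PT g -> PT (fun x => ble (f x) (g x)).
Proof.
move=> cf cg; have [P pP _ sf] := cf; have [Q pQ _ sg] := cg.
rewrite /ble; pt.
apply: (@PT_iter _ _ _ _ (fun n => P n + Q n + 20)); try by [poly | pt].
  apply: (PT_ext (f := fun q => (behead q.2.1.1, behead q.2.1.2,
    if head false q.2.1.1 == head false q.2.1.2 then q.2.2 else head false q.2.1.2))).
    by move=> [x [[? ?] ?]].
  by pt.
move=> x k _; have := iter_lestep_drop k (f x) (g x) true.
case: (iter k _ _) => -[u v] l /= [-> ->]; rewrite !esize_pair /=.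
have := !! esize_drop k (f x); have := !! esize_drop k (g x).
have := esize_bool l; have := sf x; have := sg x; lia.
Qed.

End PTbin.

Section PTsum.
Context {X : Type} {eX : Enc X}.

Lemma PT_bsum (f : X -> seq (seq bool)) : PT f -> PT (fun x => bsum (f x)).
Proof.
move=> cf; have [P pP _ sf] := cf.
apply: (@PT_foldl _ _ _ _ _ _ (fun n => P n * 4 + 1)); try by [poly | pt].
  by apply: PT_badd; pt.
move=> x k; rewrite -/(bsum _).
apply: leq_trans (esize_bits _) _; rewrite size_bsum addn1 ltnS leq_mul2r /=.
apply: leq_trans (sf x); apply: leq_trans _ (esize_take k (f x)).
by rewrite esize_seq ltnW // ltnS leq_sum // => w _; rewrite ltnS ltnW // size_esize.
Qed.

Lemma PT_cap_val (n : X -> nat) (f : X -> seq bool) :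
  PT n -> PT f -> PT (fun x => cap_val (n x) (f x)).
Proof.
move=> cn cf; have [P pP _ sn] := cn.
rewrite /cap_val; apply: (@PT_foldl _ _ _ _ _ _ (fun n => P n + 1)); try by [poly | pt].
move=> x k; apply: leq_trans (_ : esize (n x) <= _); last by have := sn x; lia.
rewrite !esize_nat ltnS leq_double.
elim/last_ind: (take _ _) => //= s b _; rewrite -cats1 foldl_cat /= geq_minr //.
Qed.
End PTsum.

(** * The algorithm *)

(** The last two flags say whether the edge may and whether it must be reversed. They express the
    goals of both problems, so that one algorithm decides both. *)
Definition eitem : Type := nat * (nat * nat * seq bool * (bool * (bool * bool))).
(* A block of vertices, and the orders in which its boundary edges may be reversed. *)
Definition part : Type := seq nat * seq (seq nat).

Definition eid (e : eitem) : nat := e.1.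
Definition esrc (e : eitem) : nat := e.2.1.1.1.
Definition edst (e : eitem) : nat := e.2.1.1.2.
Definition ewt (e : eitem) : seq bool := e.2.1.2.
Definition eor (e : eitem) : bool := e.2.2.1.
Definition emay (e : eitem) : bool := e.2.2.2.1.
Definition emust (e : eitem) : bool := e.2.2.2.2.

Definition crossb (e : eitem) (vs : seq nat) : bool :=
  (esrc e \in vs) (+) (edst e \in vs).

Definition cross (es : seq eitem) (vs : seq nat) : seq nat :=
  map eid (filter (fun e => crossb e vs) es).

(** The argument [p] lists the edges reversed so far. *)
Definition ehead (e : eitem) (p : seq nat) : nat :=
  if eor e (+) (eid e \in p) then edst e else esrc e.

Definition inflow_ok (es : seq eitem) (v : nat) (fl : seq bool) (p : seq nat) : bool :=
  ble fl (bsum (map ewt (filter (fun e => ehead e p == v) es))).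

Definition local_ok (es : seq eitem) (v : nat) (fl : seq bool) (s : seq nat) : bool :=
  all (fun k => inflow_ok es v fl (take k s)) (iota 0 (size s).+1) &&
  all (fun e => crossb e [:: v] ==>
    ((emust e ==> (eid e \in s)) && ((eid e \in s) ==> emay e))) es.

Definition insertions (x : nat) (s : seq nat) : seq (seq nat) :=
  map (fun i => take i s ++ x :: drop i s) (iota 0 (size s).+1).

Definition add_letter (x : nat) (acc : seq (seq nat)) : seq (seq nat) :=
  acc ++ flatten (map (insertions x) acc).

Definition clip (N : nat) (l : seq (seq nat)) : seq (seq nat) :=
  if fits N l then l else [::].

(* All duplicate-free sequences over l; since [::] is one of them, the empty list
   signals that the fuel N is exhausted. *)
Definition arrangements (N : nat) (l : seq nat) : seq (seq nat) :=
  foldl (fun acc x => clip N (add_letter x acc)) [:: [::]] l.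

Definition letters (es : seq eitem) (c : seq (seq nat)) : seq nat :=
  map eid (filter (fun e => has (crossb e) c) es).

(** In database terms, a natural join of the relations of the blocks in [c], followed by a
    projection to the boundary of their union: the edges inside the union are forgotten. *)
Definition joined (es : seq eitem) (ps : seq part) (c : seq (seq nat))
    (sq : seq (seq nat)) : seq (seq nat) :=
  map (fun s => filter (fun x => x \in cross es (flatten c)) s)
    (filter (fun s => all (fun p => (p.1 \in c) ==>
       (filter (fun x => x \in cross es p.1) s \in p.2)) ps) sq).

Definition merged (es : seq eitem) (ps : seq part) (c : seq (seq nat))
    (sq : seq (seq nat)) : seq part :=
  (flatten c, joined es ps c sq) :: filter (fun p => p.1 \notin c) ps.

(** Without enough fuel the state is returned unchanged, which is sound; the failure only shows in
    the number of blocks left at the end. *)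
Definition contract (N : nat) (es : seq eitem) (ps : seq part) (c : seq (seq nat)) :
    seq part :=
  if nilp (arrangements N (letters es c)) then ps else
  if fits N (merged es ps c (arrangements N (letters es c)))
  then merged es ps c (arrangements N (letters es c)) else ps.

Definition pow3 (d n : nat) : nat := iter d (fun a => minn (a + a + a) n) 1.

(* More than 3 ^ d blocks, where d is the number of boundary edges: [pow3] is the
   power of 3 capped at [size c], so that it is computed in polynomial time. *)
Definition good (es : seq eitem) (c : seq (seq nat)) : bool :=
  pow3 (size (cross es (flatten c))) (size c) < size c.

Definition joins (e : eitem) (b : seq nat) (c : seq (seq nat)) : bool :=
  (esrc e \in b) && (edst e \in flatten c) || (edst e \in b) && (esrc e \in flatten c).

(** All pairs are taken, not only adjacent ones: two blocks without boundary edges already form a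
    good set, as 3 ^ 0 < 2. *)
Definition pairs (bs : seq (seq nat)) : seq (seq (seq nat)) :=
  flatten (map (fun b1 => map (fun b2 => [:: b1; b2]) (filter (fun b2 => b2 != b1) bs)) bs).

Definition grow (es : seq eitem) (bs : seq (seq nat)) (acc : seq (seq (seq nat))) :
    seq (seq (seq nat)) :=
  flatten (map (fun c => map (fun b => b :: c)
    (filter (fun b => (b \notin c) && has (fun e => joins e b c) es) bs)) acc).

Definition growstep (N : nat) (es : seq eitem) (bs : seq (seq nat))
    (acc : seq (seq (seq nat))) : seq (seq (seq nat)) :=
  if fits N (acc ++ grow es bs acc) then acc ++ grow es bs acc else acc.

Definition cands (N : nat) (es : seq eitem) (bs : seq (seq nat)) : seq (seq (seq nat)) :=
  iter (size bs) (growstep N es bs) (pairs bs).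

Definition onestep (N : nat) (es : seq eitem) (ps : seq part) : seq part :=
  if filter (good es) (cands N es (map fst ps)) is c :: _ then contract N es ps c else ps.

Definition run (N : nat) (es : seq eitem) (ps : seq part) : seq part :=
  iter (size ps) (onestep N es) ps.

Definition parts0 (N : nat) (es : seq eitem) (fs : seq (seq bool)) : seq part :=
  map (fun vf : nat * seq bool => ([:: vf.1],
     filter (local_ok es vf.1 vf.2) (arrangements N (cross es [:: vf.1]))))
   (zip (iota 0 (size fs)) fs).

(* The empty list signals that the fuel N is exhausted. *)
Definition decide (N : nat) (es : seq eitem) (fs : seq (seq bool)) : seq bool :=
  if has (fun v => nilp (arrangements N (cross es [:: v]))) (iota 0 (size fs)) then [::] else
  if size (run N es (parts0 N es fs)) <= 1
  then [:: all (fun p : part => ~~ nilp p.2) (run N es (parts0 N es fs))] else [::].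

Definition bits_eq (a b : seq bool) : bool := ble a b && ble b a.

(* The types of the data behind [enc_cgraph] and behind the instance encodings. *)
Definition ginput : Type := seq (seq bool) * seq (seq bool * seq bool * seq bool).
Definition c2c_input : Type := ginput * (seq bool * seq bool).
Definition c2e_input : Type := ginput * (seq bool * seq bool * seq bool).

Definition mkitem (n : nat) (q : nat * (seq bool * seq bool * seq bool * (bool * (bool * bool)))) :
    eitem :=
  (q.1, (cap_val n q.2.1.1.1, cap_val n q.2.1.1.2, q.2.1.2, q.2.2)).

Definition mkitems (g : ginput) (l : seq (bool * (bool * bool))) : seq eitem :=
  map (mkitem (size g.1)) (zip (iota 0 (size g.2)) (zip g.2 l)).

(** As no edge is reversed twice, the edges to be reversed are exactly those on which the two
    configurations differ; hence both flags coincide. *)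
Definition c2c_items (x : c2c_input) : seq eitem :=
  mkitems x.1 (map (fun b : bool * bool => (b.1, (b.1 (+) b.2, b.1 (+) b.2))) (zip x.2.1 x.2.2)).

(** The target edge is recognized by its ends, compared as binary numbers; it alone must be
    reversed, while every edge may be. *)
Definition c2e_items (x : c2e_input) : seq eitem :=
  mkitems x.1 (map (fun b : bool * (seq bool * seq bool * seq bool) =>
      (b.1, (true, bits_eq b.2.1.1 x.2.1.1 && bits_eq b.2.1.2 x.2.1.2)))
    (zip x.2.2 x.1.2)).

Ltac pt_num ::= first [apply PT_fits | apply PT_bsum | apply PT_ble | apply PT_cap_val].

Lemma pow3E d n : 0 < n -> pow3 d n = minn (3 ^ d) n.
Proof.
move=> n0; elim: d => [|d IH]; first by rewrite /= expn0; lia.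
by rewrite /pow3 iterS -/(pow3 d n) IH expnS; lia.
Qed.

(** * Polynomial time of the algorithm *)

Section PTalg.
Context {X : Type} {eX : Enc X}.

Lemma PT_crossb (f : X -> eitem) (g : X -> seq nat) :
  PT f -> PT g -> PT (fun x => crossb (f x) (g x)).
Proof. by move=> cf cg; rewrite /crossb /esrc /edst; pt. Qed.

Lemma PT_eid (f : X -> eitem) : PT f -> PT (fun x => eid (f x)).
Proof. by move=> cf; rewrite /eid; pt. Qed.
End PTalg.

Ltac pt_alg ::= first [apply PT_crossb | apply PT_eid].

Section PTalg2.
Context {X : Type} {eX : Enc X}.

Lemma PT_cross (es : X -> seq eitem) (g : X -> seq nat) :
  PT es -> PT g -> PT (fun x => cross (es x) (g x)).
Proof.
by move=> cf cg; rewrite /cross; pt.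
Qed.

Lemma PT_local_ok (es : X -> seq eitem) (v : X -> nat) (fl : X -> seq bool) (s : X -> seq nat) :
  PT es -> PT v -> PT fl -> PT s ->
  PT (fun x => local_ok (es x) (v x) (fl x) (s x)).
Proof.
move=> ces cv cfl cs; rewrite /local_ok /inflow_ok /ehead /eor /ewt /esrc /edst /eid /emust /emay.
by pt.
Qed.

Lemma PT_arrangements (n : X -> nat) (l : X -> seq nat) :
  PT n -> PT l -> PT (fun x => arrangements (n x) (l x)).
Proof.
move=> cn cl; rewrite /arrangements; have [P pP _ sn] := cn.
apply: (@PT_foldl _ _ _ _ _ _ (fun n => P n + 10)); try by [poly | pt].
move=> x k; elim/last_ind: (take _ _) => [|s b _] /=.
  by rewrite -[X in X <= _]/3; lia.
rewrite -cats1 foldl_cat /= /clip; case: ifP => [|_].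
  by rewrite fitsE; have := sn x; rewrite esize_nat; lia.
by rewrite esize_seq big_nil; lia.
Qed.

Lemma PT_letters (es : X -> seq eitem) (c : X -> seq (seq nat)) :
  PT es -> PT c -> PT (fun x => letters (es x) (c x)).
Proof.
by move=> ces cc; rewrite /letters; pt.
Qed.
End PTalg2.

Ltac pt_alg ::= first [apply PT_crossb | apply PT_eid | apply PT_cross
 | apply PT_local_ok | apply PT_arrangements | apply PT_letters].

Section PTalg3.
Context {X : Type} {eX : Enc X}.

Lemma PT_contract (n : X -> nat) (es : X -> seq eitem) (ps : X -> seq part) (c : X -> seq (seq nat)) :
  PT n -> PT es -> PT ps -> PT c ->
  PT (fun x => contract (n x) (es x) (ps x) (c x)).
Proof.
move=> cn ces cps cc; rewrite /contract /merged /joined.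
have cA : !! (PT (fun x => arrangements (n x) (letters (es x) (c x)))).
  by apply: PT_arrangements => //; apply: PT_letters.
by pt; try by [apply: PT_cross; pt].
Qed.

Lemma PT_good (es : X -> seq eitem) (c : X -> seq (seq nat)) :
  PT es -> PT c -> PT (fun x => good (es x) (c x)).
Proof.
move=> ces cc; rewrite /good /pow3; pt.
have [P pP _ sc] := cc.
apply: (@PT_iter _ _ _ _ (fun n => P n + P n + 10)); try by [poly | pt].
move=> x [|k] _ /=; rewrite esize_nat //; first by rewrite addnC.
have := sc x; have := !! size_esize (c x).
by set a := iter _ _ _; lia.
Qed.

Lemma PT_growstep (n : X -> nat) (es : X -> seq eitem) (bs : X -> seq (seq nat)) (acc : X -> seq (seq (seq nat))) :
  PT n -> PT es -> PT bs -> PT acc ->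
  PT (fun x => growstep (n x) (es x) (bs x) (acc x)).
Proof. by move=> cn ces cbs cacc; rewrite /growstep /grow /joins /esrc /edst; pt. Qed.
End PTalg3.

Ltac pt_alg ::= first [apply PT_crossb | apply PT_eid | apply PT_cross
 | apply PT_local_ok | apply PT_arrangements | apply PT_letters
 | apply PT_contract | apply PT_good | apply PT_growstep].

Section PTalg4.
Context {X : Type} {eX : Enc X}.

Lemma PT_cands (n : X -> nat) (es : X -> seq eitem) (bs : X -> seq (seq nat)) :
  PT n -> PT es -> PT bs -> PT (fun x => cands (n x) (es x) (bs x)).
Proof.
move=> cn ces cbs; rewrite /cands; have [P pP _ sn] := cn.
have cp : !! (PT (fun x => pairs (bs x))) by rewrite /pairs; pt.
have [Q pQ _ sp] := cp.
apply: (@PT_iter _ _ _ _ (fun n => P n + Q n)); try by [poly | pt].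
move=> x k _; have := sn x; have := sp x; rewrite esize_nat => h1 h2.
elim: k => [|k IH] /=; first by lia.
by rewrite {1}/growstep; case: ifP => [|_]; [rewrite fitsE; lia | exact: IH].
Qed.

Lemma PT_onestep (n : X -> nat) (es : X -> seq eitem) (ps : X -> seq part) :
  PT n -> PT es -> PT ps -> PT (fun x => onestep (n x) (es x) (ps x)).
Proof.
move=> cn ces cps; rewrite /onestep; apply: PT_case; pt.
by apply: PT_cands; pt.
Qed.
End PTalg4.

Ltac pt_alg ::= first [apply PT_crossb | apply PT_eid | apply PT_cross
 | apply PT_local_ok | apply PT_arrangements | apply PT_letters
 | apply PT_contract | apply PT_good | apply PT_growstep | apply PT_onestep].

Section PTalg5.
Context {X : Type} {eX : Enc X}.

(** A new state is adopted only after it has passed [fits N]. This bounds all states of the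
    iteration at once, as [PT_run] requires. *)
Lemma esize_contract N es ps c : esize (contract N es ps c) <= maxn N (esize ps).
Proof.
rewrite /contract; case: ifP => _; first by rewrite leq_maxr.
by case: ifP => [|_]; [rewrite fitsE leq_max => -> | rewrite leq_maxr].
Qed.

Lemma esize_onestep N es ps : esize (onestep N es ps) <= maxn N (esize ps).
Proof. by rewrite /onestep; case: (filter _ _) => [|c _]; [rewrite leq_maxr | apply: esize_contract]. Qed.

Lemma PT_run (n : X -> nat) (es : X -> seq eitem) (ps : X -> seq part) :
  PT n -> PT es -> PT ps -> PT (fun x => run (n x) (es x) (ps x)).
Proof.
move=> cn ces cps; rewrite /run; have [P pP _ sn] := cn; have [Q pQ _ sp] := cps.
apply: (@PT_iter _ _ _ _ (fun n => P n + Q n)); try by [poly | pt].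
move=> x k _; have := sn x; have := sp x; rewrite esize_nat => h1 h2.
elim: k => [|k IH] /=; first by lia.
by apply: leq_trans (esize_onestep _ _ _) _; lia.
Qed.

Lemma PT_decide (n : X -> nat) (es : X -> seq eitem) (fs : X -> seq (seq bool)) :
  PT n -> PT es -> PT fs -> PT (fun x => decide (n x) (es x) (fs x)).
Proof.
move=> cn ces cfs.
have cr : !! (PT (fun x => run (n x) (es x) (parts0 (n x) (es x) (fs x)))).
  apply: PT_run => //; rewrite /parts0; pt; try by [apply: PT_local_ok; pt].
by rewrite /decide; pt.
Qed.

Lemma PT_mkitems (g : X -> ginput) (l : X -> seq (bool * (bool * bool))) :
  PT g -> PT l -> PT (fun x => mkitems (g x) (l x)).
Proof. by move=> cg cl; rewrite /mkitems /mkitem; pt. Qed.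
End PTalg5.

Lemma PT_c2c : PT (fun x : c2c_input * nat => decide x.2 (c2c_items x.1) x.1.1.1).
Proof. by apply: PT_decide; pt; apply: PT_mkitems; pt. Qed.

Lemma PT_c2e : PT (fun x : c2e_input * nat => decide x.2 (c2e_items x.1) x.1.1.1).
Proof.
apply: PT_decide; pt; apply: PT_mkitems; rewrite /bits_eq; pt.
Qed.

(** * Computable functions *)

Lemma CT_comp2 {X A B C : Type} {eX : Enc X} {eA : Enc A} {eB : Enc B} {eC : Enc C}
    (op : A -> B -> C) (f : X -> A) (g : X -> B) :
  CT (fun p : A * B => op p.1 p.2) -> CT f -> CT g -> CT (fun x => op (f x) (g x)).
Proof. by move=> cop cf cg; apply: (CT_comp (CT_pair cf cg) cop). Qed.

Lemma CT_const {X A : Type} {eX : Enc X} {eA : Enc A} (a : A) : CT (fun _ : X => a).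
Proof. by apply: PT_CT; pt. Qed.

Lemma CT_id {X : Type} {eX : Enc X} : CT (fun x : X => x).
Proof. by apply: PT_CT; pt. Qed.

Lemma CT_iter {X C : Type} {eX : Enc X} {eC : Enc C} (step : X -> C -> C) (i : X -> C)
    (n : X -> nat) :
  CT (fun q : X * C => step q.1 q.2) -> CT i -> CT n ->
  CT (fun x => iter (n x) (step x) (i x)).
Proof.
move=> cs ci cn.
apply: (CT_ext (f := fun x => foldl (fun c _ => step x c) (i x) (nseq (n x) tt))).
  by move=> x; rewrite foldl_iter.
apply: CT_foldl => //.
  apply: (CT_comp (f := fun q : X * C * unit => q.1) (g := fun q => step q.1 q.2)) => //.
  by apply: PT_CT; pt.
by apply: (CT_comp cn); apply: PT_CT; pt.
Qed.

Section Arith.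
Context {X : Type} {eX : Enc X}.
Variables f g : X -> nat.
Hypotheses (cf : CT f) (cg : CT g).

Lemma CT_addn : CT (fun x => f x + g x).
Proof. by apply: CT_comp2 => //; apply: PT_CT; pt. Qed.

Lemma CT_muln : CT (fun x => f x * g x).
Proof.
apply: CT_comp2 => //.
apply: (CT_ext (f := fun p => iter p.1 (addn p.2) 0)) => [p|].
  by rewrite iter_addn addn0 mulnC.
by apply: CT_iter; apply: PT_CT; pt.
Qed.
End Arith.

Lemma CT_expn {X : Type} {eX : Enc X} (f g : X -> nat) :
  CT f -> CT g -> CT (fun x => f x ^ g x).
Proof.
move=> cf cg; apply: CT_comp2 => //.
apply: (CT_ext (f := fun p => iter p.2 (muln p.1) 1)) => [p|].
  by rewrite iter_muln muln1.
by apply: CT_iter; try apply: CT_muln; apply: PT_CT; pt.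
Qed.

Fixpoint bsucc (s : seq bool) : seq bool :=
  if s is b :: r then (if b then false :: bsucc r else true :: r) else [:: true].

Lemma bval_bsucc s : bval (bsucc s) = (bval s).+1.
Proof. by elim: s => //= -[] s IH /=; rewrite ?IH; lia. Qed.

(** A binary numeral without leading zeros is determined by its value. This matters because
    [computable] asks for the exact encoding [enc_nat] and not merely for bits of the right
    value. *)
Lemma bval_canon_inj s t : last true s -> last true t -> bval s = bval t -> s = t.
Proof.
have pos u : last true u -> u != [::] -> 0 < bval u.
  elim: u => //= b u IH; case: u IH => [|c u] IH /=; first by case: b.
  by move=> l _; have := IH l isT => /=; lia.
have W (u : seq bool) b : last b u -> last true u by case: u.
elim: s t => [|a s IH] [|b t] //.
- by move=> _ l e; have := pos _ l isT; rewrite -e.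
- by move=> l _ e; have := pos _ l isT; rewrite e.
move=> /= ls lt e.
have ab : a = b by case: a b e {ls lt} => [] []; lia.
by rewrite ab (IH t) ?(W _ _ ls) ?(W _ _ lt) //; rewrite ab in e; lia.
Qed.

Lemma nat_bits_canon n : last true (nat_bits n).
Proof.
rewrite /nat_bits; case: (bin_of_nat n) => //= p.
suff H b : last b (pos_bits p) by apply: H.
by elim: p b => [p IH|p IH|] b /=.
Qed.

Lemma nat_bits_succ n : nat_bits n.+1 = bsucc (nat_bits n).
Proof.
apply: bval_canon_inj; rewrite ?bval_bsucc ?bval_nat_bits ?nat_bits_canon //.
suff H s b : last true s -> last b (bsucc s) by apply: H (nat_bits_canon n).
elim: s b => //= -[] s IH b h; [exact: IH | by case: s h {IH}].
Qed.

Lemma PT_bsucc {X : Type} {eX : Enc X} (f : X -> seq bool) :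
  PT f -> PT (fun x => bsucc (f x)).
Proof.
move=> cf; have [P pP _ sf] := cf.
pose st (q : bool * seq bool) (b : bool) := (q.1 && b, (q.1 (+) b) :: q.2).
have E c out s : let q := foldl st (c, out) s in
    rev (if q.1 then true :: q.2 else q.2) = rev out ++ (if c then bsucc s else s).
  elim: s c out => [|b s IH] c out /=; first by case: c; rewrite ?cats0 ?rev_cons ?cats1.
  rewrite {1 2 3}/st /= IH rev_cons -cats1 -catA.
  by case: c b => [] [].
apply: (PT_ext (f := fun x => rev (if (foldl st (true, [::]) (f x)).1
   then true :: (foldl st (true, [::]) (f x)).2 else (foldl st (true, [::]) (f x)).2))).
  by move=> x; have /= -> := E true [::] (f x).
have H : !! (PT (fun x => foldl st (true, [::]) (f x))).
  apply: (@PT_foldl _ _ _ _ _ _ (fun n => P n * 4 + 10)); try by [poly | rewrite /st; pt].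
  move=> x k; rewrite esize_pair.
  have S s q : size (foldl st q s).2 = size s + size q.2.
    by elim: s q => //= b s IH q; rewrite IH /= addnS.
  have := esize_bits (foldl st (true, [::]) (take k (f x))).2; rewrite S /= addn0 size_take_min.
  have := esize_bool (foldl st (true, [::]) (take k (f x))).1.
  by have := sf x; have := !! size_esize (f x); lia.
by pt.
Qed.

(** Numbers are unary inside the programs but binary in [computable]. The conversions may take
    exponential time, which is harmless as only computability is claimed. *)
Lemma CT_computable (f : nat -> nat) : CT f -> computable f.
Proof.
move=> cf.
have [T [p [m H]]] : !! (CT (fun s : seq bool => nat_bits (f (bval s)))).
  have cb : !! (CT bval).
    apply: (CT_ext (f := fun s => foldl (fun a (b : bool) => a + a + (if b then 1 else 0)) 0 (rev s))).
      move=> s; elim: s => //= b s IH; rewrite rev_cons -cats1 foldl_cat IH /=; case: b; lia.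
    by apply: CT_foldl; apply: PT_CT; pt.
  apply: (CT_comp (f := fun s => f (bval s)) (CT_comp cb cf)).
  apply: (CT_ext (f := fun n => iter n bsucc [::])).
    by elim=> // n IH; rewrite iterS IH nat_bits_succ.
  by apply: CT_iter; apply: PT_CT; pt; apply: PT_bsucc; pt.
exists p => n; have [|t [s' [h1 h2 h3 h4]]] := H (nat_bits n) (init (enc_nat n)).
  by [].
by exists t, s' => //; rewrite h2 bval_nat_bits.
Qed.

(** * Search with increasing fuel *)

Section Search.
Context {X : Type} {eX : Enc X}.
Variables (D : X -> nat -> seq bool).

(** Above the scratch space of [p], variable [m] holds the input, [m.+1] the fuel and [m.+2] the
    loop flag. The language has no skip command, hence the dummy assignment in the branch without an
    answer. *)
Definition searcher (p : cmd) (m : nat) : cmd :=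
  let body := Seq (Assign 0 (ECons (EVar m) (EVar m.+1)))
    (Seq p (Seq (Assign m.+1 (ECons ENil (EVar m.+1)))
      (If (EVar 0) (Assign m.+2 ENil) (Assign 0 ENil)))) in
  Seq (Assign m (EVar 0)) (Seq (Assign m.+1 ENil) (Seq (Assign m.+2 (ECons ENil ENil))
    (Seq (While (EVar m.+2) body) (Assign 0 (EHd (EVar 0)))))).

Lemma searcher_runs p m P N0 x :
  0 < m -> {homo P : a b / a <= b} ->
  computes p m (fun q : X * nat => D q.1 q.2) (fun q => P (esize q)) ->
  D x N0 <> [::] ->
  exists t out N b r, [/\ runs (searcher p m) (enc x) t out, D x N = b :: r,
    out = enc b & t <= N0.+1 * (P (esize x + N0.*2 + 2) + 30) + 30].
Proof.
move=> m0 mP Hp DN0.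
set M := P (esize x + N0.*2 + 2).
pose body := Seq (Assign 0 (ECons (EVar m) (EVar m.+1)))
    (Seq p (Seq (Assign m.+1 (ECons ENil (EVar m.+1)))
      (If (EVar 0) (Assign m.+2 ENil) (Assign 0 ENil)))).
(* Induction on the number [k] of fuel values left before [N0]; at [k = 0] an answer is
   guaranteed. *)
have loop k N s : N + k = N0 -> s m = enc x -> s m.+1 = enc N -> s m.+2 = Node Leaf Leaf ->
  exists t s' N' b r, [/\ exec (While (EVar m.+2) body) s t s', D x N' = b :: r,
    s' 0 = enc (b :: r) & t <= k.+1 * (M + 30) + 10].
  elim/ltn_ind: k N s => k IH N s eN s0 s1 s2.
  pose s3 := upd s 0 (Node (s m) (s m.+1)).
  have [|t [s4 [h1 h2 h3 h4]]] := Hp (x, N) s3; first by rewrite /s3 upd_same s0 s1.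
  have {}h4 : t <= M by apply: leq_trans h4 (mP _ _ _); rewrite esize_pair esize_nat /=; lia.
  pose s5 := upd s4 m.+1 (Node Leaf (s4 m.+1)).
  have e5 : s5 0 = enc (D x N) by rewrite /s5 upd_other.
  case eD: (D x N) => [|b r].
  - case: k IH eN => [|k] IH eN; first by case: DN0; rewrite -eN addn0.
    pose s6 := upd s5 0 Leaf.
    have [||||u [s7 [N' [b [r [k1 k2 k3 k4]]]]]] := IH k (ltnSn k) N.+1 s6; first lia.
    + by rewrite /s6 upd_other ?gtn_eqF // /s5 upd_other ?ltn_eqF // h3 // /s3 upd_other // gtn_eqF.
    + by rewrite /s6 upd_other // /s5 upd_same h3 // /s3 upd_other // s1.
    + by rewrite /s6 upd_other // /s5 upd_other ?gtn_eqF // h3 ?leqW // /s3 upd_other.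
    exists (1 + (4 + (t + (4 + (1 + 2).+1).+1).+1).+1 + u).+1, s7, N', b, r; split=> //.
    + apply: (@ExecWhileTrue (EVar m.+2) body _ s6) k1; first by rewrite /= s2.
      apply: ExecSeq; first exact: (ExecAssign 0 (ECons (EVar m) (EVar m.+1))).
      apply: ExecSeq h1 _; apply: ExecSeq; first exact: (ExecAssign m.+1 (ECons ENil (EVar m.+1))).
      apply: (@ExecIfFalse (EVar 0)); first by rewrite /= -/s5 e5 eD.
      exact: (ExecAssign 0 ENil).
    + lia.
  - pose s6 := upd s5 m.+2 Leaf.
    exists (1 + (4 + (t + (4 + (1 + 2).+1).+1).+1).+1 + 2).+1, s6, N, b, r; split=> //.
    + apply: (@ExecWhileTrue (EVar m.+2) body _ s6); first by rewrite /= s2.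
        apply: ExecSeq; first exact: (ExecAssign 0 (ECons (EVar m) (EVar m.+1))).
        apply: ExecSeq h1 _; apply: ExecSeq; first exact: (ExecAssign m.+1 (ECons ENil (EVar m.+1))).
        apply: (@ExecIfTrue (EVar 0)); first by rewrite /= -/s5 e5 eD.
        exact: (ExecAssign m.+2 ENil).
      by apply: (@ExecWhileFalse (EVar m.+2) body s6); rewrite /= /s6 upd_same.
    + by rewrite /s6 upd_other // e5 eD.
    + lia.
pose s0 := init (@enc X eX x).
pose s1 := upd s0 m (s0 0); pose s2 := upd s1 m.+1 Leaf; pose s3 := upd s2 m.+2 (Node Leaf Leaf).
have [|||| t [s4 [N' [b [r [k1 k2 k3 k4]]]]]] := loop N0 0 s3; first by [].
- by rewrite /s3 upd_other ?ltn_eqF // /s2 upd_other ?ltn_eqF // /s1 upd_same.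
- by rewrite /s3 upd_other ?ltn_eqF // /s2 upd_same.
- by rewrite /s3 upd_same.
exists (2 + (2 + (4 + (t + 3).+1).+1).+1).+1, (@enc bool _ b), N', b, r; split=> //; last lia.
exists (upd s4 0 (dhd (s4 0))); last by rewrite upd_same k3.
apply: ExecSeq; first exact: (ExecAssign m (EVar 0)).
apply: ExecSeq; first exact: (ExecAssign m.+1 ENil).
apply: ExecSeq; first exact: (ExecAssign m.+2 (ECons ENil ENil)).
by apply: ExecSeq k1 _; apply: (ExecAssign 0 (EHd (EVar 0))).
Qed.
End Search.

(** Soundness is demanded for every fuel, because the search stops at the first answer, possibly
    before the [N] that the last hypothesis provides. *)
Lemma fpt_search (P : decision_problem) (kappa : instance P -> nat) (X : Type)
    (eX : Enc X) (inp : instance P -> X) (D : X -> nat -> seq bool)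
    (g : nat -> nat) (c : nat) :
  (forall I, encode I = enc (inp I)) ->
  PT (fun q : X * nat => D q.1 q.2) ->
  (forall I N b r, D (inp I) N = b :: r -> b <-> yes I) ->
  CT g ->
  (forall I, exists2 N, N <= g (kappa I) * esize (inp I) ^ c & D (inp I) N <> [::]) ->
  fpt kappa.
Proof.
move=> encE [Q pQ [p [m Hp]] _] sound cg total.
have {}Hp := computes_weak (leq_maxr 1 m) (fun=> leqnn _) Hp.
(* For an input of size L and n = L + N, the search takes at most [W n]: at most N + 1 rounds, each
   on a pair of size at most L + 2 * N + 2. *)
pose W n := (n + 1) * (Q (n + n + n + 2) + 30) + 30.
have [mW [d hW]] : polyb W by poly.
(* These come from [W n <= d * n.+1 ^ d] with n = L + N and from L + N + 1 <= (g k + 3) * L ^ (c +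
   1). *)
exists (searcher p (maxn 1 m)), (fun k => d * (g k + 3) ^ d), (c.+1 * d).
split.
  apply: CT_computable; apply: CT_muln; first exact: CT_const.
  by apply: CT_expn; [apply: CT_addn => //|]; apply: CT_const.
move=> I; have [N Nle DN] := total I.
have [|||t [out [N' [b [r [h1 h2 h3 h4]]]]]] := searcher_runs (N0 := N) (x := inp I) _ _ Hp.
- by rewrite leq_maxl.
- exact: pQ.1.
- exact: DN.
exists t, out; rewrite encE; split=> //; last first.
  by rewrite h3 -(sound I N' b r h2); case: (b); split.
set L := dsize _; have L0 : 0 < L by apply: esize_gt0.
apply: leq_trans h4 _; apply: (@leq_trans (W (L + N))).
  rewrite leq_add2r leq_mul //; first by rewrite addn1 ltnS leq_addl.
  rewrite leq_add2r; apply: pQ.1.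
  by rewrite -/L /esize -/L; lia.
apply: leq_trans (hW _) _; rewrite -mulnA leq_mul2l expnM -expnMn; apply/orP; right.
apply: leq_exp2r_weak; rewrite expnS.
have Lc : 0 < L ^ c by rewrite expn_gt0 L0.
have : L <= L * L ^ c by rewrite leq_pmulr.
have : N <= g (kappa I) * (L * L ^ c).
  by apply: leq_trans Nle _; rewrite leq_mul2l leq_pmull ?orbT.
by rewrite mulnDl; lia.
Qed.

(** * Soundness of the contractions *)

Lemma mem_insertions x s t :
  t \in insertions x s <-> exists t1 t2, s = t1 ++ t2 /\ t = t1 ++ x :: t2.
Proof.
split=> [/mapP[i _ ->]|[t1 [t2 [-> ->]]]].
  by exists (take i s), (drop i s); rewrite cat_take_drop.
apply/mapP; exists (size t1); last by rewrite take_size_cat // drop_size_cat.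
by rewrite mem_iota size_cat; lia.
Qed.

Lemma mem_add_letter x acc t :
  t \in add_letter x acc <->
  t \in acc \/ exists t1 t2, t1 ++ t2 \in acc /\ t = t1 ++ x :: t2.
Proof.
rewrite /add_letter mem_cat; split=> [/orP[->|/flattenP[l /mapP[s sa ->]]]|]; first by left.
  by case/mem_insertions => t1 [t2 [e ->]]; right; exists t1, t2; rewrite -e.
case=> [->//|[t1 [t2 [sa ->]]]]; apply/orP; right; apply/flattenP.
by exists (insertions x (t1 ++ t2)); [apply: map_f | apply/mem_insertions; exists t1, t2].
Qed.

Lemma arrangements_rcons N l x :
  arrangements N (rcons l x) = clip N (add_letter x (arrangements N l)).
Proof. by rewrite /arrangements foldl_rcons. Qed.

Lemma mem_arrangements N l s : uniq l -> ~~ nilp (arrangements N l) ->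
  s \in arrangements N l <-> uniq s /\ {subset s <= l}.
Proof.
elim/last_ind: l s => [|l x IH] s.
  move=> _ _; rewrite inE; split=> [/eqP->//|[_ sub]].
  by case: s sub => // a s /(_ a); rewrite inE eqxx => /(_ isT).
rewrite rcons_uniq => /andP[xl ul].
rewrite arrangements_rcons /clip; case: ifP => // _ ne.
(* An empty list stays empty under [add_letter], so a nonempty result means that nothing was ever
   clipped. *)
have nel : ~~ nilp (arrangements N l) by case: (arrangements N l) ne.
rewrite mem_add_letter; split.
- case=> [/(IH _ ul nel)[us sub]|[t1 [t2 [/(IH _ ul nel)[us sub] ->]]]].
    by split=> // y /sub; rewrite mem_rcons inE orbC => ->.
  split; last first.
    move=> y; rewrite mem_cat inE mem_rcons inE.
    by have := sub y; rewrite mem_cat; case: (y == x); rewrite ?orbT //= => H /H->.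
  rewrite -cat1s uniq_catCA cat1s /= us andbT.
  by apply: contra xl => xt; apply: sub.
- move=> [us sub]; case xs: (x \in s); last first.
    left; apply/(IH _ ul nel); split=> // y ys; have := sub y ys.
    by rewrite mem_rcons inE => /orP[/eqP e|//]; rewrite -e ys in xs.
  right; case/splitPr: xs us sub => t1 t2 us sub; exists t1, t2; split=> //.
  have us' : uniq (x :: (t1 ++ t2)) by rewrite -cat1s uniq_catCA cat1s.
  apply/(IH _ ul nel); move: us' => /= /andP[xt ut]; split=> // y yt.
  have := sub y; rewrite mem_rcons inE !mem_cat inE.
  move: yt; rewrite mem_cat => /orP[] yt; rewrite yt ?orbT => /(_ isT)/orP[/eqP e|//].
    by move: xt; rewrite -e mem_cat yt.
  by move: xt; rewrite -e mem_cat yt orbT.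
Qed.

(** Induction on the total length: a head that does not occur in the other sequence is emitted; if
    both heads occur in the other sequence, agreement on the common letters forces them to be
    equal. *)
Lemma amalgam (T : eqType) (p q : seq T) : uniq p -> uniq q ->
  filter (mem q) p = filter (mem p) q ->
  exists r, [/\ uniq r, filter (mem p) r = p, filter (mem q) r = q
              & forall x, x \in r -> (x \in p) || (x \in q)].
Proof.
have [n] := ubnP (size p + size q); elim: n p q => // n IH [|x p] [|y q].
- by move=> _ _ _ _; exists [::].
- move=> _ _ uq _; exists (y :: q); split=> //; first by rewrite (eq_filter (a2 := pred0)) ?filter_pred0.
  by apply/all_filterP/allP.
- move=> _ up _ _; exists (x :: p); split=> //; last by move=> z ->.
    by apply/all_filterP/allP.
  by rewrite (eq_filter (a2 := pred0)) ?filter_pred0.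
move=> sz up uq e.
have [xp up'] := andP up; have [yq uq'] := andP uq.
have sub (s t : seq T) z : z \notin t ->
    filter (mem (z :: s)) t = filter (mem s) t.
  by move=> zt; apply: eq_in_filter => u ut /=; rewrite inE; case: eqP => // eu; rewrite -eu ut in zt.
case xq: (x \in y :: q); last first.
  have [|| r [ur rp rq rs]] := IH p (y :: q) _ up' uq; first by move: sz => /=; lia.
    by move: e; rewrite /= in xq *; rewrite inE in xq; rewrite inE xq /= => ->; rewrite -/(filter _ (y :: q)) [in LHS]sub ?xq // inE xq.
  have xr : x \notin r.
    by apply/negP => /rs; rewrite (negbTE xp) xq.
  exists (x :: r); split=> /=.
  - by rewrite xr.
  - by rewrite inE eqxx /= sub // rp.
  - by rewrite xq.
  - by move=> z; rewrite !inE => /orP[->//|/rs]; rewrite inE -orbA => ->; rewrite orbT.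
case yp: (y \in x :: p); last first.
  have [|| r [ur rp rq rs]] := IH (x :: p) q _ up uq'; first by move: sz => /=; lia.
    by move: e; rewrite [in X in _ = X -> _]/= yp => <-; rewrite sub ?yp.
  have yr : y \notin r.
    by apply/negP => /rs; rewrite (negbTE yq) yp.
  exists (y :: r); split=> /=.
  - by rewrite yr.
  - by rewrite yp.
  - by rewrite inE eqxx /= sub // rq.
  - by move=> z; rewrite !inE => /orP[->|/rs]; rewrite ?orbT // inE => /orP[->//|->]; rewrite !orbT.
have exy : x = y by move: e; rewrite /= xq yp => -[].
rewrite -{y}exy in yq uq e xq yp sz *.
have [|| r [ur rp rq rs]] := IH p q _ up' uq'; first by move: sz => /=; lia.
  by move: e; rewrite /= xq yp sub // sub // => -[].
have xr : x \notin r by apply/negP => /rs; rewrite (negbTE xp) (negbTE yq).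
exists (x :: r); split=> /=.
- by rewrite xr.
- by rewrite inE eqxx /= sub // rp.
- by rewrite inE eqxx /= sub // rq.
- by move=> z; rewrite !inE => /orP[->//|/rs/orP[]->]; rewrite !orbT.
Qed.

Lemma mem_cross es vs x :
  x \in cross es vs <-> exists e, [/\ e \in es, crossb e vs & eid e = x].
Proof.
split=> [/mapP[e]|[e [ei cr <-]]]; last by apply: map_f; rewrite mem_filter cr.
by rewrite mem_filter => /andP[cr ei] ->; exists e.
Qed.

Lemma mem_letters es c x :
  x \in letters es c <-> exists e b, [/\ e \in es, b \in c, crossb e b & eid e = x].
Proof.
split=> [/mapP[e]|[e [b [ei bc cr <-]]]].
  by rewrite mem_filter => /andP[/hasP[b bc cr] ei] ->; exists e, b.
by apply: map_f; rewrite mem_filter ei andbT; apply/hasP; exists b.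
Qed.

Definition restrict (l s : seq nat) : seq nat := filter (fun x => x \in l) s.

(** The invariant of the contractions: one global order of reversals that every block accepts. For
    single vertices it expresses the problem itself, for a single block the nonemptiness of its
    relation. *)
Definition Sol (es : seq eitem) (ps : seq part) : Prop :=
  exists2 s : seq nat, uniq s & forall p, p \in ps -> restrict (cross es p.1) s \in p.2.

Definition disjoint_blocks (bs : seq (seq nat)) : Prop :=
  forall b1 b2 v, b1 \in bs -> b2 \in bs -> v \in b1 -> v \in b2 -> b1 = b2.

Lemma mem_block (ps : seq part) p : p \in ps -> p.1 \in map fst ps.
Proof. exact: map_f. Qed.

Section Contract.
Variables (es : seq eitem) (ps : seq part) (c : seq (seq nat)).
Hypothesis uids : uniq (map eid es).
Hypothesis disj : disjoint_blocks (map fst ps).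
Hypothesis csub : {subset c <= map fst ps}.

Lemma eid_inj e1 e2 : e1 \in es -> e2 \in es -> eid e1 = eid e2 -> e1 = e2.
Proof.
elim: es uids => //= e es' IH /andP[ne ue]; rewrite !inE.
move=> /orP[/eqP->|m1] /orP[/eqP->|m2] // h; last exact: IH.
- by case/negP: ne; rewrite h map_f.
- by case/negP: ne; rewrite -h map_f.
Qed.

Lemma cross_flatten_letters x : x \in cross es (flatten c) -> x \in letters es c.
Proof.
case/mem_cross => e [ei cr <-]; apply/mem_letters.
move: cr; rewrite /crossb; case s: (_ \in flatten c); case d: (_ \in flatten c) => // _.
  case/flattenP: s => b bc sb; exists e, b; split=> //; rewrite /crossb sb /=.
  by apply: contraFN d => db; apply/flattenP; exists b.
case/flattenP: d => b bc db; exists e, b; split=> //; rewrite /crossb db addbT.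
by apply: contraFN s => sb; apply/flattenP; exists b.
Qed.

Lemma cross_letters (p : part) x : p.1 \in c -> x \in cross es p.1 -> x \in letters es c.
Proof.
by move=> pc /mem_cross[e [ei cr <-]]; apply/mem_letters; exists e, p.1.
Qed.

(** By disjointness, an edge that leaves both [p.1] and a block of [c] has one end in each, so it
    leaves the union of [c]. *)
Lemma outer_cross (p : part) x : p \in ps -> p.1 \notin c -> x \in cross es p.1 ->
  x \in letters es c -> x \in cross es (flatten c).
Proof.
move=> pp pc /mem_cross[e [ei cr <-]] /mem_letters[e' [b [ei' bc cr' ee]]].
have {ee ei'} ee : e' = e by apply: eid_inj.
rewrite {e'}ee in cr'; apply/mem_cross; exists e; split=> //.
have out v : v \in p.1 -> v \notin flatten c.
  move=> vp; apply/negP => /flattenP[b' bc' vb].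
  by case/negP: pc; rewrite (disj (mem_block pp) (csub bc') vp vb).
have inn v : v \in b -> v \in flatten c by move=> vb; apply/flattenP; exists b.
move: cr cr'; rewrite /crossb.
case s: (esrc e \in p.1); case d: (edst e \in p.1) => // _.
  rewrite (negbTE (out _ s)) /=; case s': (_ \in b); first by move: (out _ s); rewrite inn.
  by move=> /= /inn ->.
rewrite (negbTE (out _ d)) addbF; case d': (edst e \in b); first by move: (out _ d); rewrite inn.
by rewrite addbF => /inn ->.
Qed.

(** One direction is restriction. For the other, the order that witnesses the join and the order
    outside the union agree on the boundary of the union, and [amalgam] combines them. *)
Lemma Sol_merged sq :
  (forall s, s \in sq <-> uniq s /\ {subset s <= letters es c}) ->
  Sol es ps <-> Sol es (merged es ps c sq).
Proof.
move=> sqP; split.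
- move=> [s us Hs]; exists s => // p; rewrite inE => /orP[/eqP->|]; last first.
    by rewrite mem_filter => /andP[_ /Hs].
  rewrite /= /joined; apply/mapP; exists (restrict (letters es c) s).
    rewrite mem_filter; apply/andP; split.
      apply/allP => q qp; apply/implyP => qc.
      rewrite -/(restrict _ _) (_ : restrict _ _ = restrict (cross es q.1) s) ?Hs //.
      rewrite /restrict -filter_predI; apply: eq_filter => x /=.
      by case xq: (x \in cross es q.1) => //=; apply: cross_letters xq.
    apply/sqP; split; first exact: filter_uniq.
    by move=> x; rewrite mem_filter => /andP[].
  rewrite /restrict -filter_predI; apply: eq_filter => x /=.
  by case xq: (x \in cross es (flatten c)) => //=; rewrite cross_flatten_letters.
- move=> [s' us' Hs']; have := Hs' (flatten c, joined es ps c sq); rewrite inE eqxx.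
  case/(_ isT)/mapP => s0; rewrite mem_filter => /andP[/allP ok /sqP[us0 ss0]] /= e0.
  (* Edges interior to the union are removed from [s']: after the contraction no block constrains
     them, so their order may contradict [s0]. *)
  pose Z := fun x => (x \notin letters es c) || (x \in cross es (flatten c)).
  pose q := filter Z s'.
  have qX x : x \in q -> x \in letters es c -> x \in cross es (flatten c).
    by rewrite mem_filter => /andP[/orP[/negbTE->|]].
  have eX : restrict (cross es (flatten c)) s0 = restrict (cross es (flatten c)) q.
    rewrite /restrict in e0 *; rewrite -e0 /q -filter_predI; apply: eq_filter => x /=.
    by rewrite /Z; case: (x \in cross _ _); rewrite ?orbT ?andbF.
  have mX x : x \in cross es (flatten c) -> (x \in s0) = (x \in q).
    move=> xX; have := congr1 (fun s : seq nat => x \in s) eX.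
    by rewrite !mem_filter xX.
  have c1 x : x \in s0 -> (x \in q) = (x \in cross es (flatten c)).
    move=> xs; apply/idP/idP => [xq|xX]; last by rewrite -mX.
    by apply: qX xq _; apply: ss0.
  have c2 x : x \in q -> (x \in s0) = (x \in cross es (flatten c)).
    move=> xq; apply/idP/idP => [xs|xX]; last by rewrite mX.
    by apply: qX xq _; apply: ss0.
  have [|| r [ur rp rq rs]] := @amalgam _ s0 q us0; first exact: filter_uniq.
    rewrite (eq_in_filter (a2 := fun x => x \in cross es (flatten c))); last by move=> x; apply: c1.
    rewrite [RHS](eq_in_filter (a2 := fun x => x \in cross es (flatten c))); last by move=> x; apply: c2.
    exact: eX.
  exists r => // p pp; case pc: (p.1 \in c).
    have := ok p pp; rewrite pc /= -/(restrict _ _) -{1}rp.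
    rewrite (_ : restrict _ _ = restrict (cross es p.1) r) // /restrict -filter_predI.
    apply: eq_in_filter => x xr /=; case xp: (x \in cross es p.1) => //=.
    have xl := cross_letters pc xp; case/orP: (rs x xr) => // xq.
    by rewrite c2 // qX.
  have := Hs' p; rewrite inE mem_filter pc pp orbT => /(_ isT).
  rewrite (_ : restrict _ s' = restrict (cross es p.1) r) //.
  transitivity (restrict (cross es p.1) q).
    rewrite /restrict /q -filter_predI; apply: eq_filter => x /=.
    case xp: (x \in cross es p.1) => //=; rewrite /Z.
    case xl: (x \in letters es c) => //=.
    by rewrite (outer_cross pp _ xp xl) // pc.
  rewrite -{1}rq /restrict -filter_predI.
  apply: eq_in_filter => x xr /=; case xp: (x \in cross es p.1) => //=.
  case/orP: (rs x xr) => // xs; rewrite c1 //.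
  by apply: (outer_cross pp _ xp); [rewrite pc | apply: ss0].
Qed.

Lemma disjoint_merged sq : disjoint_blocks (map fst (merged es ps c sq)).
Proof.
have out (p : part) v : p \in ps -> p.1 \notin c -> v \in p.1 -> v \notin flatten c.
  move=> pp pc vp; apply/negP => /flattenP[b' bc' vb].
  by case/negP: pc; rewrite (disj (mem_block pp) (csub bc') vp vb).
move=> b1 b2 v /mapP[p1 + ->] /mapP[p2 + ->].
rewrite !inE => /orP[/eqP->|m1] /orP[/eqP->|m2] //=.
- by move: m2; rewrite mem_filter => /andP[pc pp] vf /(out _ _ pp pc); rewrite vf.
- by move: m1; rewrite mem_filter => /andP[pc pp] /(out _ _ pp pc)/negbTE ->.
move: m1 m2; rewrite !mem_filter => /andP[_ h1] /andP[_ h2].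
by apply: disj; apply: mem_block.
Qed.
End Contract.

(** Makes every accepted sequence its own restriction, so that in [Sol_single] any member of the
    last relation is a solution. *)
Definition proper (es : seq eitem) (ps : seq part) : Prop :=
  forall p s, p \in ps -> s \in p.2 -> uniq s /\ {subset s <= cross es p.1}.

Lemma letters_uniq es c : uniq (map eid es) -> uniq (letters es c).
Proof. by move=> u; apply: subseq_uniq u; rewrite map_subseq // filter_subseq. Qed.

Lemma cross_uniq es c : uniq (map eid es) -> uniq (cross es c).
Proof. by move=> u; apply: subseq_uniq u; rewrite map_subseq // filter_subseq. Qed.

Lemma contract_sound N es ps c : uniq (map eid es) ->
  disjoint_blocks (map fst ps) -> proper es ps -> {subset c <= map fst ps} ->
  [/\ Sol es ps <-> Sol es (contract N es ps c),
      disjoint_blocks (map fst (contract N es ps c)) & proper es (contract N es ps c)].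
Proof.
move=> ue dj pr cs; rewrite /contract; case: ifP => // /negbT ne; case: ifP => // _.
have sqP s := @mem_arrangements N _ s (letters_uniq c ue) ne.
split; [exact: Sol_merged | exact: disjoint_merged |].
move=> p s; rewrite inE => /orP[/eqP-> /=|]; last by rewrite mem_filter => /andP[_]; apply: pr.
case/mapP => t; rewrite mem_filter => /andP[_ /sqP[ut st]] ->.
by split; [exact: filter_uniq | move=> x; rewrite mem_filter => /andP[]].
Qed.

Lemma cands_sub N es bs c : c \in cands N es bs -> {subset c <= bs}.
Proof.
rewrite /cands; elim: (size bs) c => [|n IH] c /=.
  case/flattenP => l /mapP[b1 b1s ->] /mapP[b2]; rewrite mem_filter => /andP[_ b2s] ->.
  by move=> b; rewrite !inE => /orP[]/eqP->.
rewrite {1}/growstep; case: ifP => _; last exact: IH.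
rewrite mem_cat => /orP[|/flattenP[l /mapP[d /IH ds ->] /mapP[b]]]; first exact: IH.
rewrite mem_filter => /andP[_ bb] -> b'; rewrite inE => /orP[/eqP->//|]; exact: ds.
Qed.

Lemma onestep_sound N es ps : uniq (map eid es) ->
  disjoint_blocks (map fst ps) -> proper es ps ->
  [/\ Sol es ps <-> Sol es (onestep N es ps),
      disjoint_blocks (map fst (onestep N es ps)) & proper es (onestep N es ps)].
Proof.
move=> ue dj pr; rewrite /onestep; case E: (filter _ _) => [|c l] //.
apply: contract_sound => //; apply: (@cands_sub N es).
by have := mem_head c l; rewrite -E mem_filter => /andP[].
Qed.

Lemma run_sound N es ps : uniq (map eid es) ->
  disjoint_blocks (map fst ps) -> proper es ps ->
  [/\ Sol es ps <-> Sol es (run N es ps),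
      disjoint_blocks (map fst (run N es ps)) & proper es (run N es ps)].
Proof.
move=> ue dj pr; rewrite /run; elim: (size ps) => [|n [IH1 IH2 IH3]] //=.
have [h1 h2 h3] := onestep_sound N ue IH2 IH3.
by split=> //; rewrite IH1.
Qed.

Lemma Sol_single es ps : proper es ps -> size ps <= 1 ->
  all (fun p : part => ~~ nilp p.2) ps <-> Sol es ps.
Proof.
case: ps => [|p [|//]] pr _; first by split=> // _; exists [::].
rewrite /= andbT; split=> [|[s us /(_ p (mem_head _ _))]]; last by case: p.2.
case E: p.2 => [|s l] // _.
have [|us sub] := pr p s (mem_head _ _); first by rewrite E mem_head.
exists s => // q; rewrite inE => /eqP->; rewrite E (_ : restrict _ s = s) ?mem_head //.
by apply/all_filterP/allP.
Qed.

(** The first test in [decide] ensures that no initial relation was cut off by lack of fuel, which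
    could turn a yes into a no. The later steps are sound for any fuel. *)
Lemma decide_sound N es fs b r : uniq (map eid es) ->
  decide N es fs = b :: r ->
  b <-> exists2 s : seq nat, uniq s & forall v, v < size fs ->
    local_ok es v (nth [::] fs v) (restrict (cross es [:: v]) s).
Proof.
move=> ue; rewrite /decide; case: ifP => // /negbT/hasPn ne; case: ifP => // sz [<- _].
set p0 := parts0 N es fs in sz *.
have arrP v s : v < size fs -> s \in arrangements N (cross es [:: v]) <->
    uniq s /\ {subset s <= cross es [:: v]}.
  move=> vs; apply: mem_arrangements; first exact: cross_uniq.
  by apply: (ne v); rewrite mem_iota.
have zipP vf : vf \in zip (iota 0 (size fs)) fs ->
    vf.1 < size fs /\ vf.2 = nth [::] fs vf.1.
  move=> /(nthP (0, [::]))[i]; rewrite size_zip size_iota minnn => isz <-.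
  by rewrite nth_zip ?size_iota //= nth_iota.
have dj : disjoint_blocks (map fst p0).
  move=> b1 b2 v /mapP[p /mapP[vf _ ->] ->] /mapP[q /mapP[vf' _ ->] ->] /=.
  by rewrite !inE => /eqP<- /eqP<-.
have pr : proper es p0.
  move=> p s /mapP[vf /zipP[vs _] ->] /=; rewrite mem_filter => /andP[_].
  by move=> /(arrP _ _ vs).
have [sl _ pr'] := run_sound N ue dj pr.
apply: iff_trans (Sol_single pr' sz) _; apply: iff_trans (iff_sym sl) _.
split=> -[s us Hs]; exists s => //.
- move=> v vs; pose p := ([:: v], filter (local_ok es v (nth [::] fs v)) (arrangements N (cross es [:: v]))).
  have /Hs : p \in p0.
    apply/mapP; exists (v, nth [::] fs v) => //.
    have -> : (v, nth [::] fs v) = nth (0, [::]) (zip (iota 0 (size fs)) fs) v.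
      by rewrite nth_zip ?size_iota // nth_iota.
    by rewrite mem_nth // size_zip size_iota minnn.
  by rewrite mem_filter => /andP[].
- move=> p /mapP[vf /zipP[vs ->] ->] /=; rewrite mem_filter Hs //=.
  apply/arrP => //; split; first exact: filter_uniq.
  by move=> x; rewrite mem_filter => /andP[].
Qed.

(** * Reconfiguration sequences as sequences of reversed edges *)

Section Flips.
Variables (G : cgraph) (C1 : config G).
Implicit Types (t : seq (edge G)) (C D : config G).

Lemma foldl_reverse C t e : foldl (@reverse G) C t e = C e (+) odd (count_mem e t).
Proof.
elim: t C => [|f t IH] C /=; first by rewrite addbF.
rewrite IH ffunE oddD eq_sym; case: eqP => _ /=; by case: (C e) (odd _) => [] [].
Qed.

Lemma foldl_reverse_uniq C t e : uniq t -> foldl (@reverse G) C t e = C e (+) (e \in t).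
Proof. by move=> u; rewrite foldl_reverse count_uniq_mem //; case: (e \in t). Qed.

Lemma path_step C s : path (@step G) C s -> exists t, s = scanl (@reverse G) C t.
Proof.
elim: s C => [|D s IH] C /=; first by exists [::].
move=> /andP[/existsP[e /eqP ->] /IH[t ->]]; by exists (e :: t).
Qed.

Lemma scanl_path C t : path (@step G) C (scanl (@reverse G) C t).
Proof.
elim: t C => //= e t IH C; rewrite IH andbT; by apply/existsP; exists e.
Qed.

Lemma last_scanl C t : last C (scanl (@reverse G) C t) = foldl (@reverse G) C t.
Proof. by elim: t C => //= e t IH C; rewrite IH. Qed.

Lemma all_scanl (p : pred (config G)) C t :
  all p (C :: scanl (@reverse G) C t) <->
  forall k, p (foldl (@reverse G) C (take k t)).
Proof.
elim: t C => [|e t IH] C /=.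
  by rewrite andbT; split=> // /(_ 0).
split=> [/andP[pC h] [|k] //=|H].
  by move: k; apply/IH.
by rewrite (H 0); apply/IH => k; apply: (H k.+1).
Qed.

Lemma reversals_scanl C t e : reversals C (scanl (@reverse G) C t) e = count_mem e t.
Proof.
elim: t C => // f t IH C; rewrite /reversals /= -/(reversals _ _ _).
have := IH (reverse C f); rewrite /reversals => ->; congr (_ + _).
by rewrite ffunE [f == e]eq_sym; case: (e == f); case: (C e).
Qed.

(** Boundedness becomes [uniq], and legality of all configurations becomes a condition on prefixes;
    [k = 0] gives the start and a large [k] the end. *)
Definition legal_flips t : Prop :=
  uniq t /\ forall k, legal (foldl (@reverse G) C1 (take k t)).

Lemma reconf_flips s : reconf_seq C1 s -> bounded C1 s ->
  exists t, [/\ legal_flips t, last C1 s = foldl (@reverse G) C1 t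
              & forall e, (0 < reversals C1 s e) = (e \in t)].
Proof.
move=> /andP[lg /path_step[t st]] bd; rewrite st in lg bd *; exists t; split.
- split; last by apply/all_scanl.
  apply: count_mem_uniq => e; have := bd e; rewrite reversals_scanl.
  by rewrite -has_pred1 has_count; case: (count _ _) => [|[]].
- by rewrite last_scanl.
- by move=> e; rewrite reversals_scanl -has_pred1 has_count.
Qed.

Lemma flips_reconf t : legal_flips t ->
  exists s, [/\ reconf_seq C1 s, bounded C1 s, last C1 s = foldl (@reverse G) C1 t
              & forall e, (0 < reversals C1 s e) = (e \in t)].
Proof.
move=> [ut lg]; exists (scanl (@reverse G) C1 t); split.
- by rewrite /reconf_seq scanl_path andbT; apply/all_scanl.
- by move=> e; rewrite reversals_scanl count_uniq_mem // leq_b1.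
- by rewrite last_scanl.
- by move=> e; rewrite reversals_scanl -has_pred1 has_count.
Qed.
End Flips.

(** * Edges of the graph as numbered items *)

Section Items.
Variables (G : cgraph) (C1 : config G) (may must : edge G -> bool).
Notation E := (edge G).

(** The enumeration also fixes the order of the edge list in the encoding, so the program obtains
    these numbers by counting. *)
Definition edge_rank (e : E) : nat := index e (enum {: edge G}).
Definition edge_unrank (i : nat) : option E := ohead (drop i (enum {: edge G})).

Lemma edge_rankK e : edge_unrank (edge_rank e) = Some e.
Proof.
rewrite /edge_unrank /edge_rank.
have h : index e (enum {: edge G}) < size (enum {: edge G}) by rewrite index_mem mem_enum.
by rewrite (drop_nth e h) /= nth_index // mem_enum.
Qed.

Lemma edge_unrankK : ocancel edge_unrank edge_rank.
Proof.
move=> i; rewrite /edge_unrank /edge_rank; case E: (drop i _) => [|e l] //=.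
have h : i < size (enum {: edge G}).
  by rewrite ltnNge; apply/negP => h; rewrite drop_oversize in E.
by move: E; rewrite (drop_nth e h) => -[<- _]; rewrite index_uniq // enum_uniq.
Qed.

Lemma edge_rank_inj : injective edge_rank.
Proof. exact: (pcan_inj edge_rankK). Qed.

Definition item (e : E) : eitem :=
  (edge_rank e, ((nat_of_ord (sval e).1, nat_of_ord (sval e).2, nat_bits (weight e)),
                 (C1 e, (may e, must e)))).

Definition items : seq eitem := map item (enum {: edge G}).

Lemma mem_item e : item e \in items.
Proof. by apply: map_f; rewrite mem_enum. Qed.

Lemma items_uniq : uniq (map eid items).
Proof.
rewrite -map_comp map_inj_uniq ?enum_uniq // => e f; exact: edge_rank_inj.
Qed.

Definition incident (v : vertex G) (e : E) : bool := ((sval e).1 == v) || ((sval e).2 == v).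

(** The two ends of an edge differ, since its pair is strictly increasing; so for a single vertex
    exclusive and inclusive or agree. *)
Lemma crossb_item (v : vertex G) e : crossb (item e) [:: val v] = incident v e.
Proof.
rewrite /crossb /= !inE /incident -!val_eqE /=.
have /andP[lt _] := svalP e.
rewrite /esrc /edst /=; case: eqP => [<-|_] //.
by rewrite (gtn_eqF lt).
Qed.

Lemma mem_cross_item (v : vertex G) e :
  (edge_rank e \in cross items [:: val v]) = incident v e.
Proof.
rewrite -crossb_item; apply/idP/idP => [/mem_cross[x [/mapP[f _ ->] cr]]|cr].
  by move=> /edge_rank_inj <-.
by apply/mem_cross; exists (item e); rewrite mem_item.
Qed.

(** Only edges at [v] can point to [v], so [p] has to describe [D] on these alone. *)
Lemma inflow_okE (v : vertex G) (p : seq nat) (D : config G) :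
  (forall e, incident v e -> D e = C1 e (+) (edge_rank e \in p)) ->
  inflow_ok items (val v) (nat_bits (inflow v)) p =
  (inflow v <= \sum_(e : E | head_of D e == v) weight e).
Proof.
move=> HD; rewrite /inflow_ok bleE bval_nat_bits bval_bsum big_map big_filter big_map.
rewrite big_enum_cond /=; congr (_ <= _); apply: eq_big => [e|e _]; last first.
  by rewrite /ewt /= bval_nat_bits.
rewrite /ehead /= -(inj_eq val_inj) /head_of; case ie: (incident v e).
  by rewrite HD // /eor /eid /=; case: ifP.
move: ie; rewrite /incident -!(inj_eq val_inj) => /norP[/negbTE h1 /negbTE h2].
by rewrite /esrc /edst /=; case: ifP; case: ifP; rewrite ?h1 ?h2.
Qed.

(** This makes legality local: every moment of a restricted sequence is a moment of the whole one,
    so legality at all times splits into conditions on each vertex and its incident edges. *)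
Lemma take_filter (T : Type) (a : pred T) (s : seq T) k :
  exists j, take k (filter a s) = filter a (take j s).
Proof.
elim: s k => [|x s IH] k /=; first by exists 0.
case ax: (a x).
  case: k => [|k]; first by exists 0.
  by have [j e] := IH k; exists j.+1; rewrite /= ax e.
by have [j e] := IH k; exists j.+1; rewrite /= ax e.
Qed.

Lemma filter_take (T : Type) (a : pred T) (s : seq T) j :
  filter a (take j s) = take (size (filter a (take j s))) (filter a s).
Proof.
rewrite -{3}(cat_take_drop j s) filter_cat take_size_cat //.
Qed.

Lemma all_takes (a : pred (seq nat)) s :
  reflect (forall k, a (take k s)) (all (fun k => a (take k s)) (iota 0 (size s).+1)).
Proof.
apply: (iffP allP) => H k; last by move=> _; apply: H.
case: (leqP k (size s)) => ks; first by apply: H; rewrite mem_iota.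
rewrite take_oversize ?(ltnW ks) //; have := H (size s); rewrite take_size; apply.
by rewrite mem_iota /= add0n.
Qed.

Lemma items_correct :
  (exists2 s : seq nat, uniq s & forall v, v < sg_order G ->
    local_ok items v (nth [::] (map (fun w => nat_bits (inflow w)) (enum {: vertex G})) v)
      (restrict (cross items [:: v]) s)) <->
  (exists2 t : seq E, legal_flips C1 t &
    forall e, (must e -> e \in t) /\ (e \in t -> may e)).
Proof.
have nthE (v : vertex G) : nth [::] (map (fun w => nat_bits (inflow w)) (enum {: vertex G})) v
    = nat_bits (inflow v).
  by rewrite (nth_map v) ?size_enum_ord // nth_ord_enum.
split=> [[s us Hs]|[t [ut lg] mm]].
(* The sequence [s] may contain numbers that belong to no edge; [pmap] drops them. *)
- pose t := pmap edge_unrank s.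
  have rt : map edge_rank t = filter edge_unrank s by apply: pmap_filter edge_unrankK s.
  have ut : uniq t by rewrite -(map_inj_uniq edge_rank_inj) rt filter_uniq.
  have tE e : (e \in t) = (edge_rank e \in s).
    by rewrite -(mem_map edge_rank_inj) rt mem_filter edge_rankK.
  exists t; [split=> // k; apply/forallP => v|].
    have := Hs v (ltn_ord v); rewrite nthE => /andP[/all_takes ok _].
    have [j ej] := take_filter edge_unrank s k; rewrite -rt -map_take in ej.
    have := ok (size (restrict (cross items [:: val v]) (take j s))).
    rewrite /restrict -filter_take (inflow_okE (D := foldl (@reverse G) C1 (take k t))) //.
    move=> e ie; rewrite foldl_reverse_uniq ?take_uniq //; congr (_ (+) _).
    rewrite -(mem_map edge_rank_inj) ej !mem_filter edge_rankK.
    by rewrite mem_cross_item ie.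
  (* The flags of an edge are checked at each of its ends; the first one is used here. *)
  move=> e; have := Hs (val (sval e).1) (ltn_ord _); rewrite nthE => /andP[_ /allP ok].
  have ie : incident (sval e).1 e by rewrite /incident eqxx.
  have := ok _ (mem_item e); rewrite crossb_item ie /= mem_filter.
  by rewrite mem_cross_item ie /= tE => /andP[/implyP h1 /implyP h2].
- exists (map edge_rank t); first by rewrite map_inj_uniq //; apply: edge_rank_inj.
  move=> v vn; rewrite -[v]/(val (Ordinal vn)); move: (Ordinal vn) => {v vn} v.
  rewrite nthE; apply/andP; split.
    apply/all_takes => k.
    have [j ->] := take_filter (fun x => x \in cross items [:: val v]) (map edge_rank t) k.
    rewrite (inflow_okE (D := foldl (@reverse G) C1 (take j t))); last first.
      move=> e ie; rewrite foldl_reverse_uniq ?take_uniq // mem_filter mem_cross_item ie /=.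
      by rewrite -map_take (mem_map edge_rank_inj).
    exact: (forallP (lg j) v).
  apply/allP => _ /mapP[e _ ->]; apply/implyP; rewrite crossb_item => ie.
  rewrite /restrict mem_filter mem_cross_item ie /= (mem_map edge_rank_inj).
  by have [h1 h2] := mm e; apply/andP; split; apply/implyP.
Qed.
End Items.

(** * Instances as inputs of the program *)

Definition graph_input (G : cgraph) : ginput :=
  (map (fun v => nat_bits (inflow v)) (enum {: vertex G}),
   map (fun e : edge G => (nat_bits (sval e).1, nat_bits (sval e).2, nat_bits (weight e)))
     (enum {: edge G})).

Definition config_input (G : cgraph) (C : config G) : seq bool :=
  map (fun e => C e) (enum {: edge G}).

Definition c2c_in (I : c2c_instance) : c2c_input :=
  (graph_input (c2c_graph I), (config_input (c2c_src I), config_input (c2c_dst I))).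

Definition c2e_in (I : c2e_instance) : c2e_input :=
  (graph_input (c2e_graph I),
   ((nat_bits (sval (c2e_edge I)).1, nat_bits (sval (c2e_edge I)).2),
    config_input (c2e_src I))).

Lemma c2c_encode I : encode (d := bounded_C2C_NCL) I = enc (c2c_in I).
Proof.
by rewrite /= /enc_cgraph /enc_config /image_mem /enc /= /Enc_prod /Enc_seq /enc /= -!map_comp.
Qed.

Lemma c2e_encode I : encode (d := bounded_C2E_NCL) I = enc (c2e_in I).
Proof.
by rewrite /= /enc_cgraph /enc_config /image_mem /enc /= /Enc_prod /Enc_seq /enc /= -!map_comp.
Qed.

Lemma zip_iota_map (T U : eqType) (f : nat * T -> U) (s : seq T) : uniq s ->
  map f (zip (iota 0 (size s)) s) = map (fun x => f (index x s, x)) s.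
Proof.
move=> us; case: s us => // x0 s us; set l := x0 :: s in us *.
apply: (@eq_from_nth _ (f (0, x0))); first by rewrite !size_map size_zip size_iota minnn.
move=> i; rewrite size_map size_zip size_iota minnn => il.
rewrite (nth_map (0, x0)) ?size_zip ?size_iota ?minnn // nth_zip ?size_iota //.
by rewrite (nth_map x0) // nth_iota // index_uniq.
Qed.

Lemma mkitems_map (T : eqType) a (f : T -> seq bool * seq bool * seq bool)
    (g : T -> bool * (bool * bool)) (s : seq T) : uniq s ->
  mkitems (a, map f s) (map g s) =
  map (fun x => mkitem (size a) (index x s, (f x, g x))) s.
Proof.
move=> us; rewrite /mkitems /= size_map zip_map.
have -> (U : Type) (h : T -> U) (n : seq nat) :
    zip n (map h s) = map (fun q => (q.1, h q.2)) (zip n s).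
  by elim: (s) n => [|x s' IH] [|y n] //=; rewrite IH.
by rewrite -map_comp zip_iota_map.
Qed.

Lemma mkitems_graph (G : cgraph) (C1 : config G) may must :
  mkitems (graph_input G) (map (fun e => (C1 e, (may e, must e))) (enum {: edge G})) =
  items C1 may must.
Proof.
rewrite /graph_input mkitems_map ?enum_uniq //; apply: eq_map => e.
rewrite /mkitem /item !cap_valE size_map size_enum_ord.
rewrite (_ : (_, _).2.1 = (nat_bits (sval e).1, nat_bits (sval e).2, nat_bits (weight e))) //.
by rewrite !bval_nat_bits !(minn_idPl (ltnW (ltn_ord _))).
Qed.

Lemma c2c_itemsE I : c2c_items (c2c_in I) =
  items (c2c_src I) (fun e => c2c_src I e (+) c2c_dst I e) (fun e => c2c_src I e (+) c2c_dst I e).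
Proof. by rewrite /c2c_items /= zip_map -map_comp -mkitems_graph. Qed.

Lemma bits_eqE a b : bits_eq a b = (bval a == bval b).
Proof. by rewrite /bits_eq !bleE eqn_leq. Qed.

Lemma c2e_itemsE I : c2e_items (c2e_in I) =
  items (c2e_src I) xpredT (pred1 (c2e_edge I)).
Proof.
rewrite /c2e_items /= zip_map -map_comp -mkitems_graph; congr mkitems.
apply: eq_map => e /=; rewrite !bits_eqE !bval_nat_bits.
by rewrite -(inj_eq val_inj) /= [in RHS]/eq_op /= -!(inj_eq val_inj).
Qed.

Lemma c2c_correct I N b r :
  decide N (c2c_items (c2c_in I)) (c2c_in I).1.1 = b :: r ->
  b <-> yes (d := bounded_C2C_NCL) I.
Proof.
rewrite c2c_itemsE => h.
apply: iff_trans (decide_sound (items_uniq _ _ _) h) _.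
rewrite size_map size_enum_ord; apply: iff_trans (items_correct _ _ _) _.
split=> [[t lt mm]|[s [rs bs ls]]].
- have [s [h1 h2 h3 _]] := flips_reconf lt; exists s; split=> //.
  rewrite h3; apply/ffunP => e; rewrite foldl_reverse_uniq ?(proj1 lt) //.
  have [m1 m2] := mm e; move: m1 m2.
  by case: (c2c_src I e) (c2c_dst I e) (e \in t) => [] [] [] // h4 h5; move: (h4 isT) || move: (h5 isT).
- have [t [lt lst _]] := reconf_flips rs bs; exists t => // e.
  have := congr1 (fun D : config _ => D e) lst; rewrite ls foldl_reverse_uniq ?(proj1 lt) // => ->.
  by case: (c2c_src I e) (e \in t) => [] [].
Qed.

Lemma c2e_correct I N b r :
  decide N (c2e_items (c2e_in I)) (c2e_in I).1.1 = b :: r ->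
  b <-> yes (d := bounded_C2E_NCL) I.
Proof.
rewrite c2e_itemsE => h.
apply: iff_trans (decide_sound (items_uniq _ _ _) h) _.
rewrite size_map size_enum_ord; apply: iff_trans (items_correct _ _ _) _.
split=> [[t lt mm]|[s [rs bs ls]]].
- have [s [h1 h2 h3 h4]] := flips_reconf lt; exists s; split=> //.
  by rewrite h4; apply: (mm _).1 => /=.
- have [t [lt _ h4]] := reconf_flips rs bs; exists t => // e; split=> // /eqP->.
  by rewrite -h4.
Qed.

(** * Carvings *)

Section Carving.
Variables (T : finType) (d : {set T} -> nat).
Hypothesis d_sym : forall A, d (~: A) = d A.
Hypothesis d_sub : forall A B, d (A :|: B) + d (A :&: B) <= d A + d B.
Hypothesis d_0 : d set0 = 0.
Implicit Types (A B X Y : {set T}) (P Q : {set {set T}}).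

(** Submodularity for [A] and the complement of [B], rewritten by symmetry. *)
Lemma d_posi A B : d (A :\: B) + d (B :\: A) <= d A + d B.
Proof.
have := d_sub A (~: B); rewrite d_sym -setDE; apply: leq_trans.
by rewrite addnC leq_add2r -[d (A :|: _)]d_sym setCU setCK setIC -setDE.
Qed.

Lemma d_T : d setT = 0.
Proof. by rewrite -d_sym setCT d_0. Qed.

Section Part.
Variable P : {set {set T}}.
Hypothesis partP : partition P setT.

Definition sat A := forall B, B \in P -> (B \subset A) || [disjoint B & A].
Definition nb A := #|[set B in P | B \subset A]|.

Inductive carvable (w : nat) : {set T} -> Prop :=
  | carvable_block B : B \in P -> d B <= w -> carvable w B
  | carvable_union A B : carvable w A -> carvable w B -> [disjoint A & B] ->
      d (A :|: B) <= w -> carvable w (A :|: B).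

Lemma block_neq0 B : B \in P -> B != set0.
Proof. by case/and3P: partP => _ _ h; apply: contraTneq => ->. Qed.

Lemma block_disj B C x : B \in P -> C \in P -> x \in B -> x \in C -> B = C.
Proof.
case/and3P: partP => _ tr _ BP CP xB xC; rewrite -(def_pblock tr BP xB).
exact: def_pblock.
Qed.

Lemma block_mem x : exists2 B, B \in P & x \in B.
Proof.
have := in_setT x; case/and3P: partP => /eqP <- _ _; rewrite -mem_pblock => xB.
by exists (pblock P x) => //; apply: pblock_mem; rewrite -mem_pblock.
Qed.

Lemma sat_block B : B \in P -> sat B.
Proof.
move=> BP C CP; case: (boolP [disjoint C & B]) => [_|]; first by rewrite orbT.
rewrite -setI_eq0 => /set0Pn[x]; rewrite inE => /andP[xC xB].
by rewrite (block_disj CP BP xC xB) subxx.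
Qed.

Lemma satT : sat setT.
Proof. by move=> B _; rewrite subsetT. Qed.

Lemma satU A B : sat A -> sat B -> sat (A :|: B).
Proof.
move=> sA sB C CP; case/orP: (sA C CP) => [h|dA].
  by rewrite (subset_trans h) // subsetUl.
case/orP: (sB C CP) => [h|dB]; first by rewrite (subset_trans h) // subsetUr.
apply/orP; right; move: dA dB; rewrite -!setI_eq0 setIUr => /eqP-> /eqP->.
by rewrite setU0.
Qed.

Lemma satI A B : sat A -> sat B -> sat (A :&: B).
Proof.
move=> sA sB C CP; case/orP: (sA C CP) => [h|dA]; last first.
  by apply/orP; right; apply: disjointWr dA; apply: subsetIl.
case/orP: (sB C CP) => [h'|dB]; first by rewrite subsetI h h'.
by apply/orP; right; apply: disjointWr dB; apply: subsetIr.
Qed.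

Lemma satC A : sat A -> sat (~: A).
Proof.
move=> sA C CP; case/orP: (sA C CP) => h; last by rewrite -disjoints_subset h.
by apply/orP; right; rewrite disjoint_sym disjoints_subset setCS.
Qed.

Lemma satD A B : sat A -> sat B -> sat (A :\: B).
Proof. by move=> sA sB; rewrite setDE; apply: satI => //; apply: satC. Qed.

Lemma nb_disjU A B : sat A -> [disjoint A & B] -> nb (A :|: B) = nb A + nb B.
Proof.
move=> sA dAB; rewrite /nb -cardsUI.
have -> : [set C in P | C \subset A] :&: [set C in P | C \subset B] = set0.
  apply/setP => C; rewrite !inE; apply/negP => /andP[/andP[CP hA] /andP[_ hB]].
  have /set0Pn[x xC] := block_neq0 CP.
  move: dAB; rewrite -setI_eq0 => /eqP/setP/(_ x).
  by rewrite !inE (subsetP hA) // (subsetP hB).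
rewrite cards0 addn0; apply: eq_card => C; rewrite !inE; case CP: (C \in P) => //=.
apply/idP/orP => [h|[h|h]]; last 2 first.
- by rewrite (subset_trans h) // subsetUl.
- by rewrite (subset_trans h) // subsetUr.
case/orP: (sA C CP) => hC; [by left | right].
apply/subsetP => x xC; have := subsetP h x xC; rewrite inE => /orP[xA|//].
by move: hC; rewrite -setI_eq0 => /eqP/setP/(_ x); rewrite !inE xC xA.
Qed.

Lemma nb_block B : B \in P -> nb B = 1.
Proof.
move=> BP; rewrite /nb -(cards1 B); apply: eq_card => C; rewrite !inE.
apply/andP/eqP => [[CP h]|->]; last by rewrite BP subxx.
have /set0Pn[x xC] := block_neq0 CP.
exact: block_disj CP BP xC (subsetP h x xC).
Qed.

Lemma nb_gt0 A : sat A -> A != set0 -> 0 < nb A.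
Proof.
move=> sA /set0Pn[x xA]; have [B BP xB] := block_mem x.
apply/card_gt0P; exists B; rewrite inE BP.
case/orP: (sA B BP) => //; rewrite -setI_eq0 => /eqP/setP/(_ x).
by rewrite !inE xA xB.
Qed.

Lemma carvable_sat w A : carvable w A -> sat A.
Proof. by elim=> [B BP _|{}A B _ sA _ sB _ _]; [apply: sat_block | apply: satU]. Qed.

Lemma carvable_le w A : carvable w A -> d A <= w.
Proof. by case. Qed.

Lemma carvable_neq0 w A : carvable w A -> A != set0.
Proof.
elim=> [B /block_neq0//|{}A B _ A0 _ _ _ _].
by rewrite setU_eq0 (negbTE A0).
Qed.

(** Descending to a lowest node with more than 3 ^ w blocks gives one whose two children have at
    most 3 ^ w blocks each; a leaf is too small to be such a node. *)
Lemma carvable_large w A : carvable w A -> 3 ^ w < nb A ->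
  exists Y, [/\ sat Y, d Y <= w, 3 ^ w < nb Y & nb Y <= 2 * 3 ^ w].
Proof.
elim=> [B BP _|{}A B cA IA cB IB dAB dU].
  by rewrite nb_block // ltnNge expn_gt0.
move=> h; case: (ltnP (3 ^ w) (nb A)) => [/IA//|hA].
case: (ltnP (3 ^ w) (nb B)) => [/IB//|hB].
exists (A :|: B); split=> //; first by apply: satU; apply: carvable_sat; eassumption.
by rewrite (nb_disjU (carvable_sat cA) dAB); lia.
Qed.

Definition good_set X := 3 ^ d X < nb X.

Lemma exists_good w : carvable w setT -> 1 < nb setT ->
  exists Y, [/\ sat Y, good_set Y & nb Y <= 2 * 3 ^ w].
Proof.
move=> cT n1; case: (leqP (nb setT) (2 * 3 ^ w)) => h.
  by exists setT; split=> //; [apply: satT | rewrite /good_set d_T].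
have [|Y [sY dY h1 h2]] := carvable_large cT; first by lia.
exists Y; split=> //; rewrite /good_set; apply: leq_ltn_trans h1.
by rewrite leq_exp2l.
Qed.

(** The parts may be empty; [C = set0] gives the two-part version [titanic2]. *)
Definition titanic X := forall A B C, sat A -> sat B -> sat C ->
  A :|: B :|: C = X -> [disjoint A & B] -> [disjoint A :|: B & C] ->
  [|| d X <= d A, d X <= d B | d X <= d C].

Lemma min_good_titanic X : sat X -> good_set X ->
  (forall Y, sat Y -> good_set Y -> nb X <= nb Y) -> titanic X.
Proof.
move=> sX gX mX A B C sA sB sC eX dAB dABC; rewrite !(leqNgt (d X)) -!negb_and.
apply/negP => /and3P[hA hB hC].
have nbX : nb X = nb A + nb B + nb C.
  by rewrite -eX nb_disjU //; [rewrite nb_disjU | apply: satU].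
(* With more blocks [D] would be good itself; by minimality of [X] nothing of [X] could lie outside
   [D], so [D] would equal [X]. *)
have key D : sat D -> D \subset X -> d D < d X -> nb D <= 3 ^ (d X).-1.
  move=> sD DX hD; rewrite leqNgt; apply/negP => hn.
  have gD : good_set D.
    by apply: leq_ltn_trans hn; rewrite leq_exp2l //; lia.
  have e : nb (D :|: (X :\: D)) = nb D + nb (X :\: D).
    by apply: nb_disjU => //; rewrite -setI_eq0 setIDA setIC -setIDA setDv setI0.
  have eX' : D :|: (X :\: D) = X.
    by apply/setP => x; rewrite !inE; case xD: (x \in D) => //=; rewrite (subsetP DX).
  have := mX D sD gD; rewrite -{1}eX'.
  rewrite e; case: (eqVneq (X :\: D) set0) => [XD0|ne]; last first.
    by have := nb_gt0 (satD sX sD) ne; lia.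
  have XD : X = D by apply/eqP; rewrite eqEsubset DX andbT -setD_eq0 XD0.
  by rewrite XD ltnn in hD.
have sub D : D \in [:: A; B; C] -> D \subset X.
  by rewrite !inE -eX => /or3P[]/eqP->; apply/subsetP => x; rewrite !inE => ->; rewrite ?orbT.
have := key A sA (sub A _) hA; rewrite !inE eqxx => /(_ isT).
have := key B sB (sub B _) hB; rewrite !inE eqxx !orbT => /(_ isT).
have := key C sC (sub C _) hC; rewrite !inE eqxx !orbT => /(_ isT).
move=> k1 k2 k3; move: gX; rewrite /good_set nbX.
have -> : 3 ^ d X = 3 * 3 ^ (d X).-1 by rewrite -expnS prednK //; lia.
lia.
Qed.
End Part.

Section Contraction.
Variables (P Q : {set {set T}}) (w : nat).
Hypothesis partP : partition P setT.
Hypothesis QP : Q \subset P.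
Let X := cover Q.
Hypothesis dX : d X <= w.
Hypothesis titX : titanic P X.
Let P' := X |: (P :\: Q).

Let satX : sat P X.
Proof.
move=> B BP; case: (boolP (B \in Q)) => BQ; first by rewrite (bigcup_sup B).
apply/orP; right; rewrite -setI_eq0; apply/eqP/setP => x; rewrite !inE.
apply/negP => /andP[xB /bigcupP[C CQ xC]].
by case/negP: BQ; rewrite (block_disj partP BP (subsetP QP _ CQ) xB xC).
Qed.

Lemma titanic2 A : sat P A -> (d X <= d (A :&: X)) || (d X <= d (X :\: A)).
Proof.
move=> sA.
have := titX (satI sA satX) (satD satX sA) (_ : sat P set0).
have s0 : sat P set0 by move=> B _; rewrite -[[disjoint _ & _]]setI_eq0 setI0 eqxx orbT.
move=> /(_ s0); rewrite setU0 setIC setID => /(_ erefl).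
rewrite -!setI_eq0 setI0 eqxx setIDA [X :&: A :&: X]setIC setIA setIid setDIl.
rewrite setDv setI0 eqxx d_0 => /(_ isT isT) /or3P[->|->|] //; first by rewrite orbT.
by rewrite leqn0 => /eqP->.
Qed.

Let big A := d X <= d A.

(** Uncrossing: in the submodular inequality [d (A :&: X)] pays for [d X]. The next lemma does the
    same with [d_posi]. *)
Lemma d_join A : big (A :&: X) -> d (A :|: X) <= d A.
Proof. by move=> b; have := d_sub A X; rewrite /big in b; lia. Qed.

Lemma d_minus A : big (X :\: A) -> d (A :\: X) <= d A.
Proof. by move=> b; have := d_posi A X; rewrite /big in b; lia. Qed.

(** Removing [X] from a node of the carving may leave nothing, whereas carvable sets are
    nonempty. *)
Definition carvable0 (R : {set {set T}}) A := A = set0 \/ carvable R w A.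

Lemma carvable0U R A B : carvable0 R A -> carvable0 R B -> [disjoint A & B] -> d (A :|: B) <= w ->
  carvable0 R (A :|: B).
Proof.
move=> [->|cA] [->|cB] dAB dU; rewrite ?set0U ?setU0.
- by left.
- by right.
- by right.
- by right; apply: carvable_union.
Qed.

(** Otherwise [X :\: A] and [D :&: X] would be big; but they are the two differences of the small
    sets [A :&: X] and [X :\: D], against [d_posi]. *)
Lemma small_pair A D : sat P A -> sat P D -> D \subset A ->
  d (X :\: D) < d X -> big (A :&: X).
Proof.
move=> sA sD DA sm; rewrite /big leqNgt; apply/negP => smA.
have bA : d X <= d (X :\: A).
  by case/orP: (titanic2 sA) => //; rewrite leqNgt smA.
have bD : d X <= d (D :&: X).
  by case/orP: (titanic2 sD) => //; rewrite leqNgt sm.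
have := d_posi (A :&: X) (X :\: D).
have -> : (A :&: X) :\: (X :\: D) = D :&: X.
  apply/setP => x; rewrite !inE; have := subsetP DA x.
  by case: (x \in D) (x \in A) (x \in X) => [] [] [] //= /(_ isT).
have -> : (X :\: D) :\: (A :&: X) = X :\: A.
  apply/setP => x; rewrite !inE; have := subsetP DA x.
  by case: (x \in D) (x \in A) (x \in X) => [] [] [] //= /(_ isT).
lia.
Qed.

(** Each node [A] of the carving is replaced by [A :\: X] or by [A :|: X]. In the second case [D]
    records that [A] contains so much of [X] that the rest of [X] is small; this prevents two
    disjoint nodes from both absorbing [X]. *)
Lemma carvable_contract_aux A : carvable P w A ->
  carvable0 P' (A :\: X) \/
  (carvable0 P' (A :|: X) /\ exists D, [/\ sat P D, D \subset A & d (X :\: D) < d X]).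
Proof.
have disjDX (A1 A2 : {set T}) : [disjoint A1 & A2] -> [disjoint A1 :\: X & A2 :\: X].
  by move=> h; apply: disjointWl (subsetDl _ _) _; apply: disjointWr (subsetDl _ _) h.
have disjUX (A1 A2 : {set T}) : [disjoint A1 & A2] -> [disjoint A1 :|: X & A2 :\: X].
  move=> h; rewrite -setI_eq0; apply/eqP/setP => x; rewrite !inE.
  have := disjointFr h (x := x).
  by case: (x \in A1) (x \in A2) (x \in X) => [] [] [] //= /(_ isT).
have eqUX (A1 A2 : {set T}) : (A1 :|: X) :|: (A2 :\: X) = (A1 :|: A2) :|: X.
  by apply/setP => x; rewrite !inE; case: (x \in A1) (x \in A2) (x \in X) => [] [] [].
have cX : carvable0 P' X.
  by right; apply: carvable_block => //; rewrite !inE eqxx.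
elim=> [B BP dB|{}A B cA IA cB IB dAB dU].
  left; case: (boolP (B \in Q)) => BQ.
    by left; apply/eqP; rewrite setD_eq0 (bigcup_sup B).
  right; have -> : B :\: X = B.
    apply/setDidPl; case/orP: (satX BP) => // h.
    have /set0Pn[x xB] := block_neq0 partP BP.
    have /bigcupP[C CQ xC] := subsetP h x xB.
    by case/negP: BQ; rewrite (block_disj partP BP (subsetP QP _ CQ) xB xC).
  by apply: carvable_block => //; rewrite !inE BQ BP orbT.
have sA := carvable_sat partP cA; have sB := carvable_sat partP cB.
have sU := satU sA sB.
have absorb (A1 A2 : {set T}) : A1 :|: A2 = A :|: B -> [disjoint A1 & A2] ->
    carvable0 P' (A1 :|: X) -> carvable0 P' (A2 :\: X) -> big ((A :|: B) :&: X) ->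
    carvable0 P' ((A :|: B) :|: X).
  move=> e h c1 c2 b; rewrite -e -eqUX; apply: carvable0U => //; first exact: disjUX.
  by rewrite eqUX e; apply: leq_trans (d_join b) dU.
have dBA : [disjoint B & A] by rewrite disjoint_sym.
case: IA => [a1|[a1 [D1 [sD1 D1A sm1]]]]; case: IB => [b1|[b1 [D2 [sD2 D2B sm2]]]].
(* Neither child has absorbed [X]. If the part of [X] outside both is big, [X] can be removed from
   the union too; otherwise one of the parts inside the children is big, as [X] is titanic, and that
   child absorbs [X]. *)
- case: (leqP (d X) (d (X :\: (A :|: B)))) => bU.
    left; rewrite setDUl; apply: carvable0U => //; first exact: disjDX.
    by rewrite -setDUl; apply: leq_trans (d_minus bU) dU.
  right; split; last by exists (A :|: B).
  have bUX : big ((A :|: B) :&: X).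
    by case/orP: (titanic2 sU) => //; rewrite leqNgt bU.
  have side (A1 A2 : {set T}) : carvable P w A1 -> carvable0 P' (A1 :\: X) -> big (A1 :&: X) ->
      carvable0 P' (A1 :|: X).
    move=> c1 c2 b; rewrite (_ : _ :|: _ = (A1 :\: X) :|: X); last first.
      by apply/setP => x; rewrite !inE; case: (x \in A1) (x \in X) => [] [].
    apply: carvable0U => //; first by rewrite -setI_eq0 setIDAC setDIl setDv setI0.
    rewrite (_ : _ :|: _ = A1 :|: X); last first.
      by apply/setP => x; rewrite !inE; case: (x \in A1) (x \in X) => [] [].
    by apply: leq_trans (d_join b) (carvable_le c1).
  have := titX (satI sA satX) (satI sB satX) (satD satX sU).
  rewrite -setIUl setIC setID => /(_ erefl).
  have h1 : [disjoint X :&: A & B :&: X].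
    by apply: disjointWl (subsetIr _ _) _; apply: disjointWr (subsetIl _ _) dAB.
  have h2 : [disjoint X :&: (A :|: B) & X :\: (A :|: B)].
    by rewrite -setI_eq0 setIDA setIAC setIid -setIDA setDv setI0.
  rewrite (setIC A X) => /(_ h1 h2) /or3P[bA|bB|]; last by rewrite leqNgt bU.
  + apply: (absorb A B) => //; apply: side => //; by rewrite /big setIC.
  + by apply: (absorb B A) => //; [rewrite setUC | apply: side].
- right; split; last first.
    by exists D2; split=> //; apply: subset_trans D2B (subsetUr _ _).
  apply: (absorb B A) => //; first by rewrite setUC.
  by apply: (small_pair (D := D2)) => //; apply: subset_trans D2B (subsetUr _ _).
- right; split; last first.
    by exists D1; split=> //; apply: subset_trans D1A (subsetUl _ _).
  apply: (absorb A B) => //.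
  by apply: (small_pair (D := D1)) => //; apply: subset_trans D1A (subsetUl _ _).
(* If both children had absorbed [X], the sets [X :\: D1] and [X :\: D2] would be small while their
   differences [D2 :&: X] and [D1 :&: X] are big, against [d_posi]. *)
- exfalso.
  have dis : [disjoint D1 & D2] by apply: disjointWl D1A _; apply: disjointWr D2B dAB.
  have bD1 : d X <= d (D1 :&: X).
    by case/orP: (titanic2 sD1) => //; rewrite leqNgt sm1.
  have bD2 : d X <= d (D2 :&: X).
    by case/orP: (titanic2 sD2) => //; rewrite leqNgt sm2.
  have := d_posi (X :\: D1) (X :\: D2).
  have -> : (X :\: D1) :\: (X :\: D2) = D2 :&: X.
    apply/setP => x; rewrite !inE; have := disjointFr dis (x := x).
    by case: (x \in D1) (x \in D2) (x \in X) => [] [] [] //= /(_ isT).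
  have -> : (X :\: D2) :\: (X :\: D1) = D1 :&: X.
    apply/setP => x; rewrite !inE; have := disjointFr dis (x := x).
    by case: (x \in D1) (x \in D2) (x \in X) => [] [] [] //= /(_ isT).
  lia.
Qed.

(** If no node has absorbed [X], it is attached as a leaf at the root. *)
Lemma carvable_contract : carvable P w setT -> carvable P' w setT.
Proof.
move=> cT; have nT := carvable_neq0 partP cT.
have cX : carvable P' w X by apply: carvable_block => //; rewrite !inE eqxx.
have {cT} := carvable_contract_aux cT; rewrite setTU => -[[e|c]|[[e|//] _]].
- suff -> : setT = X by [].
  by apply/esym/eqP; rewrite -subTset -setD_eq0 e.
- rewrite -(setUCr X) setUC -setTD; apply: carvable_union => //.
    by rewrite -setI_eq0 setTD setIC setICr.
  by rewrite setTD setUC setUCr d_T.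
- by rewrite e eqxx in nT.
Qed.
End Contraction.
End Carving.

(** * From tree decompositions to carvings *)

Section CutFunction.
Variable G : sgraph.
Implicit Types (S A B : {set vertex G}) (e : edge G).

Definition cut S : {set edge G} := [set e : edge G | ((sval e).1 \in S) (+) ((sval e).2 \in S)].
Definition cutd S : nat := #|cut S|.

Lemma cutd_sym A : cutd (~: A) = cutd A.
Proof. by apply: eq_card => e; rewrite !inE addbN addNb negbK. Qed.

Lemma cutd_0 : cutd set0 = 0.
Proof. by apply: eq_card0 => e; rewrite !inE. Qed.

Lemma cutd_sub A B : cutd (A :|: B) + cutd (A :&: B) <= cutd A + cutd B.
Proof.
rewrite /cutd -!sum1_card !(big_mkcond (fun e => e \in _)) -!big_split /=.
apply: leq_sum => e _; rewrite !inE.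
by case: (_ \in A) (_ \in B) (_ \in A) (_ \in B) => [] [] [] [].
Qed.

Definition singletons : {set {set vertex G}} := [set [set v] | v : vertex G].

Definition covers (b S : {set vertex G}) : Prop :=
  forall u v, adj u v -> u \in S -> v \notin S -> (u \in b) || (v \in b).

Definition incident_edges (v : vertex G) : {set edge G} :=
  [set e : edge G | ((sval e).1 == v) || ((sval e).2 == v)].

Lemma card_incident_edges v : #|incident_edges v| <= max_degree G.
Proof.
apply: leq_trans (leq_bigmax v).
(* The map to the other end is injective on the edges at [v], because an edge is stored only once,
   with its smaller end first. *)
pose other (e : edge G) := if (sval e).1 == v then (sval e).2 else (sval e).1.
rewrite -(card_in_imset (f := other)).
  apply/subset_leq_card/subsetP => u /imsetP[e]; rewrite !inE => inc ->.
  have /andP[_ ae] := svalP e; rewrite /other.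
  case: (eqVneq (sval e).1 v) inc => [e1 _|ne /= /eqP e2]; first by rewrite -{1}e1.
  by rewrite -{1}e2 adj_sym.
move=> e f; rewrite !inE /other => he hf eo.
have /andP[le _] := svalP e; have /andP[lf _] := svalP f.
apply: val_inj => /=; case: (sval e) (sval f) le lf he hf eo => [a b] [a' b'] /=.
case: (eqVneq a v) => [->|_]; case: (eqVneq a' v) => [->|_] //=.
- by move=> _ _ _ _ ->.
- by move=> l1 + _ /eqP e2 e1; rewrite e2 -e1 => l2; have := ltn_trans l1 l2; rewrite ltnn.
- by move=> + l2 /eqP e2 _ e1; rewrite e2 e1 => l1; have := ltn_trans l1 l2; rewrite ltnn.
- by move=> _ _ /eqP-> /eqP-> ->.
Qed.

(** The origin of the width (k + 1) * D: every edge leaving [S] has an end in the bag, and each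
    vertex of the bag has at most [max_degree G] edges. *)
Lemma cutd_covered (b : {set vertex G}) S k : #|b| <= k -> covers b S -> cutd S <= k * max_degree G.
Proof.
move=> bk cv; apply: (@leq_trans #|\bigcup_(v in b) incident_edges v|).
  apply/subset_leq_card/subsetP => e; rewrite inE => h; have /andP[_ ae] := svalP e.
  have : ((sval e).1 \in b) || ((sval e).2 \in b).
    move: h; case h1: (_ \in S); case h2: (_ \in S) => // _.
      by apply: (cv _ _ ae) => //; rewrite h2.
    by rewrite orbC; apply: cv; rewrite ?h1 // adj_sym.
  by case/orP => vb; apply/bigcupP; [exists (sval e).1 | exists (sval e).2];
    rewrite // inE eqxx ?orbT.
apply: (@leq_trans (\sum_(v in b) #|incident_edges v|)).
  elim/big_rec2: _ => [|v m A _ h]; first by rewrite cards0.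
  by apply: leq_trans (leq_card_setU _ _) _; rewrite leq_add2l.
apply: (@leq_trans (\sum_(v in b) max_degree G)).
  by apply: leq_sum => v _; apply: card_incident_edges.
by rewrite sum_nat_const leq_mul2r bk orbT.
Qed.
End CutFunction.

Section TreeDecomposition.
Variables (G T : sgraph) (bag : vertex T -> {set vertex G}) (k : nat).
Hypothesis td : is_tree_decomp bag.
Hypothesis width : forall x, #|bag x| <= k.+1.
Implicit Types (x y z t : vertex T) (u v : vertex G).

Let w := k.+1 * max_degree G.
Let treeT : is_tree T := let: And4 h _ _ _ := td in h.
Let cov v : exists x, v \in bag x := let: And4 _ h _ _ := td in h v.
Let covE u v (a : adj u v) : exists x, (u \in bag x) && (v \in bag x) :=
  let: And4 _ _ h _ := td in h u v a.
Let coh v x y (hx : v \in bag x) (hy : v \in bag y) :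
    connect [rel a b | [&& adj a b, v \in bag a & v \in bag b]] x y :=
  let: And4 _ _ _ h := td in h v x y hx hy.

Definition avoid x : rel (vertex T) := [rel a b | [&& adj a b, a != x & b != x]].
(** For [y] different from [x], the component of [y] in the tree without [x]. *)
Definition branch x y : {set vertex T} := [set z | connect (avoid x) y z].

Lemma branch_self x y : y \in branch x y.
Proof. by rewrite inE connect0. Qed.

Lemma avoid_path x y p : path (avoid x) y p -> path (@adj T) y p /\ {in p, forall z, z != x}.
Proof.
elim: p y => //= z p IH y /andP[/and3P[a _ zx] /IH[h1 h2]].
split=> [|t]; first by apply/andP; split.
by rewrite inE => /orP[/eqP->|/h2].
Qed.

Lemma path_avoid x y p : y != x -> path (@adj T) y p -> {in p, forall z, z != x} ->
  path (avoid x) y p.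
Proof.
elim: p y => //= z p IH y yx /andP[a h] H; have zx := H z (mem_head _ _).
apply/andP; split; first exact/and3P.
by apply: IH => // t tp; apply: H; rewrite inE tp orbT.
Qed.

Lemma branch_neq x y z : y != x -> z \in branch x y -> z != x.
Proof.
move=> yx; rewrite inE => /connectP[p pp ->]; have [_ h] := avoid_path pp.
by have := mem_last y p; rewrite inE => /orP[/eqP->|/h].
Qed.

(** A path from [y] to [z] that avoids [x] would close a cycle through [x]. *)
Lemma branch_sep x y z : adj x y -> adj x z -> y != z -> z \notin branch x y.
Proof.
move=> xy xz yz; apply/negP; rewrite inE => /connectP[p0 pp0 e0].
have yx : y != x by apply: contraTneq xy => ->; rewrite adj_irr.
move: e0; case/shortenP: pp0 => p pp up _ ez.
have [ap hp] := avoid_path pp; have [_ _ acyc] := treeT.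
apply: (acyc [:: x, y & p]).
  by case: p ez {pp up ap hp} => //= e; rewrite e eqxx in yz.
rewrite /ucycle (cons_uniq x) up andbT /= rcons_path ap xy -ez adj_sym xz /=.
by rewrite inE negb_or eq_sym yx /=; apply/negP => /hp; rewrite eqxx.
Qed.

Lemma avoid_sym x : symmetric (avoid x).
Proof. by move=> a b; rewrite /avoid /= adj_sym [(a != x) && _]andbC. Qed.

(** The nodes whose bags contain [v] are connected without passing through [x], so they lie in one
    branch. *)
Lemma bag_branch x y v z t : v \notin bag x -> z \in branch x y -> v \in bag z ->
  v \in bag t -> t \in branch x y.
Proof.
move=> vx; rewrite !inE => cz vz vt; apply: connect_trans cz _.
apply: connect_sub (coh vz vt) => a b /and3P[ab va vb]; apply: connect1.
by apply/and3P; split; rewrite // ?(contraNneq _ vx) // => <-.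
Qed.

(** The vertices that occur only on the side of [y] of the tree edge from [x] to [y]; the carving is
    assembled from these sets. *)
Definition below x y : {set vertex G} :=
  [set v | (v \notin bag x) && [exists z, (z \in branch x y) && (v \in bag z)]].

Lemma belowP x y v :
  reflect (v \notin bag x /\ exists2 z, z \in branch x y & v \in bag z) (v \in below x y).
Proof.
rewrite inE; apply: (iffP andP) => -[h]; first by move=> /existsP[z /andP[a b]]; split; last exists z.
by move=> [z a b]; split=> //; apply/existsP; exists z; rewrite a.
Qed.

(** Some bag contains both ends of the edge. If [bag x] contains neither, that bag lies in the
    branch of the first end, which puts the second end below as well. *)
Lemma below_covers x y : covers (bag x) (below x y).
Proof.
move=> u v uv /belowP[ux [z zb uz]] vn; rewrite (negbTE ux) /=.
have [t /andP[ut vt]] := covE uv; apply: contraNT vn => vx.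
apply/belowP; split=> //; exists t => //; exact: bag_branch ux zb uz ut.
Qed.

Lemma below_disj y z z' : adj y z -> adj y z' -> z != z' ->
  [disjoint below y z & below y z'].
Proof.
move=> yz yz' zz'; rewrite -setI_eq0; apply/eqP/setP => v; rewrite in_setI in_set0.
apply/negP => /andP[/belowP[vy [t tb vt]] /belowP[_ [t' tb' vt']]].
have := bag_branch vy tb vt vt'; have := branch_sep yz yz' zz'.
rewrite inE => /negP nc ht; apply: nc; rewrite inE in tb'; rewrite inE in ht.
apply: connect_trans ht _; rewrite (sym_connect_sym (@avoid_sym y)) //.
Qed.

Notation c0 A := (A = set0 \/ carvable (@cutd G) (singletons G) w A).

Lemma covers0 b : covers b (set0 : {set vertex G}).
Proof. by move=> u v _; rewrite inE. Qed.

Lemma coversU b (A B : {set vertex G}) : covers b A -> covers b B -> covers b (A :|: B).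
Proof.
move=> cA cB u v uv; rewrite !inE negb_or => /orP[] uA /andP[vA vB].
  exact: cA uv uA vA.
exact: cB uv uA vB.
Qed.

(** All sets combined at the tree node [y] are covered by the same bag, so any union of them
    respects the width. *)
Lemma c0U y (A B : {set vertex G}) : c0 A -> c0 B -> [disjoint A & B] ->
  covers (bag y) A -> covers (bag y) B -> c0 (A :|: B).
Proof.
move=> [->|cA] [->|cB] dAB vA vB; rewrite ?set0U ?setU0; try by [left | right].
right; apply: carvable_union => //; apply: cutd_covered (width y) _; exact: coversU.
Qed.

Lemma c0_bigU y (I : finType) (F : I -> {set vertex G}) (r : seq I) :
  uniq r -> {in r, forall i, c0 (F i) /\ covers (bag y) (F i)} ->
  {in r &, forall i j, i != j -> [disjoint F i & F j]} ->
  c0 (\bigcup_(i <- r) F i) /\ covers (bag y) (\bigcup_(i <- r) F i).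
Proof.
elim: r => [|i r IH] /=; first by rewrite big_nil => _ _ _; split; [left | apply: covers0].
move=> /andP[ir ur] H D; rewrite big_cons.
have [ci vi] := H i (mem_head _ _).
have [||cr vr] := IH ur; first by move=> j jr; apply: H; rewrite inE jr orbT.
  by move=> j l jr lr; apply: D; rewrite inE ?jr ?lr orbT.
split; last exact: coversU.
apply: (c0U (y := y)) => //; rewrite -setI_eq0 big_distrr /=; apply/eqP.
apply: big1_seq => j /andP[_ jr]; apply/eqP; rewrite setI_eq0; apply: D.
- exact: mem_head.
- by rewrite inE jr orbT.
- by apply: contraNneq ir => ->.
Qed.

Lemma c0_set1 v : c0 [set v].
Proof.
right; apply: carvable_block; first exact: imset_f.
have [x vx] := cov v; apply: cutd_covered (width x) _ => a b _.
by rewrite inE => /eqP-> _; rewrite vx.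
Qed.

Lemma c0_node y (B : {set vertex G}) (N : {set vertex T}) : B \subset bag y ->
  {in N, forall z, adj y z /\ c0 (below y z)} ->
  c0 (B :|: \bigcup_(z in N) below y z).
Proof.
move=> By HN; rewrite -big_enum.
have [||cN vN] := @c0_bigU y _ (below y) (enum N) (enum_uniq _).
- by move=> z; rewrite mem_enum => /HN[_ c]; split=> //; apply: below_covers.
- move=> z z'; rewrite !mem_enum => /HN[yz _] /HN[yz' _]; exact: below_disj.
have [||cB vB] := @c0_bigU y _ (fun v => [set v]) (enum B) (enum_uniq _).
- move=> v; rewrite mem_enum => vB; split; first exact: c0_set1.
  by move=> a b _; rewrite inE => /eqP-> _; rewrite (subsetP By _ vB).
- by move=> a b _ _ ab; rewrite disjoints1 inE.
have eB : \bigcup_(v <- enum B) [set v] = B.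
  rewrite big_enum; apply/setP => v; apply/bigcupP/idP => [[u uB]|vin].
    by rewrite inE => /eqP->.
  by exists v; rewrite ?inE.
rewrite eB in cB vB; apply: (c0U (y := y)) => //.
rewrite -setI_eq0; apply/eqP/setP => v; rewrite !inE; apply/negP => /andP[vb].
rewrite big_enum => /bigcupP[z _ /belowP[vy _]].
by rewrite (subsetP By _ vb) in vy.
Qed.

(** A duplicate-free path from [y] never returns to [y], so the rest of it after the first step lies
    in a branch of [y]. *)
Lemma branch_step x y t : y != x -> t \in branch x y -> t != y ->
  exists2 z, adj y z && (z != x) & t \in branch y z.
Proof.
move=> yx; rewrite inE => /connectP[p0 pp0 e0]; move: e0.
case/shortenP: pp0 => -[|z p] pp up _ -> //=; first by rewrite eqxx.
move=> _; have [ap hp] := avoid_path pp; move: ap => /= /andP[yz ap].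
exists z; first by rewrite yz hp // mem_head.
rewrite inE; apply/connectP; exists p => //; move: up => /= /andP[yn _].
apply: path_avoid => //; first by apply: contraNneq yn => ->; apply: mem_head.
by move=> u upp; apply: contraNneq yn => <-; rewrite inE upp orbT.
Qed.

(** The measure for [c0_below]: the branches behind [y] avoid [x] by [branch_sep] and lack [y]
    itself. *)
Lemma branch_sub x y z : adj x y -> adj y z -> z != x ->
  branch y z \subset branch x y :\ y.
Proof.
move=> xy yz zx.
have yx : y != x by apply: contraTneq xy => ->; rewrite adj_irr.
have zy : z != y by apply: contraTneq yz => ->; rewrite adj_irr.
have xb : x \notin branch y z by apply: branch_sep; rewrite // adj_sym.
apply/subsetP => t tb; rewrite !inE (branch_neq zy tb) /=.
apply: (connect_trans (y := z)); first by apply: connect1; apply/and3P.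
move: tb; rewrite inE => /connectP[p0 pp0 e0]; move: e0.
case/shortenP: pp0 => p pp up _ ->; apply/connectP; exists p => //.
have [ap hp] := avoid_path pp; apply: path_avoid => // u uin.
apply: contraNneq xb => <-; rewrite inE; case/splitPl: (mem_behead (s := z :: p) uin) pp => p1 p2 <-.
by rewrite cat_path => /andP[pp1 _]; apply/connectP; exists p1.
Qed.

(** The set splits into the single vertices of [bag y] outside [bag x] and the sets below the other
    neighbours of [y]; all of these are covered by [bag y], and induction applies to the latter. *)
Lemma c0_below x y : adj x y -> c0 (below x y).
Proof.
have [n] := ubnP #|branch x y|; elim: n x y => // n IH x y sz xy.
have yx : y != x by apply: contraTneq xy => ->; rewrite adj_irr.
have -> : below x y = (bag y :\: bag x) :|:
    \bigcup_(z in [set z | adj y z && (z != x)]) below y z.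
  apply/setP => v; apply/belowP/setUP => [[vx [t tb vt]]|].
    case: (boolP (v \in bag y)) => vy; first by left; rewrite inE vx.
    have ty : t != y by apply: contraNneq vy => <-.
    have [z zz tz] := branch_step yx tb ty.
    right; apply/bigcupP; exists z; first by rewrite inE.
    by apply/belowP; split=> //; exists t.
  case=> [|/bigcupP[z zN /belowP[vy [t tb vt]]]].
    by rewrite inE => /andP[vx vy]; split=> //; exists y; rewrite ?branch_self.
  move: zN; rewrite inE => /andP[yz zx].
  have := subsetP (branch_sub xy yz zx) t tb; rewrite in_setD1 => /andP[_ tb']; split; last by exists t.
  have xb : x \notin branch y z by apply: branch_sep; rewrite // adj_sym.
  by apply: contra xb => vx; apply: bag_branch vy tb vt vx.
apply: c0_node; first exact: subsetDl.
move=> z; rewrite inE => /andP[yz zx]; split=> //; apply: IH => //.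
apply: leq_ltn_trans (subset_leq_card (branch_sub xy yz zx)) _.
by move: sz; rewrite (cardsD1 y) branch_self add1n.
Qed.

Lemma carvable_tree_decomp : 0 < sg_order G -> carvable (@cutd G) (singletons G) w setT.
Proof.
move=> n0; have [T0 conn _] := treeT; pose y : vertex T := Ordinal T0.
suff [e|//] : c0 (setT : {set vertex G}).
  by have := in_setT (Ordinal n0); rewrite e inE.
have -> : setT = bag y :|: \bigcup_(z in [set z | adj y z]) below y z.
  apply/esym/setP => v; rewrite in_setT; apply/setUP.
  case: (boolP (v \in bag y)) => vy; [by left | right].
  have [t vt] := cov v; have ty : t != y by apply: contraNneq vy => <-.
  have /connectP[p0 pp0 e0] := conn y t; move: e0.
  case/shortenP: pp0 => -[|z p] pp up _ et; first by rewrite et eqxx in ty.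
  move: pp up => /= /andP[yz pp] /andP[yn _].
  apply/bigcupP; exists z; first by rewrite inE.
  apply/belowP; split=> //; exists t => //; rewrite inE et; apply/connectP; exists p => //.
  apply: path_avoid => //; first by apply: contraNneq yn => ->; apply: mem_head.
  by move=> u upp; apply: contraNneq yn => <-; rewrite inE upp orbT.
apply: c0_node => // z; rewrite inE => yz; split=> //; exact: c0_below.
Qed.
End TreeDecomposition.

Lemma carvable_treewidth (G : sgraph) : 0 < sg_order G ->
  carvable (@cutd G) (singletons G) ((treewidth G).+1 * max_degree G) setT.
Proof.
move=> n0; rewrite /treewidth; case: ex_minnP => k /boolp.asboolP[T [bag [td wd]]] _.
exact: carvable_tree_decomp td wd n0.
Qed.

(** * Size bounds *)

Lemma esize_lt_seq (s : seq nat) k m : size s <= k -> all (fun x => x < m) s ->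
  esize s <= (k * m.*2.+2).+1.
Proof.
move=> sk sm; apply: leq_trans (esize_le sk (n := m.*2.+1) _) _ => //.
by apply: sub_all sm => x xm; rewrite esize_nat; lia.
Qed.

Definition free_arr (l : seq nat) : seq (seq nat) := foldl (fun acc x => add_letter x acc) [:: [::]] l.

Lemma free_arr_rcons l x : free_arr (rcons l x) = add_letter x (free_arr l).
Proof. by rewrite /free_arr foldl_rcons. Qed.

Lemma free_arr_mem m l s : all (fun x => x < m) l -> s \in free_arr l ->
  size s <= size l /\ all (fun x => x < m) s.
Proof.
elim/last_ind: l s => [|l x IH] s; first by rewrite inE => _ /eqP->.
rewrite all_rcons => /andP[xm lm]; rewrite free_arr_rcons size_rcons.
move/mem_add_letter => [/(IH _ lm)[h1 h2]|[t1 [t2 [/(IH _ lm)[h1 h2] ->]]]].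
  by split=> //; apply: leqW.
move: h1 h2; rewrite !size_cat /= !all_cat /= xm => h1 h2; split=> //; lia.
Qed.

(** A new letter is omitted or inserted in at most D + 1 places, so it multiplies the number of
    sequences by at most D + 2. *)
Lemma size_free_arr D l : size l <= D -> size (free_arr l) <= (D + 2) ^ size l.
Proof.
elim/last_ind: l => [|l x IH] //; rewrite size_rcons => lD.
have {IH} IH := IH (ltnW lD).
have H s : s \in free_arr l -> size s <= size l.
  move=> sl; apply: (proj1 (@free_arr_mem (\sum_(x <- l) x).+1 l s _ sl)).
  by apply/allP => y yl; rewrite ltnS (big_rem y) //= leq_addr.
rewrite free_arr_rcons /add_letter size_cat size_flatten /shape -map_comp.
have -> : sumn (map (size \o insertions x) (free_arr l)) = \sum_(s <- free_arr l) (size s).+1.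
  rewrite sumnE big_map; apply: eq_bigr => s _; by rewrite /= size_map size_iota.
apply: (@leq_trans (size (free_arr l) + size (free_arr l) * (D + 1))).
  rewrite leq_add2l -sum1_size big_distrl /= big_seq [leqRHS]big_seq.
  apply: leq_sum => s /H h; rewrite mul1n addn1 ltnS; exact: leq_trans h (ltnW lD).
by rewrite expnS; nia.
Qed.

(** For sequences of at most D edge numbers below m, the number of edges; the factor linear in m is
    the size of a unary edge number. *)
Definition rel_bound (D m : nat) : nat := ((D + 2) ^ D * ((D * m.*2.+2).+1).+1).+1.

Lemma esize_free_arr D m l : size l <= D -> all (fun x => x < m) l ->
  esize (free_arr l) <= rel_bound D m.
Proof.
move=> lD lm; apply: esize_le.
  by apply: leq_trans (size_free_arr lD) _; rewrite leq_pexp2l // addn2.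
apply/allP => s /(free_arr_mem lm)[h1 h2]; apply: esize_lt_seq h2.
exact: leq_trans lD.
Qed.

Lemma arrangements_free D m N l : rel_bound D m <= N -> size l <= D ->
  all (fun x => x < m) l -> arrangements N l = free_arr l.
Proof.
move=> rN; elim/last_ind: l => [|l x IH] // lD; rewrite all_rcons => /andP[xm lm].
have lxm : all (fun x => x < m) (rcons l x) by rewrite all_rcons xm.
rewrite arrangements_rcons IH //; last by move: lD; rewrite size_rcons; apply: ltnW.
rewrite -free_arr_rcons /clip fitsE.
by rewrite (leq_trans (esize_free_arr lD lxm)).
Qed.

Lemma free_arr_nil l : ~~ nilp (free_arr l).
Proof.
suff : [::] \in free_arr l by case: free_arr.
elim/last_ind: l => [|l x IH] //; rewrite free_arr_rcons.
by apply/mem_add_letter; left.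
Qed.

Lemma esize_map_shrink (f : seq nat -> seq nat) (l : seq (seq nat)) :
  (forall s, esize (f s) <= esize s) -> esize (map f l) <= esize l.
Proof.
move=> H; elim: l => //= s l IH; rewrite !esize_cons; have := H s; lia.
Qed.

Lemma esize_joined es ps c sq : esize (joined es ps c sq) <= esize sq.
Proof.
apply: leq_trans (esize_filter _ sq); apply: esize_map_shrink => s.
exact: esize_filter.
Qed.

Lemma size_letters es c : size (letters es c) <= \sum_(b <- c) size (cross es b).
Proof.
rewrite size_map size_filter; elim: c => [|b c IH].
  by rewrite big_nil leqn0 -leqn0 leqNgt -has_count; apply/hasPn.
rewrite big_cons size_map size_filter; apply: leq_trans _ (leq_add (leqnn _) IH).
rewrite -count_predUI; apply: leq_trans _ (leq_addr _ _).
by apply: sub_count => e /=.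
Qed.

Section StateSize.
Variables (n : nat).

Definition block_bound : nat := (n * n.*2.+2).+1.
Definition state_bound (R : nat) : nat := (n * (block_bound + R).+2).+1.

Lemma flatten_mem_sub (bs : seq (seq nat)) b : b \in bs -> {subset b <= flatten bs}.
Proof. by move=> bb x xb; apply/flattenP; exists b. Qed.

Lemma size_flatten_ge (bs : seq (seq nat)) : [::] \notin bs -> size bs <= size (flatten bs).
Proof.
elim: bs => //= b bs IH; rewrite inE negb_or size_cat => /andP[b0 /IH h].
by case: b b0 => //= x b _; lia.
Qed.

Lemma block_size (bs : seq (seq nat)) b : perm_eq (flatten bs) (iota 0 n) -> b \in bs ->
  size b <= n /\ all (fun x => x < n) b.
Proof.
move=> pe bb; split.
  have := perm_size pe; rewrite size_iota => <-.
  rewrite size_flatten sumnE /shape big_map (big_rem b) //= leq_addr //.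
apply/allP => x /(flatten_mem_sub bb); rewrite (perm_mem pe) mem_iota; lia.
Qed.

Lemma esize_block (bs : seq (seq nat)) b : perm_eq (flatten bs) (iota 0 n) -> b \in bs ->
  esize b <= block_bound.
Proof. by move=> pe /(block_size pe)[h1 h2]; apply: esize_lt_seq. Qed.

Lemma esize_state R (ps : seq part) :
  perm_eq (flatten (map fst ps)) (iota 0 n) -> [::] \notin map fst ps ->
  all (fun p : part => esize p.2 <= R) ps -> esize ps <= state_bound R.
Proof.
move=> pe ne /allP aR; apply: esize_le.
  rewrite -(size_map fst); apply: leq_trans (size_flatten_ge ne) _.
  by rewrite (perm_size pe) size_iota.
apply/allP => p pp; rewrite esize_pair.
have /= h1 := aR p pp; have h2 := esize_block pe (mem_block pp).
by rewrite ltnS leq_add.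
Qed.
End StateSize.

(** * Progress *)

Lemma uniq_flatten_disj (bs : seq (seq nat)) : uniq (flatten bs) -> disjoint_blocks bs.
Proof.
elim: bs => [|b bs IH] //=; rewrite cat_uniq => /and3P[_ /hasPn h /IH dj].
have out b' v : b' \in bs -> v \in b' -> v \notin b.
  by move=> bb vb; apply: h; apply/flattenP; exists b'.
move=> b1 b2 v; rewrite !inE => /orP[/eqP->|m1] /orP[/eqP->|m2] // v1 v2.
- by have := out _ _ m2 v2; rewrite v1.
- by have := out _ _ m1 v1; rewrite v2.
- exact: dj m1 m2 v1 v2.
Qed.

Lemma uniq_flatten_uniq (bs : seq (seq nat)) :
  uniq (flatten bs) -> [::] \notin bs -> uniq bs.
Proof.
elim: bs => [|b bs IH] //=; rewrite cat_uniq inE negb_or => /and3P[_ /hasPn h /IH u].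
move=> /andP[b0 /u ->]; rewrite andbT; apply/negP => bb.
case: b b0 bb h => // x b _ bb h.
have /h : x \in flatten bs by apply/flattenP; exists (x :: b); rewrite ?mem_head.
by rewrite /= mem_head.
Qed.

Lemma carvable_mono (T : finType) (d : {set T} -> nat) (P : {set {set T}}) w w' A :
  w <= w' -> carvable d P w A -> carvable d P w' A.
Proof.
move=> ww; elim=> [B BP dB|{}A B _ cA _ cB dAB dU].
  by apply: carvable_block => //; apply: leq_trans ww.
by apply: carvable_union => //; apply: leq_trans ww.
Qed.

Lemma carvable_block_le (T : finType) (d : {set T} -> nat) (P : {set {set T}}) w A B :
  partition P setT -> carvable d P w A -> B \in P -> B \subset A -> d B <= w.
Proof.
move=> pP cA BP; elim: cA => [C CP dC BC|{}A C cA IA cC IC _ _ BU].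
  have /set0Pn[x xB] := block_neq0 pP BP.
  by rewrite (block_disj pP BP CP xB (subsetP BC x xB)).
case/orP: (carvable_sat pP cA BP) => [|dBA]; first exact: IA.
apply: IC; apply/subsetP => x xB; have := subsetP BU x xB; rewrite inE => /orP[xA|//].
by rewrite (disjointFr dBA xB) in xA.
Qed.

Section Progress.
Variables (G : cgraph) (C1 : config G) (may must : edge G -> bool).
Let es := items C1 may must.
Let n := sg_order G.
Implicit Types (b : seq nat) (c bs : seq (seq nat)).
Notation d := (@cutd G).

Definition bset b : {set vertex G} := [set v | val v \in b].
Definition blk bs : {set {set vertex G}} := [set:: map bset bs].

Lemma cross_item_cut b e : crossb (item C1 may must e) b = (e \in cut (bset b)).
Proof. by rewrite !inE. Qed.

Lemma size_cross b : size (cross es b) = d (bset b).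
Proof.
rewrite size_map size_filter count_map /cutd cardE size_filter -enumT.
by apply: eq_count => e /=; rewrite cross_item_cut.
Qed.

Lemma bset_cons b c : bset (flatten (b :: c)) = bset b :|: bset (flatten c).
Proof. by apply/setP => v; rewrite !inE mem_cat. Qed.

Section Blocks.
Variable bs : seq (seq nat).
Hypothesis perm_bs : perm_eq (flatten bs) (iota 0 n).
Hypothesis nil_bs : [::] \notin bs.

Lemma flat_uniq : uniq (flatten bs).
Proof. by rewrite (perm_uniq perm_bs) iota_uniq. Qed.

Lemma bs_uniq : uniq bs.
Proof. exact: uniq_flatten_uniq flat_uniq nil_bs. Qed.

Lemma bs_disj : disjoint_blocks bs.
Proof. exact: uniq_flatten_disj flat_uniq. Qed.

Lemma bs_lt b x : b \in bs -> x \in b -> x < n.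
Proof. by move=> bb xb; have [_ /allP h] := block_size perm_bs bb; apply: h. Qed.

Lemma bset_neq0 b : b \in bs -> exists v, v \in bset b.
Proof.
case: b => [|x b] bb; first by case/negP: nil_bs.
by exists (Ordinal (bs_lt bb (mem_head x b))); rewrite inE /= mem_head.
Qed.

Lemma bset_inj : {in bs &, injective bset}.
Proof.
move=> b1 b2 m1 m2 e; have [v v1] := bset_neq0 m1.
have v2 : v \in bset b2 by rewrite -e.
by rewrite !inE in v1 v2; apply: bs_disj m1 m2 v1 v2.
Qed.

Lemma blk_part : partition (blk bs) setT.
Proof.
apply/and3P; split.
- apply/eqP/setP => v; rewrite inE; apply/bigcupP.
  have : val v \in flatten bs by rewrite (perm_mem perm_bs) mem_iota /= ltn_ord.
  by case/flattenP => b bb vb; exists (bset b); rewrite inE // map_f.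
- apply/trivIsetP => B1 B2; rewrite !inE => /mapP[b1 m1 ->] /mapP[b2 m2 ->] ne.
  rewrite -setI_eq0; apply/eqP/setP => v; rewrite !inE; apply: contraNF ne => /andP[v1 v2].
  by rewrite (bs_disj m1 m2 v1 v2).
- rewrite inE; apply/mapP => -[b /bset_neq0[v vb] e].
  by rewrite -e inE in vb.
Qed.

Lemma sat_sub c : {subset c <= bs} -> sat (blk bs) (bset (flatten c)).
Proof.
move=> cs B; rewrite inE => /mapP[b bb ->]; case: (boolP (b \in c)) => bc.
  by apply/orP; left; apply/subsetP => v; rewrite !inE => vb; apply/flattenP; exists b.
apply/orP; right; rewrite -setI_eq0; apply/eqP/setP => v; rewrite !inE.
apply: contraNF bc => /andP[vb /flattenP[b' bc' vb']].
by rewrite (bs_disj bb (cs _ bc') vb vb').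
Qed.

Lemma sub_blk c b : {subset c <= bs} -> b \in bs ->
  (bset b \subset bset (flatten c)) = (b \in c).
Proof.
move=> cs bb; apply/idP/idP => [h|bc]; last first.
  by apply/subsetP => v; rewrite !inE => vb; apply/flattenP; exists b.
have [v vb] := bset_neq0 bb; have := subsetP h v vb; rewrite !inE in vb *.
by case/flattenP => b' bc vb'; rewrite (bs_disj bb (cs _ bc) vb vb').
Qed.

Lemma nb_sub c : uniq c -> {subset c <= bs} -> nb (blk bs) (bset (flatten c)) = size c.
Proof.
move=> uc cs; rewrite /nb -(size_map bset c).
have uc' : uniq (map bset c).
  by rewrite map_inj_in_uniq // => b1 b2 /cs m1 /cs m2; apply: bset_inj.
rewrite -(card_uniqP uc'); apply: eq_card => B; rewrite !inE.
apply/andP/mapP => [[/mapP[b bb ->]]|[b bc ->]].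
  by rewrite sub_blk // => bc; exists b.
by rewrite sub_blk ?cs // map_f // cs.
Qed.

Lemma nbT : nb (blk bs) setT = size bs.
Proof.
rewrite -(nb_sub bs_uniq) //; congr (nb _ _); apply/esym/setP => v; rewrite !inE.
by rewrite (perm_mem perm_bs) mem_iota /= ltn_ord.
Qed.

Definition inside (X : {set vertex G}) : seq (seq nat) := filter (fun b => bset b \subset X) bs.

Lemma inside_set X : sat (blk bs) X -> bset (flatten (inside X)) = X.
Proof.
move=> sX; apply/setP => v; rewrite inE; apply/flattenP/idP => [[b]|vX].
  by rewrite mem_filter => /andP[/subsetP bX _] vb; apply: bX; rewrite inE.
have : val v \in flatten bs by rewrite (perm_mem perm_bs) mem_iota /= ltn_ord.
case/flattenP => b bb vb; exists b => //; rewrite mem_filter bb andbT.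
have /sX/orP[//|/disjointFr h] : bset b \in blk bs by rewrite inE map_f.
by have := h v; rewrite inE vb vX => /(_ isT).
Qed.

Lemma goodE c : uniq c -> 0 < size c -> {subset c <= bs} ->
  good es c = (3 ^ d (bset (flatten c)) < nb (blk bs) (bset (flatten c))).
Proof.
move=> uc c0 cs; rewrite /good size_cross pow3E // nb_sub //.
by rewrite gtn_min ltnn orbF.
Qed.

Variable w : nat.
Hypothesis carvable_bs : carvable d (blk bs) w setT.
Let M := 2 * 3 ^ w.
Let D := M * w.

Lemma block_d b : b \in bs -> d (bset b) <= w.
Proof.
move=> bb; apply: carvable_block_le blk_part carvable_bs _ _; first by rewrite inE map_f.
exact: subsetT.
Qed.

Lemma cutd_flatten c : {subset c <= bs} -> d (bset (flatten c)) <= size c * w.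
Proof.
elim: c => [|b c IH] cs.
  by rewrite (_ : bset _ = set0) ?cutd_0 //; apply/setP => v; rewrite !inE.
rewrite bset_cons /= mulSn.
have h1 := block_d (cs b (mem_head _ _)).
have h2 := IH (fun x xc => cs x (mem_behead (s := b :: c) xc)).
have := cutd_sub (bset b) (bset (flatten c)); lia.
Qed.

Lemma joins_cut e b c : b \in bs -> b \notin c -> {subset c <= bs} ->
  joins (item C1 may must e) b c -> e \in cut (bset (flatten c)).
Proof.
move=> bb bc cs; rewrite /joins /esrc /edst /= !inE.
have out x : x \in b -> x \in flatten c = false.
  move=> xb; apply/negP => /flattenP[b' bc' xb'].
  by case/negP: bc; rewrite (bs_disj bb (cs _ bc') xb xb').
by case/orP=> /andP[h1 h2]; rewrite (out _ h1) h2.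
Qed.

Lemma joins_inj e b1 b2 c : b1 \in bs -> b2 \in bs -> b1 \notin c -> b2 \notin c ->
  {subset c <= bs} -> joins (item C1 may must e) b1 c -> joins (item C1 may must e) b2 c ->
  b1 = b2.
Proof.
move=> bb1 bb2 n1 n2 cs.
have out b x : b \in bs -> b \notin c -> x \in b -> x \in flatten c = false.
  move=> bb bc xb; apply/negP => /flattenP[b' bc' xb'].
  by case/negP: bc; rewrite (bs_disj bb (cs _ bc') xb xb').
rewrite /joins; case/orP=> /andP[h1 h2]; case/orP=> /andP[h3 h4].
- exact: bs_disj bb1 bb2 h1 h3.
- by rewrite (out _ _ bb2 n2 h3) in h2.
- by rewrite (out _ _ bb2 n2 h3) in h2.
- exact: bs_disj bb1 bb2 h1 h3.
Qed.

Definition neighbours c : seq (seq nat) :=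
  filter (fun b => (b \notin c) && has (fun e => joins e b c) es) bs.

(** Double counting: each neighbour is joined to [c] by an edge leaving [c], and by [joins_inj] such
    an edge determines the neighbour. *)
Lemma size_neighbours c : {subset c <= bs} -> size (neighbours c) <= d (bset (flatten c)).
Proof.
move=> cs; rewrite -sum1_size.
pose J b e := joins (item C1 may must e) b c.
apply: (@leq_trans (\sum_(b <- neighbours c) \sum_(e : edge G) J b e)).
  rewrite big_seq [leqRHS]big_seq; apply: leq_sum => b.
  rewrite mem_filter => /andP[/andP[_ /hasP[x /mapP[e _ ->] je]] _].
  by rewrite (bigD1 e) //= /J je.
rewrite exchange_big /= /cutd -sum1_card [leqRHS]big_mkcond /=; apply: leq_sum => e _.
have nU : uniq (neighbours c) by rewrite filter_uniq // bs_uniq.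
case: (boolP (has (J^~ e) (neighbours c))) => [/hasP[b bN je]|/hasPn h]; last first.
  by rewrite big1_seq // => b /andP[_ /h]; case: (J b e).
have nP b' : b' \in neighbours c -> b' \in bs /\ b' \notin c.
  by rewrite mem_filter => /andP[/andP[-> _] ->].
have [bb bc] := nP b bN.
rewrite (joins_cut bb bc cs je) (big_rem b) //= big1_seq ?addn0 ?leq_b1 // => b' /andP[_].
rewrite mem_rem_uniq // inE => /andP[ne /nP[bb' bc']].
case je': (J b' e) => //; case/eqP: ne.
exact: joins_inj bb' bb bc' bc cs je' je.
Qed.

Variable N : nat.
(** Growing starts from at most n * n pairs. A candidate of at most M blocks has at most D = M * w
    boundary edges, hence at most D neighbours, so a round multiplies the number by at most D +
    1. *)
Definition cand_bound : nat := (n * n * (D + 1) ^ M * ((M * (block_bound n).+1).+1).+1).+1.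
Hypothesis N_cand : cand_bound <= N.

Let acc i := iter i (growstep N es bs) (pairs bs).

Lemma growE a : grow es bs a = flatten (map (fun c => map (fun b => b :: c) (neighbours c)) a).
Proof. by []. Qed.

Lemma acc_cand i c : c \in acc i ->
  [/\ uniq c, {subset c <= bs}, 1 < size c & size c <= i.+2].
Proof.
elim: i c => [|i IH] c.
  case/flattenP => l /mapP[b1 b1s ->] /mapP[b2]; rewrite mem_filter => /andP[ne b2s] ->.
  by split=> // [|b]; rewrite /= !inE ?[b1 == _]eq_sym ?ne // => /orP[]/eqP->.
rewrite /acc iterS {1}/growstep -/(acc i); case: ifP => _; last first.
  by case/IH => ? ? ? h; split=> //; apply: leqW.
rewrite mem_cat => /orP[/IH[? ? ? h]|]; first by split=> //; apply: leqW.
rewrite growE => /flattenP[l /mapP[c' /IH[u cs s1 s2] ->] /mapP[b]].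
rewrite mem_filter => /andP[/andP[bc _] bb] ->; split=> //=.
- by rewrite bc.
- by move=> x; rewrite inE => /orP[/eqP->//|/cs].
- exact: ltnW.
Qed.

Lemma size_pairs : size (pairs bs) <= n * n.
Proof.
have sb : size bs <= n.
  by apply: leq_trans (size_flatten_ge nil_bs) _; rewrite (perm_size perm_bs) size_iota.
rewrite /pairs size_flatten /shape -map_comp sumnE big_map.
apply: leq_trans (leq_mul sb sb); rewrite -sum1_size big_distrl /=.
apply: leq_sum => b _; rewrite mul1n /= size_map size_filter sum1_size; exact: count_size.
Qed.

Lemma size_grow i : i.+2 <= M -> size (grow es bs (acc i)) <= size (acc i) * D.
Proof.
move=> iM; rewrite growE size_flatten /shape -map_comp sumnE big_map -sum1_size big_distrl /=.
rewrite big_seq [leqRHS]big_seq; apply: leq_sum => c /acc_cand[_ cs _ sc].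
rewrite size_map mul1n; apply: leq_trans (size_neighbours cs) _.
apply: leq_trans (cutd_flatten cs) _; rewrite leq_mul2r; apply/orP; right.
exact: leq_trans iM.
Qed.

Lemma acc_grow i : i.+3 <= M -> size (acc i) <= n * n * (D + 1) ^ i ->
  size (acc i ++ grow es bs (acc i)) <= n * n * (D + 1) ^ i.+1 /\
  fits N (acc i ++ grow es bs (acc i)).
Proof.
move=> iM si; have sg := size_grow (ltnW iM).
have h : size (acc i ++ grow es bs (acc i)) <= n * n * (D + 1) ^ i.+1.
  by rewrite size_cat expnS; nia.
split=> //; rewrite fitsE; apply: leq_trans N_cand; apply: esize_le.
  by apply: leq_trans h _; rewrite leq_mul2l leq_pexp2l ?orbT // ?addn1 // ltnW // ltnW.
apply/allP => c; rewrite mem_cat => hc.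
have [cs sc] : {subset c <= bs} /\ size c <= M.
  case/orP: hc => [/acc_cand[_ cs _ sc]|].
    by split=> //; apply: leq_trans sc _; apply: ltnW.
  rewrite growE => /flattenP[l /mapP[c' /acc_cand[u cs s1 s2] ->] /mapP[b]].
  rewrite mem_filter => /andP[/andP[bc _] bb] ->; split=> /=.
    by move=> x; rewrite inE => /orP[/eqP->//|/cs].
  exact: leq_trans iM.
apply: leq_trans (esize_le sc (n := block_bound n) _) _ => //.
by apply/allP => b /cs bb; apply: esize_block perm_bs bb.
Qed.

Lemma size_acc i : i.+2 <= M -> size (acc i) <= n * n * (D + 1) ^ i.
Proof.
elim: i => [|i IH] iM; first by rewrite expn0 muln1; apply: size_pairs.
have [h1 h2] := acc_grow iM (IH (ltnW iM)).
by rewrite /acc iterS {1}/growstep -/(acc i) h2.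
Qed.

Lemma accS i : i.+3 <= M -> acc i.+1 = acc i ++ grow es bs (acc i).
Proof.
move=> iM; have [_ h2] := acc_grow iM (size_acc (ltnW iM)).
by rewrite /acc iterS {1}/growstep -/(acc i) h2.
Qed.

(** New candidates are appended at the end, so a first good candidate found in an early round
    remains the first. *)
Lemma acc_prefix i j : i <= j -> exists r, acc j = acc i ++ r.
Proof.
move=> /subnK<-; elim: (j - i) => [|k [r IH]]; first by exists [::]; rewrite cats0.
rewrite addSn /acc iterS {1}/growstep -/(acc (k + i)); case: ifP => _.
  by rewrite IH -catA; eexists.
by exists r.
Qed.

(** Without edges between [Y] and [Z], their cuts are disjoint and contained in the cut of [X]. *)
Lemma split_cut (X Y Z : {set vertex G}) : X = Y :|: Z -> [disjoint Y & Z] ->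
  (forall e : edge G, ~~ [|| ((sval e).1 \in Y) && ((sval e).2 \in Z)
                           | ((sval e).2 \in Y) && ((sval e).1 \in Z)]) ->
  d Y + d Z <= d X.
Proof.
move=> -> dis H; rewrite /cutd -cardsUI (_ : _ :&: _ = set0) ?cards0 ?addn0.
  apply/subset_leq_card/subsetP => e; rewrite !inE; have := H e.
  have := disjointFr dis (x := (sval e).1); have := disjointFr dis (x := (sval e).2).
  by case: (_ \in Y) (_ \in Y) (_ \in Z) (_ \in Z) => [] [] [] [] // a b; move: a b => /= a b;
    rewrite ?a ?b //.
apply/setP => e; rewrite !inE; have := H e.
have := disjointFr dis (x := (sval e).1); have := disjointFr dis (x := (sval e).2).
case: (_ \in Y) (_ \in Y) (_ \in Z) (_ \in Z) => [] [] [] [] //= a b; by rewrite ?a ?b //.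
Qed.
Notation P := (blk bs).

(** This fails when an exponent is 0, which is why isolated blocks need separate care in [reach]. *)
Lemma leq_pow3D (a b : nat) : 0 < a -> 0 < b -> 3 ^ a + 3 ^ b <= 3 ^ (a + b).
Proof.
move=> a0 b0; rewrite expnD.
have h x : 0 < x -> 3 <= 3 ^ x by case: x => // x _; rewrite expnS leq_pmulr // expn_gt0.
by have := h a a0; have := h b b0; nia.
Qed.

Section Reach.
Variable X : {set vertex G}.
Hypothesis sX : sat P X.
Hypothesis gX : good_set d P X.
Hypothesis minX : forall Y, sat P Y -> good_set d P Y -> nb P X <= nb P Y.
Hypothesis leX : nb P X <= M.
Let B := inside X.

Let subB : {subset B <= bs}.
Proof. by move=> b; rewrite mem_filter => /andP[]. Qed.

Let uB : uniq B.
Proof. exact: filter_uniq bs_uniq. Qed.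

Let sizeB : size B = nb P X.
Proof. by rewrite -(inside_set sX) nb_sub. Qed.

Let not_good Y : sat P Y -> nb P Y < nb P X -> nb P Y <= 3 ^ d Y.
Proof.
move=> sY lt; rewrite leqNgt; apply/negP => gY.
by have := minX sY gY; rewrite leqNgt lt.
Qed.

Let nbX_gt1 : 1 < nb P X.
Proof. by apply: leq_ltn_trans gX; rewrite expn_gt0. Qed.

(* Starting from a block without crossing edges, if there is one, avoids getting stuck
   at an isolated block. *)
Let start : exists2 b1, b1 \in B &
  forall b, b \in B -> d (bset b) = 0 -> d (bset b1) = 0.
Proof.
case: (boolP (has (fun b => d (bset b) == 0) B)) => [/hasP[b1 b1B /eqP z1]|/hasPn h].
  by exists b1.
move: sizeB nbX_gt1; case E: B => [|b1 r] e s1; first by rewrite -e in s1.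
exists b1; rewrite ?mem_head // => b bB z.
by have := h b; rewrite E bB z eqxx => /(_ isT).
Qed.

(** If growth got stuck inside [X], then [X] would split into two sets that are not good and have no
    edge between them, with too few blocks in total for [X] to be good. Only a part without boundary
    edges escapes this count, and the choice of [b1] excludes it. *)
Lemma reach : exists2 c, c \in acc (nb P X - 2) & bset (flatten c) = X.
Proof.
have [b1 b1B z1] := start.
suff H j : j.+2 <= nb P X ->
    exists c, [/\ c \in acc j, size c = j.+2, {subset c <= B} & b1 \in c].
  have [|c [ca sc cB _]] := H (nb P X - 2); first by lia.
  exists c => //; have [uc _ _ _] := acc_cand ca.
  rewrite -[RHS](inside_set sX) -/B.
  have pe : perm_eq c B.
    apply: uniq_perm => //; apply: (uniq_min_size uc cB _).2; rewrite sizeB sc; lia.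
  by apply/setP => v; rewrite !inE (perm_mem (perm_flatten pe)).
elim: j => [|j IH] js.
  have [b2 b2B ne] : exists2 b2, b2 \in B & b2 != b1.
    apply/hasP; rewrite -[has _ _]negbK -all_predC; apply/negP => /allP h.
    have : size B <= size [:: b1].
      by apply: uniq_leq_size uB _ => b /h /=; rewrite negbK inE.
    by rewrite sizeB /=; lia.
  exists [:: b1; b2]; split=> //; last by rewrite mem_head.
    apply/flattenP; exists (map (fun b => [:: b1; b]) (filter (fun b => b != b1) bs)).
      by apply/mapP; exists b1; rewrite ?subB.
    by apply/mapP; exists b2; rewrite // mem_filter ne subB.
  by move=> b; rewrite !inE => /orP[]/eqP->.
have [c [ca sc cB b1c]] := IH (ltnW js).
have [uc cs _ _] := acc_cand ca.
case: (boolP (has (fun b => b \in neighbours c) B)) => [/hasP[b bB bN]|/hasPn stuck].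
  exists (b :: c); split.
  - rewrite accS; last by apply: leq_trans leX.
    rewrite mem_cat growE; apply/orP; right; apply/flattenP.
    exists (map (fun b => b :: c) (neighbours c)); last exact: map_f.
    by apply/mapP; exists c.
  - by rewrite /= sc.
  - by move=> x; rewrite inE => /orP[/eqP->//|/cB].
  - by rewrite inE b1c orbT.
exfalso; pose R := filter (fun b => b \notin c) B.
pose Y := bset (flatten c); pose Z := bset (flatten R).
have Rs : {subset R <= bs} by move=> b; rewrite mem_filter => /andP[_ /subB].
have uR : uniq R by rewrite filter_uniq.
have sY : sat P Y by apply: sat_sub.
have sZ : sat P Z by apply: sat_sub.
have dis : [disjoint Y & Z].
  rewrite -setI_eq0; apply/eqP/setP => v; rewrite !inE; apply/negP.
  move=> /andP[/flattenP[b bc vb] /flattenP[b' b'R vb']].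
  have := bs_disj (cs b bc) (Rs b' b'R) vb vb' => e; move: b'R.
  by rewrite mem_filter -e bc.
have eX : X = Y :|: Z.
  rewrite -(inside_set sX) -/B; apply/setP => v; rewrite !inE; apply/flattenP/orP.
    move=> [b bB vb]; case: (boolP (b \in c)) => bc; [left | right]; apply/flattenP; exists b => //.
    by rewrite mem_filter bc.
  case=> /flattenP[b bb vb]; exists b => //; first exact: cB.
  by move: bb; rewrite mem_filter => /andP[].
have nbE : nb P X = nb P Y + nb P Z by rewrite eX (nb_disjU blk_part sY dis).
have nY : nb P Y = j.+2 by rewrite nb_sub.
have dle : d Y + d Z <= d X.
  apply: split_cut => // e; apply/negP => h.
  have [b bR jb] : exists2 b, b \in R & joins (item C1 may must e) b c.
    case/orP: h => /andP[]; rewrite !inE => h1 /flattenP[b bR vb]; exists b => //;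
      by rewrite /joins /esrc /edst /= vb h1 ?orbT.
  move: bR; rewrite mem_filter => /andP[bc bB].
  case/negP: (stuck b bB); rewrite mem_filter bc subB // andbT /=.
  by apply/hasP; exists (item C1 may must e); rewrite ?mem_item.
have gY := not_good sY; have gZ := not_good sZ.
have {}gY : nb P Y <= 3 ^ d Y by apply: gY; lia.
have {}gZ : nb P Z <= 3 ^ d Z by apply: gZ; lia.
(* [Y] has at least two blocks and is not good, which rules out [d Y = 0]. *)
have dY0 : 0 < d Y by case: (d Y) gY => //; lia.
have dX3 : 3 ^ (d Y + d Z) <= 3 ^ d X by rewrite leq_exp2l.
move: gX; rewrite /good_set => gX'.
(* If [d Z = 0], then [Z] is a single block [z] without boundary edges. By its choice [b1] has none
   either, so [b1] and [z] form a good set of two blocks, smaller than [X]. *)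
case: (posnP (d Z)) => [dZ0|dZ0]; last by have := leq_pow3D dY0 dZ0; lia.
have nZ1 : size R <= 1 by rewrite -(nb_sub uR Rs) -/Z; rewrite dZ0 in gZ.
have nZ0 : 0 < size R by rewrite -(nb_sub uR Rs) -/Z; lia.
have [z eR] : exists z, R = [:: z].
  by move: nZ0 nZ1; case: (R) => [|z []] //; exists z.
have zR : z \in R by rewrite eR mem_head.
move: (zR); rewrite mem_filter => /andP[zc zB].
have dz : d (bset z) = 0 by rewrite -dZ0 /Z eR /= cats0.
have db1 := z1 z zB dz.
have Ws : {subset [:: b1; z] <= bs} by move=> b; rewrite !inE => /orP[]/eqP->; apply: subB.
have uW : uniq [:: b1; z] by rewrite /= inE andbT; apply: contraNneq zc => <-.
have dW : d (bset (flatten [:: b1; z])) = 0.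
  rewrite !bset_cons (_ : bset (flatten [::]) = set0); last by apply/setP => v; rewrite !inE.
  rewrite setU0; have h := cutd_sub (bset b1) (bset z); rewrite db1 dz in h.
  by apply/eqP; rewrite -leqn0; apply: leq_trans (leq_addr _ _) h.
have := minX (sat_sub Ws); rewrite /good_set dW (nb_sub uW Ws) => /(_ isT) /= h.
by have := leq_trans js h.
Qed.
End Reach.

Lemma first_good : 1 < size bs -> exists c l,
  filter (good es) (cands N es bs) = c :: l /\
  [/\ uniq c, {subset c <= bs}, 1 < size c, size c <= M
    & titanic d P (bset (flatten c)) /\ d (bset (flatten c)) <= w].
Proof.
move=> bs1.
have [|Y [sY gY leY]] := exists_good (@cutd_sym G) (@cutd_0 G) blk_part carvable_bs.
  by rewrite nbT.
pose Q k := boolp.asbool (exists X, [/\ sat P X, good_set d P X & nb P X = k]).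
have exQ : exists k, Q k by exists (nb P Y); apply/boolp.asboolP; exists Y.
have [s /boolp.asboolP[X [sX gX eX]] mX] := ex_minnP exQ.
have {}mX Z : sat P Z -> good_set d P Z -> s <= nb P Z.
  by move=> sZ gZ; apply: mX; apply/boolp.asboolP; exists Z.
have sM : s <= M by apply: leq_trans (mX Y sY gY) leY.
have s1 : 1 < s by rewrite -eX; apply: leq_ltn_trans gX; rewrite expn_gt0.
have [||c0 c0a c0X] := reach sX gX; rewrite ?eX //.
rewrite eX in c0a.
have sbs : s <= size bs.
  by rewrite -eX -(inside_set sX) nb_sub ?size_filter ?count_size ?filter_uniq ?bs_uniq //
    => b; rewrite mem_filter => /andP[].
have [r er] := @acc_prefix (s - 2) (size bs) (leq_trans (leq_subr _ _) sbs).
have gc0 : good es c0.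
  have [u0 cs0 z0 _] := acc_cand c0a.
  by rewrite goodE // ?c0X ?eX //; [move: gX; rewrite /good_set eX | apply: ltnW].
(* The sets in [acc i] have at most i + 2 blocks, so that the first good candidate,
   which lies in [acc (s - 2)], has the minimal size s. *)
case E: (filter (good es) (acc (s - 2))) => [|c l].
  have h : c0 \in filter (good es) (acc (s - 2)) by rewrite mem_filter gc0.
  by rewrite E in h.
exists c, (l ++ filter (good es) r); split.
  by rewrite /cands -/(acc (size bs)) er filter_cat E.
have := mem_head c l; rewrite -E mem_filter => /andP[gc ca].
have [uc cs c1 c2] := acc_cand ca.
have gc' : good_set d P (bset (flatten c)) by rewrite /good_set -goodE // ltnW.
have nc : nb P (bset (flatten c)) = size c by rewrite nb_sub.
have ec : size c = s.
  by apply/eqP; rewrite eqn_leq -{2}nc mX // ?andbT; [lia | apply: sat_sub].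
split=> //; first by rewrite ec.
split.
  apply: (min_good_titanic (@cutd_0 G) blk_part (sat_sub cs) gc').
  by move=> Z sZ gZ; rewrite nc ec; apply: mX.
move: gc'; rewrite /good_set nc ec => h.
(* The size is at most 2 * 3 ^ w, which is below 3 ^ (w + 1); so the new block has at most [w]
   boundary edges and can be a leaf of the carving. *)
have : 3 ^ d (bset (flatten c)) < 3 ^ w.+1 by rewrite expnS; rewrite /M in sM; lia.
by rewrite ltn_exp2l.
Qed.

Lemma contract_blocks c : uniq c -> {subset c <= bs} -> 1 < size c ->
  titanic d P (bset (flatten c)) -> d (bset (flatten c)) <= w ->
  let bs' := flatten c :: filter (fun b => b \notin c) bs in
  [/\ perm_eq (flatten bs') (iota 0 n), [::] \notin bs', carvable d (blk bs') w setT
    & size bs' < size bs].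
Proof.
move=> uc cs c1 tc dc bs'.
have pc : perm_eq (c ++ filter (fun b => b \notin c) bs) bs.
  have h := permEl (perm_filterC (mem c) bs); apply: perm_trans h; rewrite perm_cat2r.
  apply: uniq_perm => //; first by rewrite filter_uniq // bs_uniq.
  by move=> b; rewrite mem_filter; apply/idP/andP => [bc|[]//]; split=> //; apply: cs.
have fc0 : flatten c != [::].
  case: c c1 cs {uc tc dc bs' pc} => // b c _ cs /=.
  apply: contra nil_bs; case: b cs => [|x b] cs //= _.
  by apply: cs; apply: mem_head.
split.
- apply: perm_trans perm_bs; rewrite /bs' /= -flatten_cat.
  exact: perm_flatten.
- rewrite inE negb_or eq_sym fc0 /=; apply: contra nil_bs.
  by rewrite mem_filter => /andP[].
- have covc : cover (blk c) = bset (flatten c).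
    apply/setP => v; rewrite inE; apply/bigcupP/flattenP => [[B]|[b bc vb]].
      by rewrite inE => /mapP[b bc ->]; rewrite inE => vb; exists b.
    by exists (bset b); rewrite inE ?map_f.
  have -> : blk bs' = cover (blk c) |: (P :\: blk c).
    apply/setP => B'; rewrite covc !inE /=; case: eqP => //= _.
    apply/mapP/andP => [[b]|[h /mapP[b bb e]]].
      rewrite mem_filter => /andP[bc bb] ->; split; last exact: map_f.
      apply: contra bc => /mapP[b' bc' e].
      by rewrite (bset_inj bb (cs _ bc') e).
    exists b => //; rewrite mem_filter bb andbT; apply: contra h => bc.
    by rewrite e map_f.
  apply: carvable_contract; rewrite ?covc //.
  + exact: cutd_sym.
  + exact: cutd_sub.
  + exact: cutd_0.
  + exact: blk_part.
  + by apply/subsetP => B'; rewrite !inE => /mapP[b bc ->]; rewrite map_f // cs.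
- by rewrite /= -(perm_size pc) size_cat -[_.+2]add2n leq_add2r.
Qed.
End Blocks.
End Progress.

(** * Termination *)

Section Termination.
Variables (G : cgraph) (C1 : config G) (may must : edge G -> bool) (w N : nat).
Let es := items C1 may must.
Let n := sg_order G.
Let m := size (enum {: edge G}).
Let M := 2 * 3 ^ w.
Let D := M * w.
Let R := rel_bound D m.

(** One summand for each use of fuel: the relations, the state after a contraction, and the list of
    candidates. *)
Definition fuel_bound : nat := R + state_bound n R + cand_bound G w.
Hypothesis fuelN : fuel_bound <= N.

Let RN : R <= N.
Proof. by apply: leq_trans fuelN; rewrite /fuel_bound -addnA leq_addr. Qed.

Let SN : state_bound n R <= N.
Proof. by apply: leq_trans fuelN; rewrite /fuel_bound addnAC leq_addl. Qed.

Let CN : cand_bound G w <= N.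
Proof. by apply: leq_trans fuelN; rewrite /fuel_bound leq_addl. Qed.

Definition carved (ps : seq part) : Prop :=
  [/\ perm_eq (flatten (map fst ps)) (iota 0 n), [::] \notin map fst ps,
      carvable (@cutd G) (blk G (map fst ps)) w setT
    & all (fun p : part => esize p.2 <= R) ps].

Lemma ids_lt (l : seq eitem) : {subset l <= es} -> all (fun x => x < m) (map eid l).
Proof.
move=> ls; rewrite all_map; apply/allP => x /ls /mapP[e _ ->] /=.
by rewrite /eid /edge_rank index_mem mem_enum.
Qed.

Lemma onestep_progress ps : carved ps -> 1 < size ps ->
  carved (onestep N es ps) /\ size (onestep N es ps) < size ps.
Proof.
move=> [pe ne cT aR] s1.
have s1' : 1 < size (map fst ps) by rewrite size_map.
have [c [l [E [uc cs c1 cM [tc dc]]]]] := first_good C1 may must pe ne cT CN s1'.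
(* At most [M] blocks with at most [w] boundary edges each. *)
have sl : size (letters es c) <= D.
  apply: leq_trans (size_letters _ _) _; apply: (@leq_trans (\sum_(b <- c) w)).
    rewrite big_seq [leqRHS]big_seq; apply: leq_sum => b /cs bb.
    by rewrite size_cross; exact: (block_d pe ne cT bb).
  by rewrite big_const_seq count_predT iter_addn_0 mulnC leq_mul2r cM orbT.
have lm : all (fun x => x < m) (letters es c).
  by apply: ids_lt => e; rewrite mem_filter => /andP[].
have eA : arrangements N (letters es c) = free_arr (letters es c).
  exact: arrangements_free RN sl lm.
have [h1 h2 h3 h4] := contract_blocks pe ne cT uc cs c1 tc dc.
rewrite /onestep E /contract eA (negbTE (free_arr_nil _)).
set ps' := merged _ _ _ _.
have bsE : map fst ps' = flatten c :: filter (fun b => b \notin c) (map fst ps).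
  by rewrite /= filter_map.
have inv' : carved ps'.
  split; rewrite ?bsE //=; apply/andP; split.
    by apply: leq_trans (esize_joined _ _ _ _) _; apply: esize_free_arr sl lm.
  by apply/allP => p; rewrite mem_filter => /andP[_]; apply: (allP aR).
rewrite fitsE (leq_trans (esize_state _ _ _) SN); try by have [] := inv'.
by split=> //; rewrite -(size_map fst) bsE -(size_map fst ps).
Qed.

Lemma onestep_small ps : size ps <= 1 -> onestep N es ps = ps.
Proof.
have E bs : pairs bs = [::] -> cands N es bs = [::].
  move=> h; rewrite /cands h; elim: (size bs) => //= i ->.
  by rewrite /growstep /grow /=; case: ifP.
case: ps => [|p [|//]] _; rewrite /onestep E //.
by rewrite /pairs /= eqxx.
Qed.

(** While two blocks are left, each round removes at least one, so as many rounds as initial blocks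
    suffice. *)
Lemma run_small ps : carved ps -> size (run N es ps) <= 1.
Proof.
move=> ips; rewrite /run.
suff H i : carved (iter i (onestep N es) ps) /\
    size (iter i (onestep N es) ps) <= maxn 1 (size ps - i).
  by have [_] := H (size ps); rewrite subnn.
elim: i => [|i [IH1 IH2]]; first by rewrite subn0 leq_maxr.
rewrite iterS; case: (leqP (size (iter i (onestep N es) ps)) 1) => h.
  by rewrite onestep_small //; split=> //; apply: leq_trans h _; rewrite leq_maxl.
have [h1 h2] := onestep_progress IH1 h; split=> //.
move: (size _) (size _) (size ps) h h2 IH2 => a b s; lia.
Qed.

Lemma decide_total (fs : seq (seq bool)) : 0 < n -> size fs = n ->
  carvable (@cutd G) (singletons G) w setT -> decide N es fs != [::].
Proof.
move=> n0 sfs cT.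
have bsE : map fst (parts0 N es fs) = map (fun v => [:: v]) (iota 0 n).
  rewrite /parts0 -map_comp.
  rewrite (eq_map (g := (fun v => [:: v]) \o fst)); last by [].
  by rewrite map_comp -/(unzip1 _) unzip1_zip ?size_iota // sfs.
have fl : flatten (map (fun v => [:: v]) (iota 0 n)) = iota 0 n.
  by elim: (iota 0 n) => //= x l ->.
have pe : perm_eq (flatten (map fst (parts0 N es fs))) (iota 0 n) by rewrite bsE fl.
have ne : [::] \notin map fst (parts0 N es fs) by rewrite bsE; apply/mapP => -[].
have eB : blk G (map fst (parts0 N es fs)) = singletons G.
  apply/setP => B; rewrite bsE !inE; apply/mapP/imsetP => [[b /mapP[v]]|[v _ ->]].
    rewrite mem_iota => vn -> ->; exists (Ordinal vn) => //.
    by apply/setP => u; rewrite !inE -val_eqE.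
  exists [:: val v]; first by rewrite map_f // mem_iota ltn_ord.
  by apply/setP => u; rewrite !inE -val_eqE.
have cT' : carvable (@cutd G) (blk G (map fst (parts0 N es fs))) w setT by rewrite eB.
have sc v : v < n -> size (cross es [:: v]) <= D.
  move=> vn; rewrite size_cross; apply: (@leq_trans w); last first.
    by rewrite /D leq_pmull // muln_gt0 expn_gt0.
  by apply: (block_d pe ne cT'); rewrite bsE map_f // mem_iota.
have lm v : all (fun x => x < m) (cross es [:: v]).
  by apply: ids_lt => e; rewrite mem_filter => /andP[].
have eA v : v < n -> arrangements N (cross es [:: v]) = free_arr (cross es [:: v]).
  by move=> vn; apply: arrangements_free RN (sc v vn) (lm v).
rewrite /decide; case: ifP => [/hasP[v]|_].
  by rewrite mem_iota sfs => vn; rewrite eA // (negbTE (free_arr_nil _)).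
rewrite run_small //; split=> //.
apply/allP => p /mapP[vf vfz ->] /=; apply: leq_trans (esize_filter _ _) _.
have vn : vf.1 < n.
  have : vf.1 \in unzip1 (zip (iota 0 (size fs)) fs) by apply: map_f.
  by rewrite unzip1_zip ?size_iota // mem_iota sfs.
by rewrite eA //; apply: esize_free_arr (sc _ vn) (lm _).
Qed.
End Termination.

(** The graph without vertices has no carving, since carvable sets are nonempty; it is decided with
    any fuel. *)
Lemma decide_total0 N es : decide N es [::] != [::].
Proof. by []. Qed.

(** * The running time *)

(** The three summands match those of [fuel_bound] after splitting off L ^ 4 for the input size L,
    with constants rounded up. The fourth power stems from n * n starting pairs times blocks of size
    quadratic in n. *)
Definition fuel_factor (w : nat) : nat :=
  let M := 2 * 3 ^ w in
  let D := M * w in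
  (D + 2) ^ D * (4 * D + 3) + ((D + 2) ^ D * (4 * D + 3) + 20) +
  ((D + 1) ^ M * (6 * M + 10) + 10).

(** For k the sum of treewidth and maximum degree, (k + 1) * k is at least the width of the carving;
    [carvable_mono] permits the larger value. *)
Definition fpt_factor (k : nat) : nat := fuel_factor ((k + 1) * k).

Lemma CT_fpt_factor : CT fpt_factor.
Proof.
rewrite /fpt_factor /fuel_factor.
by do ![apply: CT_addn | apply: CT_muln | apply: CT_expn | apply: CT_const | apply: CT_id].
Qed.

Lemma fuel_bound_le (G : cgraph) w L : 0 < L ->
  sg_order G <= L -> size (enum {: edge G}) <= L ->
  fuel_bound G w <= fuel_factor w * L ^ 4.
Proof.
move=> L0 nL mL; rewrite /fuel_factor; set M := 2 * 3 ^ w; set D := M * w.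
rewrite /fuel_bound /cand_bound /state_bound /block_bound /rel_bound -/M -/D.
move: (sg_order G) (size (enum _)) nL mL => n m nL mL.
set A := (D + 2) ^ D; set B := (D + 1) ^ M.
have A0 : 0 < A by rewrite expn_gt0 addn2.
have B0 : 0 < B by rewrite expn_gt0 addn1.
have L1 : L <= L ^ 4 by rewrite -{1}(expn1 L) leq_pexp2l.
have L2 : L ^ 2 <= L ^ 4 by rewrite leq_pexp2l.
have L3 : L ^ 3 <= L ^ 4 by rewrite leq_pexp2l.
have L4 : 0 < L ^ 4 by rewrite expn_gt0 L0.
set R := (A * _).+1.
have hR : R <= A * (4 * D + 3) * L.
  rewrite /R; apply: (@leq_trans (A * ((D * (4 * L)) + 2 * L) + L)).
    rewrite -addn1 leq_add // leq_mul2l; apply/orP; right.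
    have : D * m.*2.+2 <= D * (4 * L) by rewrite leq_mul2l; apply/orP; right; lia.
    lia.
  have : L <= A * L by rewrite leq_pmull.
  by clearbody A D; clear; nia.
have hB : (n * n.*2.+2).+1 <= 5 * L ^ 2.
  have : n * n.*2.+2 <= L * (4 * L) by rewrite leq_mul //; lia.
  have : L <= L ^ 2 by rewrite -{1}(expn1 L) leq_pexp2l.
  by rewrite -mulnn; lia.
have hS : (n * ((n * n.*2.+2).+1 + R).+2).+1 <= (A * (4 * D + 3) + 20) * L ^ 4.
  apply: (@leq_trans (L * (5 * L ^ 2 + A * (4 * D + 3) * L + 2) + L ^ 4)).
    rewrite -addn1 leq_add // leq_mul //; lia.
  have e1 : L * L ^ 2 = L ^ 3 by rewrite -expnS.
  set K := A * (4 * D + 3).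
  have e2 : L * (K * L) = K * L ^ 2 by rewrite mulnCA mulnn.
  have : K * L ^ 2 <= K * L ^ 4 by rewrite leq_mul2l L2 orbT.
  rewrite mulnDl; move: (K * L ^ 4) => X.
  rewrite !mulnDr e2 mulnCA e1; move: (L ^ 3) (L ^ 4) (K * L ^ 2) L1 L3 => P3 P4 Q.
  by clear; lia.
have hC : (n * n * B * ((M * ((n * n.*2.+2).+1).+1).+1).+1).+1 <= (B * (6 * M + 10) + 10) * L ^ 4.
  apply: (@leq_trans (L ^ 2 * B * (M * (6 * L ^ 2) + 2 * L ^ 2) + L ^ 4)).
    have L20 : 0 < L ^ 2 by rewrite expn_gt0 L0.
    rewrite -addn1 leq_add // leq_mul //.
      by rewrite leq_mul2r -mulnn leq_mul ?orbT.
    have : M * ((n * n.*2.+2).+1).+1 <= M * (6 * L ^ 2).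
      by rewrite leq_mul2l; apply/orP; right; lia.
    lia.
  have e : L ^ 2 * L ^ 2 = L ^ 4 by rewrite -expnD.
  have -> : L ^ 2 * B * (M * (6 * L ^ 2) + 2 * L ^ 2) = B * (6 * M + 2) * (L ^ 2 * L ^ 2) by nia.
  rewrite e mulnDl; have : B * (6 * M + 2) * L ^ 4 <= B * (6 * M + 10) * L ^ 4.
    by rewrite leq_mul2r leq_mul2l; apply/orP; right; apply/orP; right; lia.
  lia.
rewrite 2!mulnDl; apply: leq_add hC; apply: leq_add hS.
by apply: leq_trans hR _; rewrite leq_mul2l L1 orbT.
Qed.

Lemma total_fuel (G : cgraph) (C1 : config G) may must (L : nat) : 0 < L ->
  sg_order G <= L -> size (enum {: edge G}) <= L ->
  exists2 N, N <= fpt_factor (treewidth G + max_degree G) * L ^ 4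
    & decide N (items C1 may must) (graph_input G).1 <> [::].
Proof.
move=> L0 nL mL; set k := treewidth G + max_degree G; pose w := (k + 1) * k.
exists (fuel_bound G w); first exact: fuel_bound_le.
apply/eqP; case: (posnP (sg_order G)) => n0.
  rewrite (_ : (graph_input G).1 = [::]) ?decide_total0 //; apply: size0nil.
  by rewrite size_map size_enum_ord.
apply: decide_total => //; first by rewrite size_map size_enum_ord.
apply: carvable_mono (carvable_treewidth n0); rewrite /w /k leq_mul //; last exact: leq_addl.
by rewrite addn1 ltnS leq_addr.
Qed.

Lemma graph_input_size (G : cgraph) :
  sg_order G <= esize (graph_input G) /\ size (enum {: edge G}) <= esize (graph_input G).
Proof.
rewrite esize_pair; split; apply: leqW.
  apply: leq_trans _ (leq_addr _ _); apply: leq_trans _ (ltnW (size_esize _)).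
  by rewrite size_map size_enum_ord.
apply: leq_trans _ (leq_addl _ _); apply: leq_trans _ (ltnW (size_esize _)).
by rewrite [X in _ <= X]size_map.
Qed.

Theorem theorem12 :
  fpt (P := bounded_C2E_NCL)
      (fun I : c2e_instance => treewidth (c2e_graph I) + max_degree (c2e_graph I))
  /\
  fpt (P := bounded_C2C_NCL)
      (fun I : c2c_instance => treewidth (c2c_graph I) + max_degree (c2c_graph I)).
Proof.
split.
- apply: (fpt_search (P := bounded_C2E_NCL) (inp := c2e_in) (D := fun x N => decide N (c2e_items x) x.1.1) (g := fpt_factor) (c := 4)).
  + exact: c2e_encode.
  + exact: PT_c2e.
  + exact: c2e_correct.
  + exact: CT_fpt_factor.
  + move=> I; rewrite c2e_itemsE.
    have [h1 h2] := graph_input_size (c2e_graph I).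
    apply: total_fuel; first exact: esize_gt0.
      by rewrite esize_pair; apply: leq_trans h1 _; rewrite leqW // leq_addr.
    by rewrite esize_pair; apply: leq_trans h2 _; rewrite leqW // leq_addr.
- apply: (fpt_search (P := bounded_C2C_NCL) (inp := c2c_in) (D := fun x N => decide N (c2c_items x) x.1.1) (g := fpt_factor) (c := 4)).
  + exact: c2c_encode.
  + exact: PT_c2c.
  + exact: c2c_correct.
  + exact: CT_fpt_factor.
  + move=> I; rewrite c2c_itemsE.
    have [h1 h2] := graph_input_size (c2c_graph I).
    apply: total_fuel; first exact: esize_gt0.
      by rewrite esize_pair; apply: leq_trans h1 _; rewrite leqW // leq_addr.
    by rewrite esize_pair; apply: leq_trans h2 _; rewrite leqW // leq_addr.
Qed.
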